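(* For every Latinon $(W,f)$ over $\Omega$ there exists a sequence $(L_n)_{n\in\mathbb N}$ of Latin squares such that $L_n$ left-converges to $(W,f)$, i.e. $\lim_{n\to\infty}t(A,L_n)=t(A,(W,f))$ for every $k,\ell\in\mathbb N$ and every $A\in\mathcal R(k,\ell)$.
   Context: A Latin square of order $n$ is an $n\times n$ matrix with entries in $[n]=\{1,\dots,n\}$ in which every row and every column contains each value exactly once. $(\Omega,\mu)$ is a separable atomless probability space, $\lambda$ is Lebesgue measure on $[0,1]$, $\mathcal B$ the set of Borel probability measures on $[0,1]$. A permuton is a Borel probability measure on $[0,1]^2$ with both marginals equal to $\lambda$. A Latinon over $\Omega$ is a pair $(W,f)$, $W:\Omega^2\to\mathcal B$ measurable, $f:\Omega\to[0,1]$ measure preserving, such that for a.e. $x$ the measure $S\times T\mapsto\int_{f^{-1}(S)}W(x,y)(T)\,d\mu(y)$ and for a.e. $y$ the measure $S\times T\mapsto\int_{f^{-1}(S)}W(x,y)(T)\,d\mu(x)$ are permutons. $\mathcal R(k,\ell)$ is the set of $k\times\ell$ matrices with entries in $[k\ell]$, each value appearing exactly once. For a real matrix $A$ let $p_A$ assign to each entry value its rank among the distinct values of $A$; real $k\times\ell$ matrices $A,B$ are structurally equivalent ($A\equiv B$) if $p_A(a_{i,j})=p_B(b_{i,j})$ for all $i,j$; $\mathcal R^A(S)=\{M\in S^{k\times\ell}:M\equiv A\}$. For a Latin square $L$ of order $n\ge k,\ell$ and $A\in\mathcal R(k,\ell)$, $t(A,L)=\binom nk^{-1}\binom n\ell^{-1}\sum_{\mathbf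 x,\mathbf y}\mathbb 1[L|_{(\mathbf x,\mathbf y)}\equiv A]$, where the sum is over strictly increasing $\mathbf x\in[n]^k$, $\mathbf y\in[n]^\ell$ and $L|_{(\mathbf x,\mathbf y)}$ is the $k\times\ell$ submatrix of $L$ with rows $\mathbf x$ and columns $\mathbf y$. For a Latinon, $t(A,(W,f))=k!\ell!\int_{\Omega^k_{<_f}}\int_{\Omega^\ell_{<_f}}\big(\bigotimes_{i,j}W(x_i,y_j)\big)(\mathcal R^A([0,1]))\,d\mathbf y\,d\mathbf x$, where $\Omega^k_{<_f}=\{(x_1,\dots,x_k): f(x_1)<\dots<f(x_k)\}$. *)

(* Defs.v *)
From HB Require Import structures.
From mathcomp Require Import all_boot all_order all_algebra.
From mathcomp Require Import all_classical all_reals all_analysis.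
Import Order.TTheory GRing.Theory Num.Theory.
Import numFieldNormedType.Exports.

Set Implicit Arguments.
Unset Strict Implicit.
Unset Printing Implicit Defensive.

Local Open Scope classical_set_scope.
Local Open Scope ring_scope.

(* The set [n] = {1, ..., n} is encoded as 'I_n = {0, ..., n.-1}; only the
   relative order of entries matters for patterns. *)

Definition latin_square (n : nat) (L : 'M['I_n]_n) : Prop :=
  [/\ (0 < n)%N,
      forall i v, exists! j, L i j = v
    & forall j v, exists! i, L i j = v].

(* The set R(k,l). *)
Definition pattern (k l : nat) (A : 'M['I_(k * l)]_(k, l)) : Prop :=
  forall v, exists! p : 'I_k * 'I_l, A p.1 p.2 = v.

(* Stated over any totally ordered type so as to apply both to real matrices
   and to matrices with entries in [n]. *)
Section structural_equivalence.
Local Open Scope order_scope.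

Definition entries d (T : orderType d) k l (A : 'M[T]_(k, l)) : seq T :=
  undup [seq A p.1 p.2 | p <- enum {: 'I_k * 'I_l}].

Definition entry_rank d (T : orderType d) k l (A : 'M[T]_(k, l)) (v : T) : nat :=
  count (fun w => w <= v) (entries A).

Definition struct_equiv d (T : orderType d) d' (T' : orderType d') k l
    (A : 'M[T]_(k, l)) (B : 'M[T']_(k, l)) : bool :=
  [forall i, forall j, entry_rank A (A i j) == entry_rank B (B i j)].

End structural_equivalence.

Definition incr (k n : nat) (x : {ffun 'I_k -> 'I_n}) : bool :=
  [forall i : 'I_k, forall j : 'I_k, (i < j)%N ==> (x i < x j)%N].

Definition density (R : realType) k l (A : 'M['I_(k * l)]_(k, l))
    n (L : 'M['I_n]_n) : R :=
  ('C(n, k)%:R)^-1 * ('C(n, l)%:R)^-1 *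
  \sum_(x : {ffun 'I_k -> 'I_n} | incr x)
    \sum_(y : {ffun 'I_l -> 'I_n} | incr y)
      (struct_equiv (mxsub x y L) A)%:R.

(* The measure P_0 (x) ... (x) P_(n.-1) on T^n. *)
Section finite_product.
Context d (T : measurableType d) (R : realType).

Definition tcons n (p : T * n.-tuple T) : n.+1.-tuple T :=
  [the n.+1.-tuple T of p.1 :: p.2].

Lemma measurable_tcons n : measurable_fun [set: T * n.-tuple T] (@tcons n).
Proof. exact: measurable_cons. Qed.

HB.instance Definition _ n :=
  isMeasurableFun.Build _ _ _ _ (@tcons n) (@measurable_tcons n).

Fixpoint prod_prob n : ('I_n -> probability T R) -> probability (n.-tuple T) R :=
  match n with
  | 0 => fun=> dirac [tuple]
  | m.+1 => fun P =>
      distribution (P ord0 \x prod_prob (fun i => P (lift ord0 i)))%E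
        (@tcons m)
  end.

End finite_product.

Section measure_spaces.
Context (R : realType) d (Omega : measurableType d) (mu : probability Omega R).
Local Open Scope ereal_scope.

Definition atomless : Prop :=
  forall A, measurable A -> 0 < mu A ->
    exists B, [/\ measurable B, B `<=` A, 0 < mu B & mu B < mu A].

(* Separability of the measure algebra for the pseudometric mu (A `+` B),
   where `+` is symmetric difference. *)
Definition separable : Prop :=
  exists D : nat -> set Omega, (forall n, measurable (D n)) /\
    forall A, measurable A -> forall e : R, (0 < e)%R ->
      exists n, mu (A `+` D n) < e%:E.

End measure_spaces.

(* Lebesgue measure on [0,1], viewed as a Borel measure on the real line.
   Throughout, a measure on [0,1] or [0,1]^2 is represented by the Borel
   measure on R or R^2 that it induces, which is carried by [0,1] or [0,1]^2. *)
Definition lambda01 (R : realType) (S : set R) : \bar R :=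
  lebesgue_measure (S `&` `[0, 1]).

Definition permuton (R : realType) (pi : probability (R * R)%type R) : Prop :=
  forall S : set R, measurable S ->
    pi (S `*` setT) = lambda01 S /\ pi (setT `*` S) = lambda01 S.

(* [pprobability] carries the sigma-algebra generated by the evaluations
   P |-> P T, which is the Borel sigma-algebra of the weak topology. *)
Record latinon (R : realType) d (Omega : measurableType d)
    (mu : probability Omega R)
    (W : Omega * Omega -> pprobability R R) (f : Omega -> R) : Prop := Latinon {
  latinon_measurable : measurable_fun setT W ;
  latinon_unit : forall p, W p `[0, 1]%classic = 1%E ;
  latinon_fun_measurable : measurable_fun setT f ;
  latinon_fun_unit : forall x, 0 <= f x <= 1 ;
  latinon_fun_preserving : forall S : set R, measurable S ->
    mu (f @^-1` S) = lambda01 S ;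
  latinon_row : {ae mu, forall x, exists2 pi : probability (R * R)%type R, permuton pi &
    forall S T : set R, measurable S -> measurable T ->
      pi (S `*` T) = (\int[mu]_(y in f @^-1` S) W (x, y) T)%E} ;
  latinon_col : {ae mu, forall y, exists2 pi : probability (R * R)%type R, permuton pi &
    forall S T : set R, measurable S -> measurable T ->
      pi (S `*` T) = (\int[mu]_(x in f @^-1` S) W (x, y) T)%E} }.

Section latinon_density.
Context (R : realType) d (Omega : measurableType d) (mu : probability Omega R).
Variables (W : Omega * Omega -> pprobability R R) (f : Omega -> R).

Definition ordered_tuples k : set (k.-tuple Omega) :=
  [set x | forall i j : 'I_k, (i < j)%N -> f (tnth x i) < f (tnth x j)].

Definition mx_of_tuples k l (M : k.-tuple (l.-tuple R)) : 'M[R]_(k, l) :=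
  \matrix_(i, j) tnth (tnth M i) j.

(* The set R^A(S). *)
Definition realizations k l (A : 'M['I_(k * l)]_(k, l)) (S : set R) :
    set 'M[R]_(k, l) :=
  [set M : 'M[R]_(k, l) | (forall i j, S (M i j)) /\ struct_equiv M A].

Definition entry_prob k l (x : k.-tuple Omega) (y : l.-tuple Omega) :
    probability (k.-tuple (l.-tuple R)) R :=
  prod_prob (fun i => prod_prob (fun j => W (tnth x i, tnth y j))).

Definition latinon_density k l (A : 'M['I_(k * l)]_(k, l)) : \bar R :=
  ((k`! * l`!)%:R%:E *
   \int[prod_prob (fun _ : 'I_k => mu)]_(x in @ordered_tuples k)
     \int[prod_prob (fun _ : 'I_l => mu)]_(y in @ordered_tuples l)
       entry_prob x y (@mx_of_tuples k l @^-1` realizations A `[0%R, 1%R]%classic))%E.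

End latinon_density.

(* The first clause makes t(A, L_m) well defined for all large m, for each
   pattern A: t(A, L) is defined only if L has order at least k and l. *)
Definition left_converges (R : realType) d (Omega : measurableType d)
    (mu : probability Omega R) (n : nat -> nat) (L : forall m, 'M['I_(n m)]_(n m))
    (W : Omega * Omega -> pprobability R R) (f : Omega -> R) : Prop :=
  n @ \oo --> \oo /\
  forall k l (A : 'M['I_(k * l)]_(k, l)), (0 < k)%N -> (0 < l)%N -> pattern A ->
    (density R A (L m))%:E @[m --> \oo] --> latinon_density mu W f A.

(* Main.v *)
(* Cut [0,1] into q intervals ("classes") and sample p rows and p columns of
   the Latinon independently, sorted by f.  A second moment computation shows
   that for some sample the array w(a,b,c) of class probabilities has pattern
   densities close to those of (W,f), and nearly uniform row and column
   averages; as the averages are those of an exact triply stochastic array up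
   to a small error, w can be rounded to an integer array d(a,b,c) all of whose
   line sums are constant.  Give type a the s^p rows (a,x) with x in (Z/s)^p,
   and similarly for columns, and colour the cell ((a,x),(b,y)) by the class of
   x_b + y_b in a partition of Z/s with part sizes d(a,b,.).  The coordinates
   x_b are independent for distinct b, so the colours of the cells of a
   submatrix meeting distinct types are exactly independent with
   distribution d(a,b,.)/s.  Each colour is a regular bipartite
   graph, hence splits into perfect matchings by Hall's theorem, and using one
   symbol per matching gives a Latin square in which each cell has a symbol in
   the block of its colour.  Patterns having two entries in the same class have
   density O(1/q), so letting q tend to infinity gives the theorem. *)
Require Import Defs.
From HB Require Import structures.
From mathcomp Require Import all_boot all_order all_algebra.
From mathcomp Require Import all_classical all_reals all_analysis.
From mathcomp Require Import measurable_realfun.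
From mathcomp Require Import ring lra zify.
Import Order.TTheory GRing.Theory Num.Theory.
Import numFieldNormedType.Exports.

Set Implicit Arguments.
Unset Strict Implicit.
Unset Printing Implicit Defensive.

(** * Regular bipartite graphs and Latin squares *)

(** Two obstacles shape the argument. Every line of a Latin square is exactly equidistributed,
    whereas a sample of the Latinon achieves this only on average; hence the chain of repairs:
    replace the few bad lines, project, take integer parts. And the block construction controls only
    submatrices whose row types, and whose column types, are distinct, so it bounds the frequency of
    a set of colour patterns from below only. The upper bound comes from the same lower bound for
    the complementary set: the weights of all colour patterns add up to almost 1. In the colour of a
    cell, [x_b] gives independence: each row has its own [x], and distinct column types read
    distinct coordinates. The term [y_b] makes the rows regular: along the row [(a,x)], [x_b] alone
    would be the same for all columns of type [b]. The parameters are chosen in the order [q], then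
    the tolerance [delta], then the number [p] of sampled lines. Errors are multiplied by the number
    of colour patterns, a power of [q], which is harmless because [q] is fixed before [delta]. *)

Section bipartite.
Import mathcomp.boot.finset mathcomp.boot.fintype.
Variable T : finType.
Implicit Types (G : T -> T -> bool) (A B S : {set T}).

Definition neighbours G S : {set T} := [set u | [exists t in S, G t u]].

Lemma neighboursU G S S' :
  neighbours G (S :|: S') = neighbours G S :|: neighbours G S'.
Proof.
apply/setP=> u; rewrite !inE; apply/existsP/orP.
  move=> [t /andP[]]; rewrite inE => /orP[tS|tS] tu;
    by [left; apply/existsP; exists t; rewrite tS|right; apply/existsP; exists t; rewrite tS].
by move=> [/existsP[t /andP[tS tu]]|/existsP[t /andP[tS tu]]]; exists t; rewrite inE tS ?orbT.
Qed.

Lemma neighbours_sub G S S' : S \subset S' -> neighbours G S \subset neighbours G S'.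
Proof. by move=> /setUidPr <-; rewrite neighboursU subsetUl. Qed.

(* Hall's theorem relative to a set B of admissible partners, the form that
   passes through the induction. *)
Lemma hall_sub G A B :
  (forall S, S \subset A -> #|S| <= #|neighbours G S :&: B|) ->
  exists f : T -> T, {in A &, injective f} /\
    {in A, forall t, G t (f t) && (f t \in B)}.
Proof.
have [n] := ubnP #|A|; elim: n A B => // n IHn A B An hallA.
have [A0|/set0Pn[t0 t0A]] := eqVneq A set0.
  by exists id; split=> t; rewrite A0 inE.
(* If a nonempty proper [S] is tight, having exactly as many admissible neighbours as elements,
   match [S] into them and [A :\: S] into the rest of [B]. Otherwise every such [S] has a neighbour
   to spare, and any one edge can be removed. *)
have [/existsP[S /and4P[SA Sne SneA /eqP ScardE]]|] :=
  boolP [exists S : {set T}, [&& S \subset A, S != set0, S != A &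
           #|S| == #|neighbours G S :&: B|]].
- have SpA : S \proper A by rewrite properEneq SneA SA.
  have Slt := proper_card SpA.
  have [||f [finj fG]] := IHn S (neighbours G S :&: B).
  + by lia.
  + move=> S' S'S; rewrite setIA.
    by rewrite (setIidPl (neighbours_sub G S'S)); apply/hallA/(subset_trans S'S SA).
  have [||g [ginj gG]] := IHn (A :\: S) (B :\: neighbours G S).
  + rewrite cardsD (setIidPr SA).
    have : 0 < #|S| by rewrite card_gt0.
    by lia.
  + move=> S' S'AS.
    have [S'A S'S] := subsetDP S'AS.
    (* Apply Hall's condition to [S' :|: S] and subtract the tight part, whose neighbours are
       exactly what was removed from [B]. *)
    have := hallA (S' :|: S); rewrite subUset S'A SA => /(_ isT).
    rewrite neighboursU cardsU (disjoint_setI0 S'S) cards0 subn0.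
    rewrite setIUl cardsU -ScardE.
    rewrite setIACA setIid setIAC setIDA => le.
    have := cardsID (neighbours G S) (neighbours G S' :&: B).
    by move: le; lia.
  exists (fun t => if t \in S then f t else g t); split.
    move=> t u tA uA; case: ifPn => tS; case: ifPn => uS fE.
    + exact: finj.
    + have /andP[_] := fG t tS; rewrite fE inE => /andP[uN _].
      have := gG u; rewrite !inE uS uA => /(_ isT)/and3P[_].
      by move: uN; rewrite inE => ->.
    + have /andP[_] := fG u uS; rewrite -fE inE => /andP[uN _].
      have := gG t; rewrite !inE tS tA => /(_ isT)/and3P[_].
      by move: uN; rewrite inE => ->.
    + by apply: ginj => //; rewrite inE ?tS ?uS.
  move=> t tA; case: ifPn => tS.
    by have /andP[->] := fG t tS; rewrite inE => /andP[_ ->].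
  have := gG t; rewrite [_ \in A :\: S]inE tS tA => /(_ isT) /andP[->].
  by rewrite inE => /andP[_ ->].
- rewrite negb_exists => /forallP noS.
  have [u uN] : exists u, u \in neighbours G [set t0] :&: B.
    apply/set0Pn; rewrite -card_gt0.
    by apply: leq_trans (hallA [set t0] _); rewrite ?cards1 ?sub1set.
  move: uN; rewrite !inE => /andP[/existsP[t' /andP[]]].
  rewrite inE => /eqP -> t0u uB.
  have [||f [finj fG]] := IHn (A :\ t0) (B :\ u).
  + by move: An; rewrite (cardsD1 t0 A) t0A; lia.
  + move=> S SA; have [->|Sne] := eqVneq S set0; first by rewrite cards0.
    have SA' : S \subset A by apply: (subset_trans SA); exact: subsetDl.
    have SneA : S != A.
      by apply: contraTneq SA => ->; apply/subsetPn; exists t0 => //; rewrite !inE eqxx.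
    have := noS S; rewrite SA' Sne SneA /= => neq.
    have lt : #|S| < #|neighbours G S :&: B| by rewrite ltn_neqAle neq hallA.
    move: lt; rewrite setIDA (cardsD1 u (neighbours G S :&: B)).
    by case: (_ \in _); lia.
  exists (fun t => if t == t0 then u else f t); split.
    move=> t v tA vA; case: eqP => [->|/eqP tt0]; case: eqP => [->|/eqP vt0] // fE.
    + have /andP[_] := fG v (introT setD1P (conj vt0 vA)).
      by rewrite -fE !inE eqxx.
    + have /andP[_] := fG t (introT setD1P (conj tt0 tA)).
      by rewrite fE !inE eqxx.
    + by apply: finj; rewrite // !inE ?tt0 ?vt0.
  move=> t tA; case: eqP => [->|/eqP tt0]; first by rewrite t0u.
  have /andP[->] := fG t (introT setD1P (conj tt0 tA)).
  by rewrite !inE => /andP[_ ->].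
Qed.

Definition regular G D :=
  (forall t, #|[set u | G t u]| = D) /\ (forall u, #|[set t | G t u]| = D).

(** Hall's condition by double counting: [#|S| * D] edges leave [S], all end among its neighbours,
    and each neighbour receives at most [D] of them. *)
Lemma regular_matching G D : 0 < D -> regular G D ->
  exists f : T -> T, injective f /\ forall t, G t (f t).
Proof.
move=> D0 [Grow Gcol].
have [S _|f [finj fG]] := @hall_sub G [set: T] [set: T].
  rewrite setIT -(leq_pmul2r D0).
  have -> : #|S| * D = \sum_(t in S) \sum_(u | G t u) 1.
    rewrite -sum_nat_const; apply: eq_bigr => t _; rewrite -(Grow t) sum1dep_card.
    by apply: eq_card => u; rewrite !inE.
  have -> : #|neighbours G S| * D = \sum_(u in neighbours G S) \sum_(t | G t u) 1.
    rewrite -sum_nat_const; apply: eq_bigr => t _; rewrite -(Gcol t) sum1dep_card.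
    by apply: eq_card => u; rewrite !inE.
  rewrite (exchange_big_dep (mem (neighbours G S))) /=; last first.
    by move=> t u tS tu; rewrite inE; apply/existsP; exists t; rewrite tS.
  apply: leq_sum => u _; rewrite !sum1dep_card.
  by apply/subset_leq_card/subsetP => t; rewrite !inE => /andP[].
exists f; split; first by move=> t u; apply: finj; rewrite inE.
by move=> t; have /andP[] := fG t (in_setT t).
Qed.

(** König's theorem for regular graphs: removing a perfect matching lowers the degree by one, so
    induction colours the rest, and the matching takes the new colour. *)
Lemma regular_edge_coloring G D : regular G D ->
  exists e : T -> T -> nat,
  [/\ forall t u, G t u -> e t u < D,
      forall t u u', G t u -> G t u' -> e t u = e t u' -> u = u' &
      forall t t' u, G t u -> G t' u -> e t u = e t' u -> t = t'].
Proof.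
elim: D G => [|D IHD] G [Grow Gcol].
  have G0 t u : G t u = false.
    apply/negP => Gtu; have /eqP := Grow t.
    by rewrite cards_eq0 => /eqP/setP/(_ u); rewrite !inE Gtu.
  by exists (fun _ _ => 0%N); split=> [t u|t u u'|t t' u]; rewrite G0.
have [f [finj fG]] := regular_matching (ltn0Sn D) (conj Grow Gcol).
have [g fK gK] := injF_bij finj.
pose G' t u := G t u && (u != f t).
have [|e [eD erow ecol]] := IHD G'.
  split=> [t|u].
    have := Grow t; rewrite (cardsD1 (f t)) inE fG => -[<-].
    by apply: eq_card => u; rewrite !inE andbC.
  have := Gcol u; rewrite (cardsD1 (g u)) inE -{2}[u]gK fG => -[<-].
  apply: eq_card => t; rewrite !inE /G'.
  have -> : (u == f t) = (t == g u) by apply/eqP/eqP => ->; rewrite ?fK ?gK.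
  by rewrite andbC.
exists (fun t u => if u == f t then D else e t u); split.
- move=> t u Gtu; case: ifPn => // ne; apply: ltnW.
  by rewrite ltnS; apply: eD; rewrite /G' Gtu.
- move=> t u u' Gtu Gtu'; case: eqP => [->|/eqP ut]; case: eqP => [->|/eqP ut'] // eE.
  + by have := eD t u'; rewrite /G' Gtu' ut' -eE ltnn => /(_ isT).
  + by have := eD t u; rewrite /G' Gtu ut eE ltnn => /(_ isT).
  + by apply: (erow t) => //; rewrite /G' ?Gtu ?Gtu'.
- move=> t t' u Gtu Gtu'; case: eqP => [ut|/eqP ut]; case: eqP => [ut'|/eqP ut'] eE.
  + by apply: finj; rewrite -ut -ut'.
  + by have := eD t' u; rewrite /G' Gtu' ut' -eE ltnn => /(_ isT).
  + by have := eD t u; rewrite /G' Gtu ut eE ltnn => /(_ isT).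
  + by apply: (ecol t _ u) => //; rewrite /G' ?Gtu ?Gtu'.
Qed.

End bipartite.

(** The symbol is [C i j * D + e], with [e] the index of the matching of the cell within its colour
    class. Equal symbols mean equal colour and equal matching, so two such cells never share a line;
    injectivity on lines suffices, as a line has as many cells as there are symbols. *)
Lemma latin_square_refinement (n q D : nat) (C : 'I_n -> 'I_n -> 'I_q) :
  (0 < n)%N -> n = (q * D)%N ->
  (forall i c, #|[set j | C i j == c]| = D) ->
  (forall j c, #|[set i | C i j == c]| = D) ->
  exists L : 'M['I_n]_n, latin_square L /\ forall i j, (L i j %/ D)%N = C i j.
Proof.
move=> n0 nE Crow Ccol.
have D0 : (0 < D)%N by move: n0; rewrite nE muln_gt0 => /andP[].
have reg c : regular (fun i j => C i j == c) D.
  by split=> [i|j]; [rewrite -(Crow i c)|rewrite -(Ccol j c)]; apply: eq_card => u; rewrite !inE.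
have [e eP] := choice (fun c => regular_edge_coloring (reg c)).
have eD i j : (e (C i j) i j < D)%N by have [+ _ _] := eP (C i j); apply.
have Lbound i j : (C i j * D + e (C i j) i j < n)%N.
  rewrite nE; have : (C i j).+1 * D <= q * D by rewrite leq_mul2r ltn_ord orbT.
  by have := eD i j; rewrite mulSn; lia.
pose L : 'M['I_n]_n := (\matrix_(i, j) Ordinal (Lbound i j))%R.
have LC i j : (L i j %/ D)%N = C i j.
  by rewrite mxE /= divnMDl // divn_small ?addn0.
exists L; split=> //.
have Leq i j i' j' : L i j = L i' j' ->
    C i j = C i' j' /\ e (C i j) i j = e (C i' j') i' j'.
  move=> LE; have CE : C i j = C i' j' by apply/val_inj; rewrite /= -!LC LE.
  split=> //; move/(congr1 val): LE; rewrite !mxE /= CE; lia.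
split=> // [i v|j v].
- have Linj : injective (L i).
    move=> j j' /Leq[CE]; rewrite CE; have [_ + _] := eP (C i j'); apply.
    + by rewrite CE eqxx.
    + by [].
  have [g gK Kg] := injF_bij Linj; exists (g v); split=> // j <-.
  by rewrite gK.
- have Linj : injective (L^~ j).
    move=> i i' /Leq[CE]; rewrite CE; have [_ _ +] := eP (C i' j); apply.
    + by rewrite CE eqxx.
    + by [].
  have [g gK Kg] := injF_bij Linj; exists (g v); split=> // i <-.
  by rewrite gK.
Qed.

Local Open Scope ring_scope.

(** * Block colourings *)

Lemma exists_class_sizes (q s : nat) (D : 'I_q -> nat) :
  (\sum_c D c)%N = s ->
  exists g : 'I_s -> 'I_q, forall c, (\sum_(r < s) (g r == c))%N = D c.
Proof.
move=> DE.
pose w := flatten [seq nseq (D c) c | c <- enum 'I_q].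
have wsz : size w == s.
  rewrite size_flatten /shape -map_comp -DE sumnE big_map big_enum /=.
  by apply/eqP; apply: eq_bigr => c _; rewrite size_nseq.
exists (tnth (Tuple wsz)) => c.
rewrite -(big_tuple _ _ (Tuple wsz) predT (fun x => nat_of_bool (x == c))) /=.
rewrite big_flatten /= big_map big_enum /= (bigD1 c) //= [X in (_ + X)%N]big1.
  by rewrite addn0 big_nseq eqxx iter_addn addn0 mul1n.
by move=> e /negPf ec; rewrite big_nseq ec iter_addn addn0 mul0n.
Qed.

(** Independence of distinct coordinates of a uniform [x]: as [b] is injective, each coordinate
    enters at most one factor and the sum factorizes. The exact independence of colours in a block
    colouring rests on this. *)
Lemma sum_prod_coordinates (F : numFieldType) (p s l : nat) (b : 'I_l -> 'I_p)
    (K : 'I_l -> 'I_s -> F) : (0 < s)%N -> injective b ->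
  \sum_(x : {ffun 'I_p -> 'I_s}) \prod_j K j (x (b j)) =
  s%:R ^+ p * \prod_j ((\sum_r K j r) / s%:R).
Proof.
move=> s0 binj.
have sne : (s%:R : F) != 0 by rewrite pnatr_eq0 -lt0n.
pose H (b' : 'I_p) (r : 'I_s) := \prod_(j | b j == b') K j r.
transitivity (\sum_(x : {ffun 'I_p -> 'I_s}) \prod_b' H b' (x b')).
  apply: eq_bigr => x _; rewrite (partition_big b predT) //=.
  by apply: eq_bigr => b' _; apply: eq_bigr => j /eqP ->.
rewrite -(bigA_distr_bigA H).
rewrite [X in _ * X](partition_big b predT) //=.
have -> : (s%:R : F) ^+ p = \prod_(b' < p) s%:R by rewrite prodr_const card_ord.
rewrite -big_split /=; apply: eq_bigr => b' _; rewrite /H.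
have [j0 /eqP j0b|nob] := pickP (fun j => b j == b').
  have bE j : (b j == b') = (j == j0).
    by apply/eqP/eqP => [|->//]; rewrite -j0b => /binj.
  rewrite (big_pred1 j0) //; under eq_bigr do rewrite (big_pred1 j0) //.
  by field.
rewrite [X in _ * X]big_pred0 ?mulr1 //.
by under eq_bigr do rewrite big_pred0 //; rewrite sumr_const card_ord.
Qed.

Section lexicographic_index.
Variables (p : nat) (X : finType).

Lemma lex_enc_subproof (z : 'I_p * X) :
  (z.1 * #|X| + enum_rank z.2 < p * #|X|)%N.
Proof.
have le : (z.1.+1 * #|X| <= p * #|X|)%N by rewrite leq_mul2r ltn_ord orbT.
have := ltn_ord (enum_rank z.2); rewrite [#|_|]/= => lt.
by apply: leq_trans le; rewrite mulSn addnC ltn_add2r.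
Qed.

(** The type comes first, so lines of distinct types are ordered as their types, and increasing
    types lift to increasing lines whatever the second components are. *)
Definition lex_enc z : 'I_(p * #|X|) := Ordinal (lex_enc_subproof z).

Lemma lex_enc_div z : (lex_enc z %/ #|X|)%N = z.1.
Proof.
have lt := ltn_ord (enum_rank z.2).
by rewrite /= divnMDl ?divn_small ?addn0 //; apply: leq_ltn_trans lt.
Qed.

Lemma lex_enc_bij : bijective lex_enc.
Proof.
apply: inj_card_bij; last by rewrite card_prod !card_ord.
move=> z z' zE; have z1 : z.1 = z'.1.
  by apply: val_inj; rewrite /= -!lex_enc_div zE.
case: z z' z1 zE => [a u] [a' u'] /= -> /(congr1 val)/= /addnI/val_inj/enum_rank_inj ->.
by [].
Qed.

Lemma lex_enc_lt (z z' : 'I_p * X) : (z.1 < z'.1)%N -> (lex_enc z < lex_enc z')%N.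
Proof.
by rewrite -!lex_enc_div; apply: contraTT; rewrite -!leqNgt => /leq_div2r; exact.
Qed.

End lexicographic_index.

(** * Increasing index tuples and pattern frequencies *)

Lemma incr_inj k n (x : {ffun 'I_k -> 'I_n}) : incr x -> injective x.
Proof.
move=> xi i j xij; apply: val_inj; case: (ltngtP i j) => // ij.
- by have := forallP (forallP xi i) j; rewrite ij /= xij ltnn.
- by have := forallP (forallP xi j) i; rewrite ij /= xij ltnn.
Qed.

Lemma card_incr k n : #|[pred x : {ffun 'I_k -> 'I_n} | incr x]| = 'C(n, k).
Proof.
rewrite -card_ltn_sorted_tuples.
pose h (x : {ffun 'I_k -> 'I_n}) := [tuple x i | i < k].
have hinj : injective h.
  move=> x y /(congr1 (@tnth _ _)) hxy; apply/ffunP => i.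
  by have := congr1 (@^~ i) hxy; rewrite !tnth_mktuple.
rewrite -(fintype.card_image hinj); apply: eq_card => t; rewrite !inE.
apply/fintype.imageP/idP => [[x]|st].
  rewrite inE => xi ->.
  have nthE i (ik : (i < k)%N) : nth 0%N (map val (h x)) i = x (Ordinal ik).
    rewrite (nth_map (x (Ordinal ik))) ?size_tuple //.
    by rewrite -(tnth_nth _ (h x) (Ordinal ik)) tnth_mktuple.
  rewrite (sorted_pairwise ltn_trans); apply/(pairwiseP 0%N) => i j.
  rewrite !inE size_map size_tuple => ik jk ij; rewrite !nthE.
  by have /implyP := forallP (forallP xi (Ordinal ik)) (Ordinal jk); apply.
exists [ffun i => tnth t i]; last first.
  by apply: eq_from_tnth => i; rewrite tnth_mktuple ffunE.
rewrite inE; apply/forallP => i; apply/forallP => j; apply/implyP => ij; rewrite !ffunE.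
move: st; rewrite (sorted_pairwise ltn_trans) => /(pairwiseP 0%N)/(_ i j).
rewrite !inE size_map size_tuple !ltn_ord => /(_ isT isT ij).
by rewrite !(nth_map (tnth t i)) ?size_tuple // -!tnth_nth.
Qed.

Definition mx_inj (k l : nat) (T : Type) (M : 'M[T]_(k, l)) : Prop :=
  injective (fun z : 'I_k * 'I_l => M z.1 z.2).

(** [N] coarsens the order of [M] but, being injective, merges nothing: the comparisons in [M] and
    [N] agree, and with distinct entries the rank counts the cells that are at most a given one. [M]
    will hold symbols or real values, [N] their classes. *)
Lemma struct_equiv_coarsen d (T : orderType d) d' (T' : orderType d')
    d'' (T'' : orderType d'') k l (M : 'M[T]_(k, l)) (N : 'M[T']_(k, l))
    (A : 'M[T'']_(k, l)) :
  mx_inj N ->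
  (forall i j i' j', (M i j <= M i' j')%O -> (N i j <= N i' j')%O) ->
  struct_equiv M A = struct_equiv N A.
Proof.
move=> Ninj MN.
have Minj : mx_inj M.
  move=> [i j] [i' j'] /= ME; apply: Ninj => /=; apply/eqP.
  by rewrite eq_le !MN // ME.
have rk (d0 : Order.disp_t) (T0 : orderType d0) (Q : 'M[T0]_(k, l)) i j : mx_inj Q ->
    entry_rank Q (Q i j) = count (fun z => (Q z.1 z.2 <= Q i j)%O) (enum {: 'I_k * 'I_l}).
  move=> Qinj; rewrite /entry_rank /entries undup_id; last first.
    by rewrite (map_inj_uniq Qinj) enum_uniq.
  by rewrite count_map.
rewrite /struct_equiv; apply: eq_forallb => i; apply: eq_forallb => j.
rewrite (rk _ _ M) // (rk _ _ N) //; congr (_ == _); apply: eq_count => z /=.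
apply/idP/idP; first exact: MN.
move=> le'; case: leP => // lt; move: (MN _ _ _ _ (ltW lt)) => le.
have /Ninj zE : N z.1 z.2 = N (i, j).1 (i, j).2 by apply/eqP; rewrite eq_le le le'.
by move: lt; rewrite zE /= ltxx.
Qed.

Section pattern_weight.
Context {R : realType}.

(* The density of the colour pattern c in the p-step array v, normalized by
   p^k/k! and p^l/l! instead of the binomial coefficients, which are smaller. *)
Definition pattern_weight p q k l (v : 'I_p -> 'I_p -> 'I_q -> R)
    (c : 'M['I_q]_(k, l)) : R :=
  (k`! * l`!)%:R / p%:R ^+ (k + l) *
  \sum_(a : {ffun 'I_k -> 'I_p} | incr a) \sum_(b : {ffun 'I_l -> 'I_p} | incr b)
    \prod_i \prod_j v (a i) (b j) (c i j).

(** [density] with an arbitrary predicate in place of structural equivalence, so that a lower bound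
    can serve both for a pattern and for its complement. *)
Definition pattern_frequency k l n (L : 'M['I_n]_n) (Q : pred 'M['I_n]_(k, l)) : R :=
  ('C(n, k)%:R)^-1 * ('C(n, l)%:R)^-1 *
  \sum_(x : {ffun 'I_k -> 'I_n} | incr x)
    \sum_(y : {ffun 'I_l -> 'I_n} | incr y) (Q (mxsub x y L))%:R.

Lemma pattern_frequencyC k l n (L : 'M['I_n]_n) (Q : pred 'M['I_n]_(k, l)) :
  (k <= n)%N -> (l <= n)%N ->
  pattern_frequency L (predC Q) = 1 - pattern_frequency L Q.
Proof.
move=> kn ln; apply/eqP; rewrite eq_sym subr_eq -mulrDr -big_split /=; apply/eqP.
under [in RHS]eq_bigr => x _ do rewrite -big_split /=.
transitivity (('C(n, k)%:R : R)^-1 * ('C(n, l)%:R)^-1 * ('C(n, k)%:R * 'C(n, l)%:R)).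
  have := bin_gt0 n k; have := bin_gt0 n l; rewrite kn ln => l0 k0.
  by field; rewrite !pnatr_eq0 -!lt0n l0 k0.
congr (_ * _); rewrite -!card_incr -!sum1_card !natr_sum mulr_suml.
apply: eq_bigr => x _; rewrite mul1r; apply: eq_bigr => y _.
by case: (Q _); rewrite /= ?addr0 ?add0r.
Qed.

End pattern_weight.

Lemma ffact_le_exp n k : (n ^_ k <= n ^ k)%N.
Proof.
elim: k n => [|k IHk] n; first by rewrite ffactn0.
case: n => [|n]; first by rewrite ffact0n.
rewrite ffactSS expnS leq_mul2l; apply/orP; right.
apply: leq_trans (IHk n) _; case: k {IHk} => [|k]; first by rewrite !expn0.
by rewrite leq_exp2r ?leqnSn.
Qed.


Section cell_sums.
Variables (p s' q : nat) (d : 'I_p -> 'I_p -> 'I_q -> nat).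
Local Notation s := s'.+1.
Variable g : 'I_p -> 'I_p -> 'I_s -> 'I_q.
Hypothesis gE : forall a b c, (\sum_r (g a b r == c))%N = d a b c.

(** Here [x] is the vector of a row of type [a], and [r j] the coordinate of the [j]-th column
    vector added to it. The shift by [r j] only permutes the residues, so the count does not depend
    on the column vectors. *)
Lemma sum_cells (F : numFieldType) l (a : 'I_p) (b : 'I_l -> 'I_p)
    (r : 'I_l -> 'I_s) (c : 'I_l -> 'I_q) : injective b ->
  \sum_(x : {ffun 'I_p -> 'I_s}) \prod_j (g a (b j) (x (b j) + r j) == c j)%:R =
  s%:R ^+ p * \prod_j ((d a (b j) (c j))%:R / s%:R) :> F.
Proof.
move=> binj.
rewrite (sum_prod_coordinates (fun j t => (g a (b j) (t + r j) == c j)%:R)) //.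
congr (_ * _); apply: eq_bigr => j _; congr (_ / _).
rewrite -natr_sum -gE [in RHS](reindex_inj (addIr (r j))); congr (_%:R).
Qed.

Lemma card_cells (a b : 'I_p) (r : 'I_s) (c : 'I_q) :
  (\sum_(x : {ffun 'I_p -> 'I_s}) (g a b (x b + r)%R == c) =
   s ^ p.-1 * d a b c)%N.
Proof.
have := @sum_cells rat 1 a (fun=> b) (fun=> r) (fun=> c) _.
rewrite big_ord1; under eq_bigr do rewrite big_ord1.
move=> /(_ (fun i j _ => etrans (ord1 i) (esym (ord1 j)))).
rewrite -natr_sum; have p0 : (0 < p)%N by apply: leq_ltn_trans (ltn_ord a).
have -> : s%:R ^+ p = s%:R ^+ p.-1 * s%:R :> rat by rewrite -exprSr prednK.
rewrite -mulrA [s%:R * _]mulrC divfK ?pnatr_eq0 //.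
by rewrite -natrX -natrM => /eqP; rewrite eqr_nat => /eqP.
Qed.

End cell_sums.

(** An inequality, because only submatrices with increasing, hence distinct, types are counted. It
    holds for any set [P] of colour patterns that forces [Q]; dividing a symbol by [D] recovers the
    colour of its cell. *)
Lemma latin_of_block_array (p s q e : nat) (d : 'I_p -> 'I_p -> 'I_q -> nat) :
  (0 < p)%N -> (0 < s)%N ->
  (forall a b, \sum_c d a b c = s)%N ->
  (forall a c, \sum_b d a b c = e)%N ->
  (forall b c, \sum_a d a b c = e)%N ->
  exists n D (L : 'M['I_n]_n), [/\ (p <= n)%N, latin_square L &
    forall (R : realType) k l (P : pred 'M['I_q]_(k, l)) (Q : pred 'M['I_n]_(k, l)),
      (k <= p)%N -> (l <= p)%N ->
      (forall (M : 'M['I_n]_(k, l)) c, P c -> (forall i j, (M i j %/ D)%N = c i j) -> Q M) ->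
      \sum_(c | P c) pattern_weight (fun a b c => (d a b c)%:R / s%:R : R) c <=
      pattern_frequency L Q].
Proof.
case: s => // s'; set s := s'.+1 => p0 _ dcell drow dcol.
pose X := {ffun 'I_p -> 'I_s}.
have [g gE] : exists g : 'I_p -> 'I_p -> 'I_s -> 'I_q,
    forall a b c, (\sum_r (g a b r == c))%N = d a b c.
  have H z : exists g : 'I_s -> 'I_q, forall c, (\sum_r (g r == c))%N = d z.1 z.2 c.
    exact: exists_class_sizes.
  have [h hE] := choice H; exists (fun a b => h (a, b)) => a b c.
  exact: (hE (a, b)).
have cardX : #|{: X}| = (s ^ p)%N by rewrite card_ffun !card_ord.
pose n := (p * #|{: X}|)%N.
have [dec encK decK] := lex_enc_bij p X.
pose C (i j : 'I_n) : 'I_q :=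
  g (dec i).1 (dec j).1 ((dec i).2 (dec j).1 + (dec j).2 (dec j).1).
(* A row of type [a] has [s ^ p.-1 * d a b c] cells of colour [c] in the columns of type [b]; the
   sum over [b] is [D], whatever the row and the colour. *)
pose D := (s ^ p.-1 * e)%N.
have sumn_enc (F : 'I_n -> nat) :
    (\sum_i F i = \sum_(a < p) \sum_(x : X) F (lex_enc (a, x)))%N.
  rewrite pair_big /= (reindex (@lex_enc p X)) /=; last exact/onW_bij/lex_enc_bij.
  by apply: eq_bigr => -[].
have nE : n = (q * D)%N.
  have sp : (s ^ p = s ^ p.-1 * s)%N by rewrite -expnSr prednK.
  rewrite /n cardX /D sp mulnCA [RHS]mulnCA; congr (_ * _)%N.
  have : (\sum_(b < p) \sum_c d (Ordinal p0) b c = \sum_(c < q) e)%N.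
    by rewrite exchange_big; apply: eq_bigr => c _; exact: drow.
  under eq_bigr do rewrite dcell.
  by rewrite !sum_nat_const !card_ord mulnC.
have n0 : (0 < n)%N by rewrite muln_gt0 p0 cardX expn_gt0.
have Crow i c : #|[set j | C i j == c]%SET| = D.
  rewrite -sum1dep_card big_mkcond /= sumn_enc /D -(drow (dec i).1 c) big_distrr /=.
  apply: eq_bigr => b _; rewrite -(card_cells gE _ _ ((dec i).2 b)).
  by apply: eq_bigr => y _; rewrite /C encK /= addrC; case: (_ == _).
have Ccol j c : #|[set i | C i j == c]%SET| = D.
  rewrite -sum1dep_card big_mkcond /= sumn_enc /D -(dcol (dec j).1 c) big_distrr /=.
  apply: eq_bigr => a _; rewrite -(card_cells gE _ _ ((dec j).2 (dec j).1)).
  by apply: eq_bigr => y _; rewrite /C encK /=; case: (_ == _).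
have [L [Llat LC]] := latin_square_refinement n0 nE Crow Ccol.
exists n, D, L; split=> //.
  by rewrite leq_pmulr // cardX expn_gt0.
move=> R k l P Q kp lp PQ.
have np : (p <= n)%N by rewrite leq_pmulr // cardX expn_gt0.
(* Lifts types [a] and vectors [u] to line indices. *)
pose ext h (a : {ffun 'I_h -> 'I_p}) (u : {ffun 'I_h -> X}) : {ffun 'I_h -> 'I_n} :=
  [ffun i => lex_enc (a i, u i)].
have ext_inj h (a a' : {ffun 'I_h -> 'I_p}) u u' :
    ext h a u = ext h a' u' -> (a, u) = (a', u').
  move=> /ffunP eE; have H i : (a i, u i) = (a' i, u' i).
    by have := eE i; rewrite !ffunE => /(can_inj encK).
  by congr pair; apply/ffunP => i; have [] := H i.
have ext_incr h (a : {ffun 'I_h -> 'I_p}) u : incr a -> incr (ext h a u).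
  move=> ai; apply/forallP => i; apply/forallP => j; apply/implyP => ij.
  rewrite !ffunE; apply: lex_enc_lt => /=.
  by have /implyP := forallP (forallP ai i) j; apply.
have sum_ext h (F : {ffun 'I_h -> 'I_n} -> R) : (forall x, 0 <= F x) ->
    \sum_(a : {ffun 'I_h -> 'I_p} | incr a) \sum_u F (ext h a u) <=
    \sum_(x | incr x) F x.
  move=> F0; rewrite pair_big /=.
  rewrite (partition_big (fun z => ext h z.1 z.2) (fun x => incr x)) /=; last first.
    by move=> [a u] /=; rewrite andbT => /ext_incr.
  apply: ler_sum => x _.
  have [[a u] /= /andP[/andP[ai _] /eqP ex]|none] :=
      pickP (fun z : {ffun 'I_h -> 'I_p} * {ffun 'I_h -> X} =>
               incr z.1 && true && (ext h z.1 z.2 == x)).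
    rewrite (big_pred1 (a, u)) /= ?ex // => -[a' u'] /=; rewrite -ex.
    apply/idP/eqP => [/andP[_ /eqP/ext_inj]//|[-> ->]].
    by rewrite ai eqxx.
  by rewrite big_pred0.
rewrite /pattern_frequency.
have Ck : (0 < 'C(n, k))%N by rewrite bin_gt0 (leq_trans kp).
have Cl : (0 < 'C(n, l))%N by rewrite bin_gt0 (leq_trans lp).
(* Normalizing by powers gives less than normalizing by binomials, the right direction for a lower
   bound. *)
have bound h : (0 < 'C(n, h))%N -> h`!%:R / n%:R ^+ h <= ('C(n, h)%:R : R)^-1.
  move=> Ch; rewrite -[leRHS]mul1r ler_pdivlMr ?ltr0n // mulrAC.
  rewrite ler_pdivrMr ?exprn_gt0 ?ltr0n // mul1r -natrX -natrM ler_nat.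
  by rewrite mulnC bin_ffact ffact_le_exp.
pose S : R := \sum_(x : {ffun 'I_k -> 'I_n} | incr x)
    \sum_(y : {ffun 'I_l -> 'I_n} | incr y) (Q (mxsub x y L))%:R.
have S0 : 0 <= S by apply: sumr_ge0 => x _; apply: sumr_ge0 => y _; exact: ler0n.
apply: (@le_trans _ _ (k`!%:R / n%:R ^+ k * (l`!%:R / n%:R ^+ l) * S)); last first.
  rewrite ler_wpM2r // ler_pM ?bound ?mulr_ge0 ?invr_ge0 ?exprn_ge0 ?ler0n //.
(* For fixed column vectors [v], the row vectors are summed one row at a time; the result is the
   same for all [v]. *)
have cnt (c : 'M['I_q]_(k, l)) (a : {ffun 'I_k -> 'I_p}) (b : {ffun 'I_l -> 'I_p}) :
    incr a -> incr b ->
    \sum_u \sum_v \prod_i \prod_j (C (ext k a u i) (ext l b v j) == c i j)%:R =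
    (s%:R ^+ p) ^+ (k + l) * \prod_i \prod_j ((d (a i) (b j) (c i j))%:R / s%:R) :> R.
  move=> ai bi; rewrite exchange_big /=.
  transitivity (\sum_(v : {ffun 'I_l -> X}) (s%:R ^+ p) ^+ k *
       \prod_i \prod_j ((d (a i) (b j) (c i j))%:R / s%:R) : R).
    apply: eq_bigr => v _.
    transitivity (\sum_(u : {ffun 'I_k -> X}) \prod_i \prod_j
        (g (a i) (b j) (u i (b j) + v j (b j)) == c i j)%:R : R).
      apply: eq_bigr => u _; apply: eq_bigr => i _; apply: eq_bigr => j _.
      by rewrite /C !ffunE !encK.
    rewrite -(bigA_distr_bigA (fun i (x : X) => \prod_j
        (g (a i) (b j) (x (b j) + v j (b j)) == c i j)%:R)).
    have -> : (s%:R ^+ p) ^+ k = \prod_(i < k) (s%:R ^+ p : R).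
      by rewrite prodr_const card_ord.
    rewrite -big_split /=; apply: eq_bigr => i _.
    exact: (@sum_cells _ _ _ _ g gE R l (a i) b (fun j => v j (b j)) (c i) (incr_inj bi)).
  rewrite sumr_const card_ffun cardX card_ord -[LHS]mulr_natl !natrX.
  by rewrite exprD; ring.
rewrite /S.
pose N (c : 'M['I_q]_(k, l)) (x : {ffun 'I_k -> 'I_n}) (y : {ffun 'I_l -> 'I_n}) : R :=
   \prod_i \prod_j (C (x i) (y j) == c i j)%:R.
have N0 c x y : 0 <= N c x y.
  by apply: prodr_ge0 => i _; apply: prodr_ge0 => j _; exact: ler0n.
(* A submatrix has a single colour pattern [c0], so at most one term is nonzero. *)
have leQ x y : \sum_(c | P c) N c x y <= (Q (mxsub x y L))%:R.
  pose c0 : 'M['I_q]_(k, l) := \matrix_(i, j) C (x i) (y j).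
  have Nc c : c != c0 -> N c x y = 0.
    move=> /eqP ne; apply/eqP; apply: contrapT => /negP Nn; apply: ne.
    apply/matrixP => i j; move: Nn; rewrite mxE.
    rewrite /N prodf_seq_neq0 => /allP/(_ i); rewrite mem_index_enum => /(_ isT) /=.
    rewrite prodf_seq_neq0 => /allP/(_ j); rewrite mem_index_enum => /(_ isT) /=.
    by case: (C _ _ =P _) => [->//|_]; rewrite mulr0n eqxx.
  have N1 c : N c x y <= 1.
    apply: Num.Theory.prodr_ile1 => i _; apply/andP; split.
      by apply: prodr_ge0 => j _; exact: ler0n.
    by apply: Num.Theory.prodr_ile1 => j _; case: (_ == _); rewrite ?ler01 ?lexx.
  have [Pc0|nPc0] := boolP (P c0).
    rewrite (bigD1 c0) //= big1 ?addr0; last by move=> c /andP[_]; exact: Nc.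
    rewrite (PQ _ c0) // => i j; by rewrite !mxE LC.
  rewrite big1 ?ler0n // => c Pc; apply: Nc; apply: contraNneq nPc0 => <-.
  exact: Pc.
apply: (@le_trans _ _ (k`!%:R / n%:R ^+ k * (l`!%:R / n%:R ^+ l) *
   \sum_(c | P c) \sum_(x : {ffun 'I_k -> 'I_n} | incr x)
    \sum_(y : {ffun 'I_l -> 'I_n} | incr y) N c x y)); last first.
  rewrite ler_wpM2l ?mulr_ge0 ?invr_ge0 ?exprn_ge0 ?ler0n // exchange_big /=.
  apply: ler_sum => x _; rewrite exchange_big /=; apply: ler_sum => y _.
  exact: leQ.
rewrite big_distrr /=; apply: ler_sum => c Pc; rewrite /pattern_weight.
have nR : n%:R = p%:R * s%:R ^+ p :> R by rewrite /n cardX natrM natrX.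
apply: (@le_trans _ _ (k`!%:R / n%:R ^+ k * (l`!%:R / n%:R ^+ l) *
   \sum_(a : {ffun 'I_k -> 'I_p} | incr a) \sum_(b : {ffun 'I_l -> 'I_p} | incr b)
     \sum_u \sum_v N c (ext k a u) (ext l b v))).
  under [in leRHS]eq_bigr => a ai do under eq_bigr => b bi do rewrite cnt //.
  under [in leRHS]eq_bigr => a ai do rewrite -big_distrr /=.
  rewrite -[in leRHS]big_distrr /= !mulrA ler_wpM2r //.
    apply: sumr_ge0 => a _; apply: sumr_ge0 => b _.
    by do 2 (apply: prodr_ge0 => ? _); rewrite divr_ge0 ?ler0n.
  rewrite nR !exprMn !exprD natrM le_eqVlt; apply/orP; left; apply/eqP.
  by field; rewrite !expf_neq0 ?pnatr_eq0 // -lt0n.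
rewrite ler_wpM2l ?mulr_ge0 ?invr_ge0 ?exprn_ge0 ?ler0n //.
apply: (@le_trans _ _ (\sum_(a : {ffun 'I_k -> 'I_p} | incr a) \sum_u
    \sum_(y : {ffun 'I_l -> 'I_n} | incr y) N c (ext k a u) y)); last first.
  apply: (sum_ext k (fun x => \sum_(y : {ffun 'I_l -> 'I_n} | incr y) N c x y)) => x.
  by apply: sumr_ge0 => y _; exact: N0.
apply: ler_sum => a _; rewrite exchange_big /=; apply: ler_sum => u _.
exact: (sum_ext l (fun y => N c (ext k a u) y)).
Qed.

(** * Rounding approximately triply stochastic arrays *)

Section deviation.
Variables (V : pzRingType) (n : nat).
Implicit Types x y : 'I_n -> V.

(* n times the deviation of x from its mean, so that integrality is kept. *)
Definition deviation x i := n%:R * x i - \sum_j x j.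

Lemma sum_deviation x : \sum_i deviation x i = 0.
Proof.
by rewrite sumrB -mulr_sumr sumr_const card_ord mulr_natl subrr.
Qed.

Lemma deviationD x y i : deviation (fun j => x j + y j) i = deviation x i + deviation y i.
Proof. by rewrite /deviation big_split mulrDr /= opprD addrACA. Qed.

Lemma deviation_sum m (x : 'I_m -> 'I_n -> V) i :
  \sum_h deviation (x h) i = deviation (fun j => \sum_h x h j) i.
Proof. by rewrite sumrB -mulr_sumr exchange_big. Qed.

Lemma deviation0 i : deviation (fun=> 0) i = 0.
Proof. by rewrite /deviation big1 // mulr0 subrr. Qed.

End deviation.

Definition deviation3 (V : pzRingType) p q (x : 'I_p -> 'I_p -> 'I_q -> V) a b c :=
  deviation (fun a' => deviation (fun b' => deviation (x a' b') c) b) a.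

Section deviation3_sums.
Variables (V : pzRingType) (p q : nat) (x : 'I_p -> 'I_p -> 'I_q -> V).

Lemma sum_deviation3_1 b c : \sum_a deviation3 x a b c = 0.
Proof. exact: sum_deviation. Qed.

Lemma sum_deviation3_2 a c : \sum_b deviation3 x a b c = 0.
Proof.
rewrite deviation_sum -[RHS](deviation0 V a); congr deviation.
by apply/funext => a'; exact: sum_deviation.
Qed.

Lemma sum_deviation3_3 a b : \sum_c deviation3 x a b c = 0.
Proof.
rewrite deviation_sum -[RHS](deviation0 V a); congr deviation.
apply/funext => a'; rewrite deviation_sum -[RHS](deviation0 V b); congr deviation.
by apply/funext => b'; exact: sum_deviation.
Qed.

End deviation3_sums.

Lemma deviationZ (R : comPzRingType) n (k : R) (x : 'I_n -> R) i :
  deviation (fun j => k * x j) i = k * deviation x i.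
Proof. by rewrite /deviation -mulr_sumr mulrBr mulrCA. Qed.

Lemma ler_norm_deviation (R : numDomainType) n (x : 'I_n -> R) M i :
  (forall j, `|x j| <= M) -> `|deviation x i| <= 2%:R * n%:R * M.
Proof.
move=> xM; rewrite /deviation (le_trans (ler_normB _ _)) //.
rewrite normrM normr_nat.
have -> : 2%:R * n%:R * M = n%:R * M + n%:R * M by ring.
apply: lerD; first by rewrite ler_wpM2l.
apply: le_trans (ler_norm_sum _ _ _) _; apply: le_trans (ler_sum _ (fun j _ => xM j)) _.
by rewrite sumr_const card_ord mulr_natl.
Qed.

Section integral_array.
Variables (R : realType) (p q : nat) (v : 'I_p -> 'I_p -> 'I_q -> R) (delta : R).
Hypotheses (p0 : (0 < p)%N) (q0 : (0 < q)%N) (delta0 : 0 < delta).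
Hypothesis v0 : forall a b c, 0 <= v a b c.
Hypothesis v_cell : forall a b, \sum_c v a b c = 1.
Hypothesis v_row : forall a c, `|\sum_b v a b c - p%:R / q%:R| <= delta * p%:R.
Hypothesis v_col : forall b c, `|\sum_a v a b c - p%:R / q%:R| <= delta * p%:R.

(** Along [c] the deviation is exact, since cells sum to 1. Along [b] it adds the row error [r a'],
    at most [q * delta * p]. Along [a] it multiplies that bound by [2 * p] and adds [p] times a
    column error of the same size; hence the constant [3 = 2 + 1]. *)
Lemma deviation3_near a b c :
  `|deviation3 v a b c - p%:R ^+ 2 * (q%:R * v a b c - 1)| <= 3%:R * p%:R ^+ 2 * q%:R * delta.
Proof.
have qR : (0 : R) < q%:R by rewrite ltr0n.
have qn : (q%:R : R) != 0 by rewrite gt_eqF.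
pose r a' := - (q%:R * (\sum_b' v a' b' c - p%:R / q%:R)).
have -> : deviation3 v a b c = deviation (fun a' => p%:R * (q%:R * v a' b c - 1) + r a') a.
  rewrite /deviation3; congr deviation; apply/funext => a'.
  rewrite {1}/deviation [in LHS]/deviation v_cell; under eq_bigr do rewrite v_cell.
  rewrite sumrB sumr_const card_ord -mulr_sumr /r.
  by field.
rewrite deviationD {1}/deviation -mulr_sumr sumrB sumr_const card_ord -mulr_sumr.
set S := \sum_a' v a' b c; set Dr := deviation r a.
have -> : p%:R * (p%:R * (q%:R * v a b c - 1)) - p%:R * (q%:R * S - 1 *+ p) + Dr -
   p%:R ^+ 2 * (q%:R * v a b c - 1) = - (p%:R * (q%:R * (S - p%:R / q%:R))) + Dr.
  by field.
apply: le_trans (ler_normD _ _) _; rewrite normrN.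
have -> : 3%:R * p%:R ^+ 2 * q%:R * delta = p%:R * (q%:R * (delta * p%:R)) +
   2%:R * p%:R * (q%:R * (delta * p%:R)) by ring.
apply: lerD.
  by rewrite !normrM !normr_nat !ler_wpM2l // v_col.
by apply: ler_norm_deviation => a'; rewrite normrN normrM normr_nat ler_wpM2l // v_row.
Qed.

(* deviation3 / (p^2 q) projects onto the arrays with zero line sums; it is
   applied to the integer parts of a large multiple of (1 - theta) v, and theta
   leaves room for the errors, keeping the result nonnegative. *)
Lemma exists_integral_array : 4%:R * q%:R * delta <= 1 ->
  exists (d : 'I_p -> 'I_p -> 'I_q -> nat) (s e : nat),
  [/\ (0 < s)%N, forall a b, (\sum_c d a b c = s)%N,
      forall a c, (\sum_b d a b c = e)%N, forall b c, (\sum_a d a b c = e)%N &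
      forall a b c, `|(d a b c)%:R / s%:R - v a b c| <= 8%:R * q%:R * delta].
Proof.
(* Chosen so that [theta / q%:R] equals [4%:R * delta], the total error bounded below:
   [3%:R * delta] from the line sums and [delta] from the integer parts. *)
move=> delta1; set theta := 4%:R * q%:R * delta.
have qR : (0 : R) < q%:R by rewrite ltr0n.
have pR : (0 : R) < p%:R by rewrite ltr0n.
(* An error of at most 1 per entry grows by factors [2 * p], [2 * p] and [2 * q] under the three
   deviations; dividing by [p ^ 2 * q] leaves 8, and dividing by [N] leaves at most [delta]. *)
pose N := (Num.trunc (8%:R / delta)).+1.
have NR : (0 : R) < N%:R by rewrite ltr0n.
have N8 : 8%:R / N%:R <= delta.
  rewrite ler_pdivrMr // -ler_pdivrMl // mulrC ltW //.
  by apply: truncnS_gt.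
pose y a b c : R := N%:R * ((1 - theta) * v a b c).
pose e0 a b c : int := Num.floor (y a b c).
pose phi a b c : R := (e0 a b c)%:~R - y a b c.
have phi1 a b c : `|phi a b c| <= 1.
  rewrite /phi /e0; have := floor_itv (y a b c); move=> /andP[l u].
  rewrite ler_norml; apply/andP; split; first by move: u; rewrite intrD; lra.
  by lra.
(* Deviations sum to zero along every line, so this constant alone determines the line sums. *)
pose d0 a b c : int := (p ^ 2 * N)%N%:Z + deviation3 e0 a b c.
have d0E a b c : (d0 a b c)%:~R =
    p%:R ^+ 2 * N%:R + N%:R * (1 - theta) * deviation3 v a b c + deviation3 phi a b c :> R.
  rewrite /d0 intrD -pmulrn natrM natrX -addrA; congr (_ + _).
  have morph n (x : 'I_n -> int) i :
      (deviation x i)%:~R = deviation (fun j => (x j)%:~R : R) i.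
    by rewrite /deviation rmorphB rmorphM rmorph_nat rmorph_sum.
  have -> : N%:R * (1 - theta) * deviation3 v a b c = deviation3 y a b c.
    rewrite /deviation3 -deviationZ; congr deviation; apply/funext => a'.
    rewrite -deviationZ; congr deviation; apply/funext => b'.
    rewrite -deviationZ; congr deviation; apply/funext => c'.
    by rewrite /y mulrA.
  rewrite /deviation3 -deviationD morph; congr deviation; apply/funext => a'.
  rewrite -deviationD morph; congr deviation; apply/funext => b'.
  rewrite -deviationD morph; congr deviation; apply/funext => c'.
  by rewrite /phi addrC subrK.
pose s := (q * (p ^ 2 * N))%N.
have sR : (0 : R) < s%:R by rewrite ltr0n !muln_gt0 q0 p0.
(* Error against the mixture of [v] and the uniform distribution with weights [1 - theta] and
   [theta]. *)
pose E a b c : R := (d0 a b c)%:~R / s%:R - ((1 - theta) * v a b c + theta / q%:R).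
have Eb a b c : `|E a b c| <= 4%:R * delta.
  have -> : E a b c = (1 - theta) * ((deviation3 v a b c -
     p%:R ^+ 2 * (q%:R * v a b c - 1)) / (p%:R ^+ 2 * q%:R)) +
       deviation3 phi a b c / (p%:R ^+ 2 * q%:R) / N%:R.
    rewrite /E d0E /s natrM natrM natrX; field.
    by rewrite !gt_eqF.
  have pq0 : 0 < p%:R ^+ 2 * q%:R :> R by rewrite mulr_gt0 ?exprn_gt0.
  have pqi : 0 <= (p%:R ^+ 2 * q%:R)^-1 :> R by rewrite invr_ge0 ltW.
  have Ni : 0 <= N%:R^-1 :> R by rewrite invr_ge0.
  apply: le_trans (ler_normD _ _) _.
  have -> : 4%:R * delta = 3%:R * delta + delta by ring.
  have theta0 : 0 <= theta by rewrite /theta !mulr_ge0 // ltW.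
  apply: lerD.
    rewrite normrM ger0_norm ?subr_ge0 //.
    apply: le_trans (_ : `|(deviation3 v a b c - p%:R ^+ 2 * (q%:R * v a b c - 1)) /
       (p%:R ^+ 2 * q%:R)| <= _).
      by rewrite ler_piMl ?normr_ge0 // gerBl.
    rewrite normrM (ger0_norm pqi) ler_pdivrMr //.
    by apply: le_trans (deviation3_near a b c) _; rewrite le_eqVlt; apply/orP; left; apply/eqP; ring.
  apply: le_trans N8; rewrite normrM (ger0_norm Ni).
  rewrite ler_wpM2r // normrM (ger0_norm pqi).
  rewrite ler_pdivrMr //.
  have -> : 8%:R * (p%:R ^+ 2 * q%:R) =
     2%:R * p%:R * (2%:R * p%:R * (2%:R * q%:R * 1)) :> R by ring.
  apply: ler_norm_deviation => a'; apply: ler_norm_deviation => b'.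
  exact: ler_norm_deviation.
have thq : theta / q%:R = 4%:R * delta.
  by rewrite /theta; field; rewrite gt_eqF.
have d00 a b c : 0 <= d0 a b c.
  rewrite -(ler0z R) -(pmulr_lge0 _ (x := s%:R^-1)) ?invr_gt0 //.
  have := Eb a b c; rewrite ler_norml => /andP[+ _]; rewrite /E thq.
  have : 0 <= (1 - theta) * v a b c by rewrite mulr_ge0 // subr_ge0.
  lra.
(* One statement for the three families of lines: [F] runs along a line of [m] cells. *)
have sumabs m (F : 'I_m -> 'I_p * 'I_p * 'I_q) :
    \sum_i deviation3 e0 (F i).1.1 (F i).1.2 (F i).2 = 0 ->
    (\sum_i `|d0 (F i).1.1 (F i).1.2 (F i).2|%N = m * (p ^ 2 * N))%N.
  move=> F0; have : (\sum_i `|d0 (F i).1.1 (F i).1.2 (F i).2|%N)%N%:Z =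
      \sum_i d0 (F i).1.1 (F i).1.2 (F i).2.
    by rewrite (big_morph Posz PoszD (erefl _)); apply: eq_bigr => i _; rewrite gez0_abs.
  rewrite big_split /= F0 addr0 sumr_const card_ord -mulr_natl natz -PoszM.
  by move=> [->].
have absd a b c : (`|d0 a b c|%N)%:Z = d0 a b c by rewrite gez0_abs.
exists (fun a b c => `|d0 a b c|%N), s, (p * (p ^ 2 * N))%N; split.
- by rewrite !muln_gt0 q0 p0.
- by move=> a b; apply: (sumabs q (fun c => (a, b, c))) (sum_deviation3_3 _ _ _).
- by move=> a c; apply: (sumabs p (fun b => (a, b, c))) (sum_deviation3_2 _ _ _).
- by move=> b c; apply: (sumabs p (fun a => (a, b, c))) (sum_deviation3_1 _ _ _).
move=> a b c.
have -> : `|d0 a b c|%N%:R = (d0 a b c)%:~R :> R by rewrite -{2}absd -pmulrn.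
have -> : (d0 a b c)%:~R / s%:R - v a b c = E a b c + theta * (q%:R^-1 - v a b c).
  by rewrite /E; ring.
apply: le_trans (ler_normD _ _) _.
have v1 : v a b c <= 1.
  by rewrite -(v_cell a b) (bigD1 c) //= lerDl sumr_ge0.
have q1 : q%:R^-1 <= 1 :> R by rewrite invf_le1 // ler1n.
have : `|q%:R^-1 - v a b c| <= 1.
  rewrite ler_norml; apply/andP; split; first by have := qR; rewrite -invr_gt0 => ?; lra.
  by have := v0 a b c; lra.
rewrite normrM [`|theta|]ger0_norm; last by rewrite /theta !mulr_ge0 // ltW.
move=> le1; have th0 : 0 <= theta by rewrite /theta !mulr_ge0 // ltW.
have := Eb a b c; have := ler_wpM2l th0 le1; rewrite mulr1.
have : delta <= q%:R * delta by rewrite ler_peMl ?ler1n // ltW.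
by rewrite /theta; lra.
Qed.

End integral_array.

(** * Weights of colour patterns *)

Lemma ler_norm_prodB (F : numDomainType) (I : Type) (r : seq I) (x y : I -> F) :
  (forall i, 0 <= x i <= 1) -> (forall i, 0 <= y i <= 1) ->
  `|\prod_(i <- r) x i - \prod_(i <- r) y i| <= \sum_(i <- r) `|x i - y i|.
Proof.
move=> x01 y01; elim: r => [|i r IHr]; first by rewrite !big_nil subrr normr0.
rewrite !big_cons; set X := \prod_(j <- r) x j; set Y := \prod_(j <- r) y j.
have -> : x i * X - y i * Y = (x i - y i) * X + y i * (X - Y) by ring.
have X01 : 0 <= X <= 1.
  rewrite prodr_ge0 => [|j _]; last by have /andP[] := x01 j.
  by rewrite Num.Theory.prodr_ile1.
apply: le_trans (ler_normD _ _) _; rewrite !normrM; apply: lerD.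
  by rewrite ler_piMr // ger0_norm; have /andP[] := X01.
apply: le_trans IHr; rewrite ler_piMl // ger0_norm; by have /andP[] := y01 i.
Qed.

Lemma sum_coordinate (F : numFieldType) p k (i : 'I_k) (g : 'I_p -> F) : (0 < p)%N ->
  \sum_(a : {ffun 'I_k -> 'I_p}) g (a i) = p%:R ^+ k / p%:R * \sum_r g r.
Proof.
move=> p0; have := @sum_prod_coordinates F k p 1 (fun=> i) (fun=> g) p0.
rewrite big_ord1; under eq_bigr do rewrite big_ord1.
move=> -> => [|j j' _]; last by rewrite [j]ord1 [j']ord1.
by rewrite mulrA mulrAC.
Qed.

Lemma sum_coordinate2 (F : numFieldType) p k (i i' : 'I_k) (g h : 'I_p -> F) :
  (0 < p)%N -> i != i' ->
  \sum_(a : {ffun 'I_k -> 'I_p}) g (a i) * h (a i') =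
  p%:R ^+ k * ((\sum_r g r) / p%:R * ((\sum_r h r) / p%:R)).
Proof.
move=> p0 ii'.
have := @sum_prod_coordinates F k p 2 (fun j => if j == ord0 then i else i')
  (fun j => if j == ord0 then g else h) p0.
rewrite !big_ord_recl big_ord0 /= mulr1.
under eq_bigr do rewrite !big_ord_recl big_ord0 /= mulr1.
move=> -> // j j'.
case: (unliftP ord0 j) => [j1|] ->; case: (unliftP ord0 j') => [j2|] -> //=.
- by rewrite [j1]ord1 [j2]ord1.
- by move=> ie; rewrite ie eqxx in ii'.
- by move=> ie; rewrite ie eqxx in ii'.
Qed.

Lemma sum_mx_prod (F : comPzRingType) k l q (G : 'I_k -> 'I_l -> 'I_q -> F) :
  \sum_(c : 'M['I_q]_(k, l)) \prod_i \prod_j G i j (c i j) =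
  \prod_i \prod_j \sum_e G i j e.
Proof.
pose h (f : {ffun 'I_k * 'I_l -> 'I_q}) : 'M['I_q]_(k, l) := \matrix_(i, j) f (i, j).
have hbij : bijective h.
  exists (fun c : 'M['I_q]_(k, l) => [ffun z => c z.1 z.2]).
    by move=> f; apply/ffunP => -[i j]; rewrite ffunE mxE.
  by move=> c; apply/matrixP => i j; rewrite mxE ffunE.
rewrite (reindex h) /=; last exact/onW_bij.
rewrite pair_big /= (bigA_distr_bigA (fun z => G z.1 z.2)).
apply: eq_bigr => f _; rewrite pair_big /=.
by apply: eq_bigr => -[i j] _; rewrite mxE.
Qed.

Section weights.
Variables (R : realType) (p q : nat).
Hypotheses (p0 : (0 < p)%N) (q0 : (0 < q)%N).
Variables (k l : nat).
Implicit Types (v : 'I_p -> 'I_p -> 'I_q -> R) (c : 'M['I_q]_(k, l)).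

Let pR : (0 : R) < p%:R. Proof. by rewrite ltr0n. Qed.
Let pn : (p%:R : R) != 0. Proof. by rewrite gt_eqF. Qed.

Lemma pattern_weight_ge0 v c : (forall a b e, 0 <= v a b e) -> 0 <= pattern_weight v c.
Proof.
move=> v0; rewrite mulr_ge0 ?divr_ge0 ?exprn_ge0 //.
do 2 (apply: sumr_ge0 => ? _); by do 2 (apply: prodr_ge0 => ? _).
Qed.

(** A mean distance per colour is all that is available, since trimmed lines need not be close to
    the original ones. The product over cells telescopes into [k * l] differences, and each,
    averaged over all choices of its row and column, is such a mean distance. *)
Lemma pattern_weight_lipschitz v v' c eps :
  (forall a b e, 0 <= v a b e <= 1) -> (forall a b e, 0 <= v' a b e <= 1) ->
  (forall e, \sum_a \sum_b `|v a b e - v' a b e| <= eps * p%:R ^+ 2) ->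
  `|pattern_weight v c - pattern_weight v' c| <= (k`! * l`!)%:R * (k * l)%:R * eps.
Proof.
move=> v01 v'01 L1; rewrite /pattern_weight -mulrBr normrM ger0_norm ?divr_ge0 ?exprn_ge0 //.
rewrite -!mulrA ler_wpM2l // mulrC ler_pdivrMr ?exprn_gt0 //.
rewrite -sumrB; apply: le_trans (ler_norm_sum _ _ _) _.
have dom (a : {ffun 'I_k -> 'I_p}) : incr a ->
   `|\sum_(b : {ffun 'I_l -> 'I_p} | incr b) \prod_i \prod_j v (a i) (b j) (c i j) -
     \sum_(b : {ffun 'I_l -> 'I_p} | incr b) \prod_i \prod_j v' (a i) (b j) (c i j)| <=
   \sum_(b : {ffun 'I_l -> 'I_p}) \sum_i \sum_j
     `|v (a i) (b j) (c i j) - v' (a i) (b j) (c i j)|.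
  move=> _; rewrite -sumrB; apply: le_trans (ler_norm_sum _ _ _) _.
  rewrite big_mkcond; apply: ler_sum => b _; case: ifPn => _; last first.
    by do 2 (apply: sumr_ge0 => ? _).
  rewrite !pair_big /=.
  exact: (ler_norm_prodB (index_enum _) (fun z => v01 _ _ _) (fun z => v'01 _ _ _)).
apply: le_trans (ler_sum _ dom) _.
apply: (@le_trans _ _ (\sum_(a : {ffun 'I_k -> 'I_p}) \sum_(b : {ffun 'I_l -> 'I_p})
    \sum_i \sum_j `|v (a i) (b j) (c i j) - v' (a i) (b j) (c i j)|)).
  by rewrite big_mkcond; apply: ler_sum => a _; case: ifPn => // _; do 3 (apply: sumr_ge0 => ? _).
under eq_bigr => a _.
  rewrite exchange_big; under eq_bigr do rewrite exchange_big.
  over.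
rewrite exchange_big; under eq_bigr do rewrite exchange_big.
apply: (@le_trans _ _ (\sum_(i < k) \sum_(j < l) eps * p%:R ^+ (k + l))).
  apply: ler_sum => i _; apply: ler_sum => j _.
  under eq_bigr => a _ do rewrite (sum_coordinate j (fun b => `|v (a i) b (c i j) - v' (a i) b (c i j)|) p0).
  rewrite -mulr_sumr (sum_coordinate i (fun a => \sum_b `|v a b (c i j) - v' a b (c i j)|) p0).
  have := L1 (c i j); set S := \sum_a \sum_b _ => Sle.
  have -> : p%:R ^+ l / p%:R * (p%:R ^+ k / p%:R * S) = p%:R ^+ (k + l) * (S / p%:R ^+ 2).
    by rewrite exprD; field.
  by rewrite mulrC ler_wpM2r ?exprn_ge0 // ler_pdivrMr ?exprn_gt0.
rewrite sumr_const card_ord sumr_const card_ord -mulrnA -[leLHS]mulr_natl.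
by rewrite mulnC mulrA.
Qed.

(** Every cell sums to 1 over the colours, so what remains is the number of increasing tuples
    against the normalization by powers. *)
Lemma sum_pattern_weight v : (forall a b, \sum_e v a b e = 1) ->
  \sum_(c : 'M['I_q]_(k, l)) pattern_weight v c =
  (k`! * 'C(p, k))%:R / p%:R ^+ k * ((l`! * 'C(p, l))%:R / p%:R ^+ l).
Proof.
move=> v1; rewrite -mulr_sumr exchange_big /=.
under eq_bigr do rewrite exchange_big /=.
have one (a : {ffun 'I_k -> 'I_p}) (b : {ffun 'I_l -> 'I_p}) :
    \prod_i \prod_j \sum_e v (a i) (b j) e = 1.
  by rewrite big1 // => i _; rewrite big1.
under eq_bigr => a _ do under eq_bigr => b _ do
  rewrite (sum_mx_prod (fun i j => v (a i) (b j))) one.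
under eq_bigr do rewrite sumr_const card_incr.
rewrite sumr_const card_incr -mulrnA exprD !natrM.
by field; rewrite !expf_neq0.
Qed.

Definition mx_injb c := injectiveb (fun z : 'I_k * 'I_l => c z.1 z.2).

(** Union bound over pairs of cells [z != z'] of equal colour. They differ in row or in column;
    averaging over that index, separately for the two cells, turns the constant line sums into a
    factor [1 / q] for each, and the [q] possible colours leave [1 / q]. *)
Lemma sum_noninjective_weight v :
  (forall a b e, 0 <= v a b e) -> (forall a b, \sum_e v a b e = 1) ->
  (forall a e, \sum_b v a b e = p%:R / q%:R) ->
  (forall b e, \sum_a v a b e = p%:R / q%:R) ->
  \sum_(c | ~~ mx_injb c) pattern_weight v c <=
  (k`! * l`!)%:R * ((k * l) ^ 2)%:R / q%:R.
Proof.
move=> v0 v1 vrow vcol.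
have qn : (q%:R : R) != 0 by rewrite pnatr_eq0 -lt0n.
pose V (a : 'I_k -> 'I_p) (b : 'I_l -> 'I_p) (z : 'I_k * 'I_l) e :=
  v (a z.1) (b z.2) e.
pose at_ (z : 'I_k * 'I_l) (i : 'I_k) (j : 'I_l) := (i == z.1) && (j == z.2).
have atE z y : at_ z y.1 y.2 = (y == z) by case: z y => [? ?] [? ?].
(* The equality of colours is distributed as one indicator per cell, so that the sum over [c]
   factorizes; every cell other than [z] and [z'] contributes 1. *)
have pair_sum (z z' : 'I_k * 'I_l) (a : 'I_k -> 'I_p) (b : 'I_l -> 'I_p) : z != z' ->
    \sum_(c : 'M['I_q]_(k, l) | c z.1 z.2 == c z'.1 z'.2) \prod_i \prod_j v (a i) (b j) (c i j) =
    \sum_e V a b z e * V a b z' e.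
  move=> zz'; have z'z : z' != z by rewrite eq_sym.
  transitivity (\sum_e \sum_(c : 'M['I_q]_(k, l)) \prod_i \prod_j
     (V a b (i, j) (c i j) * (at_ z i j || at_ z' i j ==> (c i j == e))%:R)).
    rewrite exchange_big big_mkcond /=; apply: eq_bigr => c _.
    transitivity (\sum_e (\prod_i \prod_j v (a i) (b j) (c i j)) *
       ((c z.1 z.2 == e) && (c z'.1 z'.2 == e))%:R).
      rewrite -mulr_sumr (bigD1 (c z.1 z.2)) //= eqxx /= [X in _ + X]big1 ?addr0.
        by rewrite [c z'.1 _ == _]eq_sym; case: ifP => _; rewrite ?mulr1 ?mulr0.
      by move=> e /negPf ne; rewrite [c z.1 _ == _]eq_sym ne.
    apply: eq_bigr => e _; rewrite !pair_big /= big_split /=; congr (_ * _).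
    rewrite (bigD1 z) //= (bigD1 z') //= !atE !eqxx orbT /=.
    rewrite big1 ?mulr1 ?mulrA => [|y /andP[yz yz']].
      by case: (_ == _); case: (_ == _); rewrite ?mulr0 ?mulr1.
    by rewrite !atE (negPf yz) (negPf yz').
  apply: eq_bigr => e _.
  rewrite (sum_mx_prod (fun i j e' => V a b (i, j) e' *
     (at_ z i j || at_ z' i j ==> (e' == e))%:R)).
  rewrite pair_big /= (bigD1 z) //= (bigD1 z') //= !atE.
  rewrite !eqxx orbT /= [X in _ * (_ * X)]big1 ?mulr1 => [|y /andP[yz yz']]; last first.
    rewrite !atE (negPf yz) (negPf yz') /=.
    by under eq_bigr do rewrite mulr1; exact: v1.
  have one (F : 'I_q -> R) : \sum_e' F e' * (e' == e)%:R = F e.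
    rewrite (bigD1 e) //= eqxx mulr1 big1 ?addr0 // => e' /negPf ->.
    by rewrite mulr0.
  by rewrite !one.
have pair_bound (z z' : 'I_k * 'I_l) : z != z' ->
    \sum_(c : 'M['I_q]_(k, l) | c z.1 z.2 == c z'.1 z'.2) pattern_weight v c <= (k`! * l`!)%:R / q%:R.
  move=> zz'; rewrite -mulr_sumr exchange_big /=.
  under eq_bigr do rewrite exchange_big /=.
  under eq_bigr => a _ do under eq_bigr => b _ do rewrite pair_sum //.
  (* Dropping the monotonicity of [a] and [b] makes their coordinates independent. *)
  apply: (@le_trans _ _ ((k`! * l`!)%:R / p%:R ^+ (k + l) *
     \sum_(a : {ffun 'I_k -> 'I_p}) \sum_(b : {ffun 'I_l -> 'I_p})
        \sum_e V a b z e * V a b z' e)).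
    rewrite ler_wpM2l ?divr_ge0 ?exprn_ge0 // big_mkcond; apply: ler_sum => a _.
    have nn b : 0 <= \sum_e V a b z e * V a b z' e.
      by apply: sumr_ge0 => e _; apply: mulr_ge0; exact: v0.
    case: ifPn => _; last by apply: sumr_ge0.
    by rewrite big_mkcond; apply: ler_sum => b _; case: ifPn.
  rewrite le_eqVlt; apply/orP; left; apply/eqP.
  have cancel_q (S : R) : S = p%:R ^+ (k + l) / q%:R ->
      (k`! * l`!)%:R / p%:R ^+ (k + l) * S = (k`! * l`!)%:R / q%:R.
    by move=> ->; rewrite mulrA divfK ?expf_neq0.
  have sumq (x : R) : \sum_(e < q) (p%:R / q%:R / p%:R * (p%:R / q%:R / p%:R)) * x = x / q%:R.
    rewrite sumr_const card_ord -[LHS]mulr_natl; field.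
    by rewrite qn pn.
  apply: cancel_q; have [z1|z1] := eqVneq z.1 z'.1.
    have z2 : z.2 != z'.2.
      by apply: contraNneq zz' => z2; rewrite [z]surjective_pairing [z']surjective_pairing z1 z2.
    rewrite -(sumq (p%:R ^+ (k + l))).
    under eq_bigr do rewrite exchange_big /=.
    rewrite exchange_big /=; apply: eq_bigr => e _.
    under eq_bigr => a _ do rewrite (sum_coordinate2 (v (a z.1) ^~ e) (v (a z'.1) ^~ e) p0 z2) !vrow.
    by rewrite sumr_const card_ffun !card_ord -[LHS]mulr_natl natrX exprD; ring.
  rewrite -(sumq (p%:R ^+ (k + l))) exchange_big /=.
  under eq_bigr do rewrite exchange_big /=.
  rewrite exchange_big /=; apply: eq_bigr => e _.
  under eq_bigr => b _ do rewrite (sum_coordinate2 (fun a => v a (b z.2) e) (fun a => v a (b z'.2) e) p0 z1) !vcol.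
  by rewrite sumr_const card_ffun !card_ord -[LHS]mulr_natl natrX exprD; ring.
apply: (@le_trans _ _ (\sum_(z : 'I_k * 'I_l) \sum_(z' : 'I_k * 'I_l)
    (if z != z' then \sum_(c : 'M['I_q]_(k, l) | c z.1 z.2 == c z'.1 z'.2) pattern_weight v c else 0))).
  have -> : \sum_(z : 'I_k * 'I_l) \sum_(z' : 'I_k * 'I_l)
    (if z != z' then \sum_(c : 'M['I_q]_(k, l) | c z.1 z.2 == c z'.1 z'.2) pattern_weight v c else 0) =
    \sum_(c : 'M['I_q]_(k, l)) \sum_(z : 'I_k * 'I_l) \sum_(z' : 'I_k * 'I_l)
      (if (z != z') && (c z.1 z.2 == c z'.1 z'.2) then pattern_weight v c else 0).
    rewrite [RHS]exchange_big /=; apply: eq_bigr => z _.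
    rewrite [RHS]exchange_big /=; apply: eq_bigr => z' _.
    case: (z != z') => /=; first by rewrite big_mkcond.
    by rewrite big1.
  rewrite big_mkcond; apply: ler_sum => c _.
  have nn z z' : 0 <= (if (z != z') && (c z.1 z.2 == c z'.1 z'.2)
       then pattern_weight v c else 0).
    by case: ifPn => // _; exact: pattern_weight_ge0.
  case: ifPn => [|_]; last by do 2 (apply: sumr_ge0 => ? _).
  case/injectivePn => z [z' zz' czz'].
  rewrite (bigD1 z) //= (bigD1 z') //= zz' czz' eqxx /= -addrA lerDl addr_ge0 //.
    by apply: sumr_ge0 => y _; case: ifP => // _; exact: pattern_weight_ge0.
  by apply: sumr_ge0 => y _; apply: sumr_ge0 => y' _; exact: nn.
apply: (@le_trans _ _ (\sum_(z : 'I_k * 'I_l) \sum_(z' : 'I_k * 'I_l) (k`! * l`!)%:R / q%:R)).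
  apply: ler_sum => z _; apply: ler_sum => z' _; case: ifPn => [|_]; first exact: pair_bound.
  by rewrite divr_ge0.
rewrite !sumr_const card_prod !card_ord -mulrnA -[leLHS]mulr_natl mulnn.
by rewrite mulrCA mulrA.
Qed.

End weights.

(** * Trimming exceptional lines and passing to a Latin square *)

Lemma card_large_rows (R : realFieldType) (p q : nat) (x : 'I_p -> 'I_q -> R) delta :
  0 < delta -> \sum_a \sum_c x a c ^+ 2 <= delta ^+ 3 * p%:R ->
  (#|[set a | [exists c, delta < `|x a c|]]%SET|)%:R <= delta * p%:R.
Proof.
move=> delta0 sumx; set B := [set a | _]%SET.
(* Each counted row contributes at least [delta ^+ 2], so the hypothesis with [delta ^+ 3] leaves
   one factor [delta] for the proportion of such rows. *)
rewrite -(ler_pM2l (exprn_gt0 2 delta0)) mulrA -exprSr.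
apply: le_trans sumx; rewrite mulr_natr -sumr_const big_mkcond.
have x2 a c : 0 <= x a c ^+ 2 by rewrite sqr_ge0.
apply: ler_sum => a _; case: ifPn => [|_]; last exact: sumr_ge0.
rewrite inE => /existsP[c xac]; rewrite (bigD1 c) //=.
apply: (@le_trans _ _ (x a c ^+ 2)); last by rewrite lerDl sumr_ge0.
by rewrite -[leRHS]real_normK ?num_real // lerXn2r ?nnegrE ?normr_ge0 // ltW.
Qed.

Section trimming.
Variables (R : realType) (p q : nat) (w : 'I_p -> 'I_p -> 'I_q -> R) (delta : R).
Hypotheses (p0 : (0 < p)%N) (q0 : (0 < q)%N) (delta0 : 0 < delta).
Hypothesis delta1 : 8%:R * q%:R * delta <= 1.
Hypothesis w0 : forall a b c, 0 <= w a b c.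
Hypothesis w_cell : forall a b, \sum_c w a b c = 1.
Hypothesis w_row : \sum_a \sum_c ((\sum_b w a b c) / p%:R - q%:R^-1) ^+ 2 <= delta ^+ 3 * p%:R.
Hypothesis w_col : \sum_b \sum_c ((\sum_a w a b c) / p%:R - q%:R^-1) ^+ 2 <= delta ^+ 3 * p%:R.

(* The exceptional rows and columns, few by Chebyshev's inequality, are
   replaced by the uniform distribution before rounding. *)
Lemma exists_near_integral_array :
  exists (d : 'I_p -> 'I_p -> 'I_q -> nat) (s e : nat),
  [/\ (0 < s)%N, forall a b, (\sum_c d a b c = s)%N,
      forall a c, (\sum_b d a b c = e)%N, forall b c, (\sum_a d a b c = e)%N &
      forall c, \sum_a \sum_b `|(d a b c)%:R / s%:R - w a b c| <=
        18%:R * q%:R * delta * p%:R ^+ 2].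
Proof.
have qR : (0 : R) < q%:R by rewrite ltr0n.
have pR : (0 : R) < p%:R by rewrite ltr0n.
have q1 : q%:R^-1 <= 1 :> R by rewrite invf_le1 // ler1n.
have qV : 0 < q%:R^-1 :> R by rewrite invr_gt0.
have w1 a b c : w a b c <= 1.
  by rewrite -(w_cell a b) (bigD1 c) //= lerDl sumr_ge0.
set B := [set a | [exists c, delta < `|(\sum_b w a b c) / p%:R - q%:R^-1|]]%SET.
set B' := [set b | [exists c, delta < `|(\sum_a w a b c) / p%:R - q%:R^-1|]]%SET.
have cB : #|B|%:R <= delta * p%:R := card_large_rows delta0 w_row.
have cB' : #|B'|%:R <= delta * p%:R := card_large_rows delta0 w_col.
(* The sum of a line that is kept is off by [delta * p] for its replaced entries and by [delta * p]
   for the line itself, hence the tolerance [2%:R * delta] passed to the rounding. *)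
pose v a b c : R := if (a \in B) || (b \in B') then q%:R^-1 else w a b c.
have vw a b c : `|v a b c - w a b c| <= (a \in B)%:R + (b \in B')%:R.
  rewrite /v; case: (a \in B); case: (b \in B'); rewrite /= ?subrr ?normr0 ?addr0 ?add0r ?ler01 //;
  have := w0 a b c; have := w1 a b c; rewrite ler_norml; move: q1 qV; lra.
have v_cell a b : \sum_c v a b c = 1.
  rewrite /v; case: (_ || _) => //; rewrite sumr_const card_ord -(mulr_natr q%:R^-1).
  by rewrite mulVf // gt_eqF.
have cst : \sum_(b < p) q%:R^-1 = p%:R / q%:R :> R.
  by rewrite sumr_const card_ord -(mulr_natl q%:R^-1).
have sumB (S : {set 'I_p}) : \sum_a (a \in S)%:R = #|S|%:R :> R.
  by rewrite -natr_sum -sum1_card [in RHS]big_mkcond; congr _%:R; apply: eq_bigr => a _; case: (_ \in _).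
have near (y z : 'I_p -> R) (S : {set 'I_p}) : #|S|%:R <= delta * p%:R ->
    `|(\sum_b z b) / p%:R - q%:R^-1| <= delta ->
    (forall b, `|y b - z b| <= (b \in S)%:R) ->
    `|\sum_b y b - p%:R / q%:R| <= 2%:R * delta * p%:R.
  move=> cS zd yz.
  have -> : \sum_b y b - p%:R / q%:R =
     \sum_b (y b - z b) + p%:R * ((\sum_b z b) / p%:R - q%:R^-1).
    by rewrite sumrB; field; rewrite !gt_eqF.
  apply: le_trans (ler_normD _ _) _.
  have -> : 2%:R * delta * p%:R = delta * p%:R + p%:R * delta by ring.
  apply: lerD; last by rewrite normrM normr_nat ler_wpM2l.
  apply: le_trans cS; rewrite -sumB; apply: le_trans (ler_norm_sum _ _ _) _.
  exact: ler_sum.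
have v_row a c : `|\sum_b v a b c - p%:R / q%:R| <= 2%:R * delta * p%:R.
  have [aB|aB] := boolP (a \in B).
    by rewrite /v aB /= cst subrr normr0 !mulr_ge0 // ltW.
  apply: (near _ (fun b => w a b c) B') => //.
    by move: aB; rewrite inE negb_exists => /forallP/(_ c); rewrite -leNgt.
  by move=> b; have := vw a b c; rewrite (negPf aB) add0r.
have v_col b c : `|\sum_a v a b c - p%:R / q%:R| <= 2%:R * delta * p%:R.
  have [bB|bB] := boolP (b \in B').
    rewrite /v bB /=; under eq_bigr do rewrite orbT.
    by rewrite cst subrr normr0 !mulr_ge0 // ltW.
  apply: (near _ (fun a => w a b c) B) => //.
    by move: bB; rewrite inE negb_exists => /forallP/(_ c); rewrite -leNgt.
  by move=> a; have := vw a b c; rewrite (negPf bB) addr0.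
have [|a b c||d [s [e [s0 dcell drow dcol dv]]]] :=
  @exists_integral_array R p q v (2%:R * delta) p0 q0 _ _ v_cell v_row v_col.
- by rewrite mulr_gt0.
- by rewrite /v; case: ifP => // _; rewrite ltW.
- by apply: le_trans delta1; rewrite le_eqVlt; apply/orP; left; apply/eqP; ring.
exists d, s, e; split=> // c.
apply: (@le_trans _ _ (\sum_(a < p) \sum_(b < p)
    (8%:R * q%:R * (2%:R * delta) + (a \in B)%:R + (b \in B')%:R))).
  apply: ler_sum => a _; apply: ler_sum => b _.
  have -> : (d a b c)%:R / s%:R - w a b c =
    ((d a b c)%:R / s%:R - v a b c) + (v a b c - w a b c) by ring.
  rewrite -[leRHS]addrA; apply: le_trans (ler_normD _ _) _.
  exact: lerD (dv a b c) (vw a b c).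
have dsum (K : R) (x y : 'I_p -> R) : \sum_a \sum_b (K + x a + y b) =
    p%:R * (p%:R * K) + p%:R * \sum_a x a + p%:R * \sum_b y b.
  under eq_bigr do rewrite big_split /= sumr_const card_ord -[X in X + _]mulr_natl.
  rewrite big_split /= -mulr_sumr big_split /= !sumr_const card_ord.
  by rewrite -(mulr_natl (\sum_b y b)) -(mulr_natl K); ring.
rewrite dsum !sumB.
(* [18 = 16 + 2]: rounding with tolerance [2%:R * delta] costs [16 * q * delta] per cell, and the
   replaced rows and columns add at most [delta] each on average. *)
have p1 : p%:R * (#|B|%:R) <= p%:R * (delta * p%:R) by rewrite ler_wpM2l.
have p2 : p%:R * (#|B'|%:R) <= p%:R * (delta * p%:R) by rewrite ler_wpM2l.
have p3 : p%:R * (delta * p%:R) <= q%:R * (p%:R * (delta * p%:R)).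
  by rewrite ler_peMl ?ler1n // !mulr_ge0 // ltW.
by lra.
Qed.

(** The injective colour patterns equivalent to [A] bound the density from below, and the other
    injective ones bound its complement from below; together they miss only the non-injective
    patterns and the defect [1 - tot], so the density is pinched. Non-injective weights are bounded
    for the array with exact line sums and then transferred to [w]. *)
Lemma latin_of_weights : exists n (L : 'M['I_n]_n), [/\ (p <= n)%N, latin_square L &
  forall k l (A : 'M['I_(k * l)]_(k, l)), (k <= p)%N -> (l <= p)%N ->
   let N := (k`! * l`!)%:R : R in
   let err := #|{: 'M['I_q]_(k, l)}|%:R * (N * (k * l)%:R * (18%:R * q%:R * delta)) in
   let col := N * ((k * l) ^ 2)%:R / q%:R in
   let tot := (k`! * 'C(p, k))%:R / p%:R ^+ k * ((l`! * 'C(p, l))%:R / p%:R ^+ l) in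
   `|density R A L - \sum_(c | mx_injb c && struct_equiv c A) pattern_weight w c| <=
     col + err + `|1 - tot| /\
   \sum_(c : 'M['I_q]_(k, l) | ~~ mx_injb c) pattern_weight w c <= col + err].
Proof.
have [d [s [e [s0 dcell drow dcol dw]]]] := exists_near_integral_array.
have [n [D [L [pn Llat Lfreq]]]] := latin_of_block_array p0 s0 dcell drow dcol.
exists n, L; split=> // k l A kp lp N err col tot.
pose v a b c : R := (d a b c)%:R / s%:R.
have v0 a b c : 0 <= v a b c by rewrite divr_ge0.
have sR : (0 : R) < s%:R by rewrite ltr0n.
have sn : (s%:R : R) != 0 by rewrite gt_eqF.
have qn : (q%:R : R) != 0 by rewrite pnatr_eq0 -lt0n.
have v_cell a b : \sum_c v a b c = 1.
  by rewrite -mulr_suml -natr_sum dcell mulfV.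
have se : (q * e = p * s)%N.
  have : (\sum_(b < p) \sum_c d (Ordinal p0) b c = \sum_(c < q) e)%N.
    by rewrite exchange_big; apply: eq_bigr => c _; exact: drow.
  under eq_bigr do rewrite dcell.
  by rewrite !sum_nat_const !card_ord.
have esq : (e%:R / s%:R : R) = p%:R / q%:R.
  by apply/eqP; rewrite eqr_div // -!natrM -se mulnC.
have v_row a c : \sum_b v a b c = p%:R / q%:R.
  by rewrite -mulr_suml -natr_sum drow.
have v_col b c : \sum_a v a b c = p%:R / q%:R.
  by rewrite -mulr_suml -natr_sum dcol.
have le1 (u : 'I_p -> 'I_p -> 'I_q -> R) : (forall a b c, 0 <= u a b c) ->
    (forall a b, \sum_c u a b c = 1) -> forall a b c, 0 <= u a b c <= 1.
  move=> u0 u1 a b c; rewrite u0 /= -(u1 a b) (bigD1 c) //= lerDl; exact: sumr_ge0.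
have lip (c : 'M['I_q]_(k, l)) : `|pattern_weight v c - pattern_weight w c| <=
     N * (k * l)%:R * (18%:R * q%:R * delta).
  apply: pattern_weight_lipschitz => //; exact: le1.
have sum_lip (P : pred 'M['I_q]_(k, l)) :
    `|\sum_(c | P c) pattern_weight v c - \sum_(c | P c) pattern_weight w c| <= err.
  rewrite -sumrB; apply: le_trans (ler_norm_sum _ _ _) _.
  apply: (@le_trans _ _ (\sum_(c : 'M['I_q]_(k, l)) N * (k * l)%:R * (18%:R * q%:R * delta))).
    rewrite big_mkcond; apply: ler_sum => c _; case: ifP => // _.
    by rewrite !mulr_ge0 // ltW.
  by rewrite sumr_const -[leLHS]mulr_natl.
have non := @sum_noninjective_weight R p q p0 q0 k l v v0 v_cell v_row v_col.
have total := @sum_pattern_weight R p q p0 k l v v_cell.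
have coarse (M : 'M['I_n]_(k, l)) (c : 'M['I_q]_(k, l)) :
    mx_injb c -> (forall i j, (M i j %/ D)%N = c i j) ->
    struct_equiv M A = struct_equiv c A.
  move=> /injectiveP cinj Mc; apply: struct_equiv_coarsen => // i j i' j'.
  by rewrite !leEord -!Mc => /leq_div2r; exact.
pose SA := \sum_(c | mx_injb c && struct_equiv c A) pattern_weight v c.
pose SN := \sum_(c : 'M['I_q]_(k, l) | mx_injb c && ~~ struct_equiv c A) pattern_weight v c.
have low : SA <= density R A L.
  apply: (Lfreq R k l _ (fun M => struct_equiv M A)) => // M c /andP[cinj cA] Mc.
  by rewrite (coarse M c).
have high : SN <= 1 - density R A L.
  rewrite -(@pattern_frequencyC R k l n L (fun M => struct_equiv M A)) ?(leq_trans _ pn) //.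
  apply: (Lfreq R k l _ (predC (fun M => struct_equiv M A))) => // M c /andP[cinj cA] Mc.
  by rewrite /= (coarse M c).
have totE : tot = SA + SN + \sum_(c : 'M['I_q]_(k, l) | ~~ mx_injb c) pattern_weight v c.
  rewrite /tot -total (bigID (@mx_injb q k l)) /=; congr (_ + _).
  by rewrite (bigID (fun c => struct_equiv c A)).
have := sum_lip (fun c => mx_injb c && struct_equiv c A).
have := sum_lip (fun c => ~~ mx_injb c).
rewrite -/SA; move: non; rewrite -/N -/col.
set X := \sum_(c | ~~ _) _; set X' := \sum_(c | ~~ _) _; set Y := \sum_(c | _) _.
rewrite -/X in totE.
move=> non; rewrite !ler_norml => /andP[x1 x2] /andP[y1 y2].
have := ler_norm (1 - tot); split; last by lra.
apply/andP; split; lra.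
Qed.

End trimming.

Local Open Scope classical_set_scope.
Local Open Scope ring_scope.

(** * Expectation of bounded measurable functions *)

Section bounded_measurable.
Context d (T : measurableType d) (R : realType).
Implicit Types F G : T -> R.

(** A class closed under ring operations, sections and partial expectations, on which integrability
    and Fubini's theorem hold without further conditions. *)
Definition bounded_measurable F :=
  measurable_fun setT F /\ exists M, forall z, `|F z| <= M.

Lemma bounded_measurable_cst r : bounded_measurable (fun=> r).
Proof. by split; [exact: measurable_cst|exists `|r|]. Qed.

Lemma bounded_measurableD F G : bounded_measurable F -> bounded_measurable G ->
  bounded_measurable (fun z => F z + G z).
Proof.
move=> [mF [M FM]] [mG [N GN]]; split; first exact: measurable_funD.
by exists (M + N) => z; apply: le_trans (ler_normD _ _) (lerD _ _).
Qed.

Lemma bounded_measurableM F G : bounded_measurable F -> bounded_measurable G ->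
  bounded_measurable (fun z => F z * G z).
Proof.
move=> [mF [M FM]] [mG [N GN]]; split; first exact: measurable_funM.
by exists (M * N) => z; rewrite normrM ler_pM.
Qed.

Lemma bounded_measurableB F G : bounded_measurable F -> bounded_measurable G ->
  bounded_measurable (fun z => F z - G z).
Proof.
move=> bF bG; have := bounded_measurableD bF (bounded_measurableM (bounded_measurable_cst (-1)) bG).
by congr bounded_measurable; apply/funext => z; rewrite mulN1r.
Qed.

Lemma bounded_measurable_sum (I : Type) (r : seq I) (P : pred I) (F : I -> T -> R) :
  (forall i, bounded_measurable (F i)) ->
  bounded_measurable (fun z => \sum_(i <- r | P i) F i z).
Proof.
move=> bF; elim: r => [|i r IHr].
  by under eq_fun do rewrite big_nil; exact: bounded_measurable_cst.
under eq_fun do rewrite big_cons; case: (P i) => //.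
exact: bounded_measurableD.
Qed.

Lemma bounded_measurable_prod (I : Type) (r : seq I) (F : I -> T -> R) :
  (forall i, bounded_measurable (F i)) ->
  bounded_measurable (fun z => \prod_(i <- r) F i z).
Proof.
move=> bF; elim: r => [|i r IHr].
  by under eq_fun do rewrite big_nil; exact: bounded_measurable_cst.
under eq_fun do rewrite big_cons; exact: bounded_measurableM.
Qed.

Lemma bounded_measurable_indic (A : set T) : measurable A ->
  bounded_measurable (fun z => (z \in A)%:R).
Proof.
move=> mA; split; last first.
  by exists 1 => z; case: (_ \in _); rewrite ?normr1 ?normr0.
by rewrite -[X in measurable_fun _ X]/(\1_A : T -> R); exact: measurable_indic.
Qed.

End bounded_measurable.

Lemma bounded_measurable_comp d1 d2 (T1 : measurableType d1) (T2 : measurableType d2)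
    (R : realType) (F : T2 -> R) (g : T1 -> T2) :
  bounded_measurable F -> measurable_fun setT g -> bounded_measurable (fun z => F (g z)).
Proof.
move=> [mF [M FM]] mg; split; first exact: (measurableT_comp mF mg).
by exists M.
Qed.

Section expectation.
Context d (T : measurableType d) (R : realType) (P : probability T R).
Implicit Types F G : T -> R.

Lemma integrable_bounded F : bounded_measurable F -> P.-integrable setT (EFin \o F).
Proof.
move=> [mF [M FM]]; apply: measurable_bounded_integrable => //.
  by rewrite [X in (X < _)%E]probability_setT ltry.
by exists M; split; rewrite ?num_real // => N MN z _; apply: le_trans (FM z) (ltW MN).
Qed.

Lemma expect_EFin F : bounded_measurable F ->
  (\int[P]_z (F z)%:E = (\int[P]_z F z)%:E)%E.
Proof.
move=> bF; rewrite /Rintegral fineK //.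
exact: (integrable_fin_num measurableT (integrable_bounded bF)).
Qed.

Lemma expectD F G : bounded_measurable F -> bounded_measurable G ->
  \int[P]_z (F z + G z) = \int[P]_z F z + \int[P]_z G z.
Proof. by move=> bF bG; rewrite RintegralD //; exact: integrable_bounded. Qed.

Lemma expectB F G : bounded_measurable F -> bounded_measurable G ->
  \int[P]_z (F z - G z) = \int[P]_z F z - \int[P]_z G z.
Proof. by move=> bF bG; rewrite RintegralB //; exact: integrable_bounded. Qed.

Lemma expectZ r F : bounded_measurable F ->
  \int[P]_z (r * F z) = r * \int[P]_z F z.
Proof. by move=> bF; rewrite RintegralZl //; exact: integrable_bounded. Qed.

Lemma expect_cst r : \int[P]_z r = r.
Proof.
rewrite /Rintegral integral_cst // [X in (_ * X)%E](_ : _ = 1%E) ?mule1 //.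
exact: probability_setT.
Qed.

Lemma expect_sum (I : Type) (r : seq I) (Q : pred I) (F : I -> T -> R) :
  (forall i, bounded_measurable (F i)) ->
  \int[P]_z (\sum_(i <- r | Q i) F i z) = \sum_(i <- r | Q i) \int[P]_z F i z.
Proof.
move=> bF; elim: r => [|i r IHr].
  by under eq_Rintegral do rewrite big_nil; rewrite big_nil expect_cst.
under eq_Rintegral do rewrite big_cons; rewrite big_cons -IHr; case: (Q i) => //.
by rewrite expectD //; exact: bounded_measurable_sum.
Qed.

Lemma le_expect F G : bounded_measurable F -> bounded_measurable G ->
  (forall z, F z <= G z) -> \int[P]_z F z <= \int[P]_z G z.
Proof.
move=> bF bG FG; rewrite -subr_ge0 -expectB //.
by apply: Rintegral_ge0 => z _; rewrite subr_ge0.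
Qed.

Lemma norm_expect F M : bounded_measurable F -> (forall z, `|F z| <= M) ->
  `|\int[P]_z F z| <= M.
Proof.
move=> bF FM; have bM r := @bounded_measurable_cst _ T R r.
rewrite ler_norml; apply/andP; split.
  rewrite -[leLHS]expect_cst; apply: le_expect => // z.
  by have := FM z; rewrite ler_norml => /andP[].
rewrite -[leRHS]expect_cst; apply: le_expect => // z.
by have := FM z; rewrite ler_norml => /andP[].
Qed.

(** The first moment method: values at least [r] everywhere would have mean at least [r]. *)
Lemma expect_exists F r : bounded_measurable F -> \int[P]_z F z < r ->
  exists z, F z < r.
Proof.
move=> bF Fr; apply: contrapT => /forallNP nF.
have : r <= \int[P]_z F z.
  rewrite -[leLHS]expect_cst; apply: le_expect => //.
    exact: bounded_measurable_cst.
  by move=> z; rewrite leNgt; apply/negP.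
by rewrite leNgt Fr.
Qed.

End expectation.

Lemma expect_pushforward d1 d2 (T1 : measurableType d1) (T2 : measurableType d2)
    (R : realType) (P1 : probability T1 R) (P2 : probability T2 R)
    (g : T1 -> T2) (F : T2 -> R) : measurable_fun setT g -> bounded_measurable F ->
  (forall A, measurable A -> P1 (g @^-1` A) = P2 A) ->
  \int[P1]_z F (g z) = \int[P2]_z F z.
Proof.
move=> mg bF P12.
pose gm : {mfun T1 >-> T2} := HB.pack g (isMeasurableFun.Build _ _ _ _ g mg).
have -> : \int[P2]_z F z = \int[distribution P1 gm]_z F z.
  by congr fine; apply: eq_measure_integral => A mA _; exact: (esym (P12 A mA)).
rewrite /Rintegral integral_distribution //; last first.
  exact: (integrable_bounded P1 (bounded_measurable_comp bF mg)).
by apply/measurable_EFinP; have [] := bF.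
Qed.

Section expect_product.
Context d1 d2 (T1 : measurableType d1) (T2 : measurableType d2) (R : realType).
Variables (P1 : probability T1 R) (P2 : probability T2 R) (F : T1 * T2 -> R).
Hypothesis bF : bounded_measurable F.

Lemma bounded_measurable_section1 x : bounded_measurable (fun y => F (x, y)).
Proof.
by apply: (bounded_measurable_comp bF); exact: pair1_measurable.
Qed.

Lemma bounded_measurable_section2 y : bounded_measurable (fun x => F (x, y)).
Proof.
by apply: (bounded_measurable_comp bF); exact: pair2_measurable.
Qed.

Let iF : (P1 \x P2)%E.-integrable setT (EFin \o F).
Proof. exact: (integrable_bounded (P1 \x P2)%E bF). Qed.

Lemma bounded_measurable_expect2 : bounded_measurable (fun x => \int[P2]_y F (x, y)).
Proof.
split.
  have := measurable_fubini_F iF => mFF; apply/measurable_EFinP.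
  move: mFF; congr measurable_fun; apply/funext => x /=.
  exact: (expect_EFin P2 (bounded_measurable_section1 x)).
have [_ [M FM]] := bF; exists M => x.
by apply: norm_expect; [exact: bounded_measurable_section1|].
Qed.

Lemma bounded_measurable_expect1 : bounded_measurable (fun y => \int[P1]_x F (x, y)).
Proof.
split.
  have := measurable_fubini_G iF => mFF; apply/measurable_EFinP.
  move: mFF; congr measurable_fun; apply/funext => y /=.
  exact: (expect_EFin P1 (bounded_measurable_section2 y)).
have [_ [M FM]] := bF; exists M => y.
by apply: norm_expect; [exact: bounded_measurable_section2|].
Qed.

Lemma expect_prod12 :
  \int[(P1 \x P2)%E]_z F z = \int[P1]_x \int[P2]_y F (x, y).
Proof.
rewrite /Rintegral -(integral12_prod_meas1 iF); congr fine.
apply: eq_integral => x _.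
exact: (expect_EFin P2 (bounded_measurable_section1 x)).
Qed.

Lemma expect_prod21 :
  \int[(P1 \x P2)%E]_z F z = \int[P2]_y \int[P1]_x F (x, y).
Proof.
rewrite /Rintegral -(integral21_prod_meas1 iF); congr fine.
apply: eq_integral => y _.
exact: (expect_EFin P1 (bounded_measurable_section2 y)).
Qed.

End expect_product.

(** * Sampling from a power of a probability space *)

Section boxes.
Context d (T : measurableType d) (R : realType).

Definition box n (A : 'I_n -> set T) : set (n.-tuple T) :=
  [set t | forall i, A i (tnth t i)].

Lemma measurable_box n (A : 'I_n -> set T) :
  (forall i, measurable (A i)) -> measurable (box A).
Proof.
move=> mA; have -> : box A = \bigcap_(i in setT) ((fun t => tnth t i) @^-1` A i).
  by apply/seteqP; split=> [t tA i _|t tA i]; [exact: tA|exact: (tA i Logic.I)].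
apply: fin_bigcap_measurable => // i _.
by rewrite -[X in measurable X]setTI; exact: measurable_tnth.
Qed.

Lemma prod_prob_box n (P : 'I_n -> probability T R) (A : 'I_n -> set T) :
  (forall i, measurable (A i)) ->
  (prod_prob P (box A) = \prod_(i < n) P i (A i))%E.
Proof.
elim: n P A => [|n IHn] P A mA.
  by rewrite big_ord0 /= diracE mem_set // => -[].
rewrite big_ord_recl -IHn //.
have -> : (prod_prob P (box A) =
   (P ord0 \x prod_prob (fun i => P (lift ord0 i)))
     (A ord0 `*` box (fun i => A (lift ord0 i))))%E.
  rewrite /= /distribution /pushforward; congr (_ _).
  apply/seteqP; split=> [[x t] /= xA|[x t] /= [xA tA] i].
    by split=> [|i]; [have := xA ord0|have := xA (lift ord0 i); rewrite tnthS].
  by case: (unliftP ord0 i) => [j|] -> //; rewrite tnthS.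
by rewrite product_measure1E //; exact: measurable_box.
Qed.

(** Boxes are stable under intersection and generate the sigma-algebra of tuples, the preimage of a
    set under a coordinate being a box whose other sides are full. *)
Lemma tuple_measure_unique n (P1 P2 : probability (n.-tuple T) R) :
  (forall A : 'I_n -> set T, (forall i, measurable (A i)) ->
    P1 (box A) = P2 (box A)) ->
  forall B, measurable B -> P1 B = P2 B.
Proof.
move=> P12 B mB.
pose G := [set C | exists A : 'I_n -> set T, (forall i, measurable (A i)) /\ C = box A].
apply: (@measure_unique _ R (n.-tuple T) G (fun=> setT)) => //.
- apply/seteqP; split.
    apply: smallest_sub; first exact: smallest_sigma_algebra.
    move=> C; rewrite -bigcup_seq => -[i _ [A mA <-]].
    apply: sub_sigma_algebra.
    exists (fun j => if j == i then A else setT); split.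
      by move=> j; case: ifP.
    rewrite setTI; apply/seteqP; split=> [t tA j|t /(_ i)]; last by rewrite eqxx.
    by case: eqP => [->|].
  apply: smallest_sub; first exact: sigma_algebra_measurable.
  by move=> _ [A [mA ->]]; exact: measurable_box.
- move=> _ _ [A [mA ->]] [A' [mA' ->]]; exists (fun i => A i `&` A' i); split.
    by move=> i; exact: measurableI.
  apply/seteqP; split=> [t [tA tA'] i|t tA]; first by split.
  by split=> i; have [] := tA i.
- by move=> _; exists (fun=> setT); split=> //; apply/seteqP; split.
- by apply/seteqP; split=> // x _; exists 0%N.
- by move=> _ [A [mA ->]]; exact: P12.
- by move=> _; rewrite [X in (X < _)%E]probability_setT ltry.
Qed.

End boxes.

(** Identifies the law of [g] by its values on boxes. It recognizes independent samples, both among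
    selected coordinates and in concatenated tuples. *)
Lemma expect_to_tuple dS (S : measurableType dS) d (T : measurableType d) (R : realType)
    (Q : probability S R) n (P : 'I_n -> probability T R) (g : S -> n.-tuple T)
    (F : n.-tuple T -> R) :
  measurable_fun setT g -> bounded_measurable F ->
  (forall A, (forall i, measurable (A i)) ->
    (Q (g @^-1` box A) = \prod_(i < n) P i (A i))%E) ->
  \int[Q]_z F (g z) = \int[prod_prob P]_t F t.
Proof.
move=> mg bF QA; apply: expect_pushforward => //.
pose gm : {mfun S >-> n.-tuple T} := HB.pack g (isMeasurableFun.Build _ _ _ _ g mg).
move=> B mB; rewrite -[LHS]/(distribution Q gm B); apply: tuple_measure_unique => // A mA.
by rewrite prod_prob_box //; exact: QA.
Qed.

Section sampling.
Context d (T : measurableType d) (R : realType) (mu : probability T R).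

Notation power n := (prod_prob (fun _ : 'I_n => mu)).

Definition select p k (a : 'I_k -> 'I_p) (t : p.-tuple T) : k.-tuple T :=
  [tuple tnth t (a i) | i < k].

Lemma measurable_select p k (a : 'I_k -> 'I_p) : measurable_fun setT (select a).
Proof.
apply/measurable_fun_tnthP => i.
rewrite (_ : _ \o _ = fun t => tnth t (a i)); first exact: measurable_tnth.
by apply/funext => t /=; rewrite tnth_mktuple.
Qed.

Lemma prod_select_sets p k (a : 'I_k -> 'I_p) (A : 'I_k -> set T) :
  injective a ->
  (\prod_(j < p) mu (if [pick i | a i == j] is Some i then A i else setT) =
   \prod_(i < k) mu (A i))%E.
Proof.
move=> ainj; rewrite [RHS](partition_big a predT) //=; apply: eq_bigr => j _.
case: pickP => [i /eqP aij|noj]; last by rewrite big_pred0 //; exact: probability_setT.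
by rewrite (big_pred1 i) // => i'; apply/eqP/eqP => [|-> //]; rewrite -aij => /ainj.
Qed.

Lemma expect_select p k (a : 'I_k -> 'I_p) (F : k.-tuple T -> R) :
  injective a -> bounded_measurable F ->
  \int[power p]_t F (select a t) = \int[power k]_t F t.
Proof.
move=> ainj bF; apply: expect_to_tuple => //; first exact: measurable_select.
move=> A mA.
have -> : select a @^-1` box A =
    box (fun j => if [pick i | a i == j] is Some i then A i else setT).
  apply/seteqP; split=> t /= tA.
    move=> j; case: pickP => // i /eqP <-.
    by have := tA i; rewrite tnth_mktuple.
  move=> i; rewrite tnth_mktuple; have := tA (a i); case: pickP => [i' /eqP/ainj ->//|].
  by move=> /(_ i); rewrite eqxx.
rewrite prod_prob_box ?prod_select_sets // => j.
by case: pickP.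
Qed.

Definition cat_pair k l (z : k.-tuple T * l.-tuple T) : (k + l).-tuple T :=
  [tuple match fintype.split i with inl j => tnth z.1 j | inr j => tnth z.2 j end | i < k + l].

Lemma measurable_cat_pair k l : measurable_fun setT (@cat_pair k l).
Proof.
apply/measurable_fun_tnthP => i; rewrite /comp.
under eq_fun do rewrite tnth_mktuple.
case: (fintype.split i) => j.
  exact: (measurableT_comp (@measurable_tnth _ T k j) measurable_fst).
exact: (measurableT_comp (@measurable_tnth _ T l j) measurable_snd).
Qed.

Lemma expect_cat k l (F : (k + l).-tuple T -> R) : bounded_measurable F ->
  \int[power (k + l)]_t F t = \int[(power k \x power l)%E]_z F (cat_pair z).
Proof.
move=> bF; symmetry; apply: (@expect_to_tuple _ _ _ T R (power k \x power l)%E) => //.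
  exact: measurable_cat_pair.
move=> A mA.
have -> : @cat_pair k l @^-1` box A =
    box (fun i => A (lshift l i)) `*` box (fun i => A (rshift k i)).
  apply/seteqP; split=> [z zA|z [/= zA1 zA2] i]; last first.
    rewrite tnth_mktuple; case: (fintype.splitP i) => j ij.
      by rewrite (_ : i = lshift l j); [exact: zA1|exact: val_inj].
    by rewrite (_ : i = rshift k j); [exact: zA2|exact: val_inj].
  split=> /= i.
    by have := zA (lshift l i); rewrite tnth_mktuple -[lshift l i]/(unsplit (inl i)) unsplitK.
  by have := zA (rshift k i); rewrite tnth_mktuple -[rshift k i]/(unsplit (inr i)) unsplitK.
apply: (etrans (product_measure1E (power k) (power l) _ _)); [exact: measurable_box..|].
rewrite big_split_ord /=; congr (_ * _)%E; exact: (prod_prob_box _ (fun i => mA _)).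
Qed.

Lemma expect_tnth n (i : 'I_n) (F : T -> R) : bounded_measurable F ->
  \int[power n]_t F (tnth t i) = \int[mu]_x F x.
Proof.
move=> bF; apply: (@expect_pushforward _ _ _ _ _ (power n) mu (fun t => tnth t i)) => //.
  exact: measurable_tnth.
move=> A mA.
have -> : (fun t : n.-tuple T => tnth t i) @^-1` A = box (fun j => if j == i then A else setT).
  apply/seteqP; split=> [t /= tA j|t /(_ i)]; last by rewrite eqxx.
  by case: eqP => [->|].
rewrite prod_prob_box => [|j]; last by case: ifP.
rewrite (bigD1 i) //= eqxx [X in (_ * X)%E]big1 ?mule1 // => j /negPf ->.
exact: probability_setT.
Qed.

Lemma expect_tnth2 n (i j : 'I_n) (F : T * T -> R) : i != j -> bounded_measurable F ->
  \int[power n]_t F (tnth t i, tnth t j) = \int[(mu \x mu)%E]_z F z.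
Proof.
move=> ij bF; pose g (t : n.-tuple T) := (tnth t i, tnth t j).
have mg : measurable_fun setT g.
  by apply: measurable_fun_pair; exact: measurable_tnth.
apply: (@expect_pushforward _ _ _ _ _ (power n) (mu \x mu)%E g) => // X mX.
pose gm : {mfun n.-tuple T >-> (T * T)%type} := HB.pack g (isMeasurableFun.Build _ _ _ _ g mg).
rewrite -[LHS]/(distribution (power n) gm X); symmetry.
apply: product_measure_unique => // A B mA mB.
rewrite /= /distribution /pushforward /=.
have -> : g @^-1` (A `*` B) =
    box (fun h => if h == i then A else if h == j then B else setT).
  apply/seteqP; split=> [t [/= tA tB] h|t tAB].
    by case: eqP => [->//|_]; case: eqP => [->|].
  split=> /=; first by have := tAB i; rewrite eqxx.
  by have := tAB j; rewrite eq_sym (negPf ij) eqxx.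
rewrite prod_prob_box => [|h]; last by case: ifP => // _; case: ifP.
have ji : j != i by rewrite eq_sym.
rewrite (bigD1 i) //= (bigD1 j) //= eqxx eq_sym (negPf ij) eqxx.
rewrite [X in (_ * (_ * X))%E]big1 ?mule1 // => h /andP[/negPf -> /negPf ->].
exact: probability_setT.
Qed.

End sampling.

(** * First and second moments of sample means *)

Lemma ffact_ratio_ge (F : realFieldType) p k : (0 < p)%N ->
  1 - (k ^ 2)%:R / p%:R <= (p ^_ k)%:R / p%:R ^+ k :> F.
Proof.
move=> p0; have pR : (0 : F) < p%:R by rewrite ltr0n.
(* The bound by 1 is carried through the induction: it is what bounds [x * (k / p)] by [k / p]. *)
suff [] : (p ^_ k)%:R / p%:R ^+ k <= 1 :> F /\
    1 - (k ^ 2)%:R / p%:R <= (p ^_ k)%:R / p%:R ^+ k :> F by [].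
elim: k => [|k [IH1 IH2]]; first by rewrite ffactn0 expr0 mul0r subr0 divr1.
set x := (p ^_ k)%:R / p%:R ^+ k in IH1 IH2.
have x0 : 0 <= x by rewrite divr_ge0 ?exprn_ge0.
have -> : (p ^_ k.+1)%:R / p%:R ^+ k.+1 = x * ((p - k)%:R / p%:R) :> F.
  by rewrite ffactnSr natrM exprSr /x; field; rewrite expf_neq0 gt_eqF.
have le1 : (p - k)%:R / p%:R <= 1 :> F.
  by rewrite ler_pdivrMr // mul1r ler_nat leq_subr.
have ge : 1 - k%:R / p%:R <= (p - k)%:R / p%:R :> F.
  rewrite ler_pdivlMr // mulrBl mul1r divfK ?gt_eqF // lerBlDr -natrD ler_nat.
  by lia.
split; first by apply: mulr_ile1 => //; rewrite divr_ge0.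
have := ler_wpM2l x0 ge; rewrite mulrBr mulr1.
have kp : 0 <= k%:R / p%:R :> F by rewrite divr_ge0.
have := ler_wpM2r kp IH1; rewrite mul1r.
have -> : (k.+1 ^ 2)%:R / p%:R = (k ^ 2)%:R / p%:R + k%:R / p%:R + k.+1%:R / p%:R :> F.
  by rewrite -!mulrDl -!natrD; congr (_%:R / _); lia.
have kS : 0 <= k.+1%:R / p%:R :> F by rewrite divr_ge0.
by lra.
Qed.

Lemma sum_noninjective (F : realFieldType) p k : (0 < p)%N ->
  \sum_(a : {ffun 'I_k -> 'I_p}) (~~ injectiveb a)%:R <=
  (k ^ 2)%:R / p%:R * p%:R ^+ k :> F.
Proof.
move=> p0; have pR : (0 : F) < p%:R by rewrite ltr0n.
have pk : (0 : F) < p%:R ^+ k by rewrite exprn_gt0.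
have -> : \sum_(a : {ffun 'I_k -> 'I_p}) (~~ injectiveb a)%:R =
    p%:R ^+ k - (p ^_ k)%:R :> F.
  apply/eqP; rewrite eq_sym subr_eq; apply/eqP.
  have -> : (p ^_ k)%:R = \sum_(a : {ffun 'I_k -> 'I_p}) (injectiveb a)%:R :> F.
    rewrite -[in LHS](card_ord p) -[in LHS](card_ord k) -card_inj_ffuns -sum1dep_card.
    by rewrite natr_sum big_mkcond; apply: eq_bigr => a _; case: (injectiveb _).
  rewrite -big_split /= (eq_bigr (fun=> 1)) => [|a _].
    by rewrite sumr_const card_ffun !card_ord natrX.
  by case: (injectiveb a); rewrite ?addr0 ?add0r.
have := @ffact_ratio_ge F p k p0; rewrite -(ler_pM2r pk) mulrBl mul1r divfK ?gt_eqF //.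
lra.
Qed.

Lemma sum_ffun_split (F : nmodType) (I : finType) k l
    (G : {ffun 'I_k -> I} -> {ffun 'I_l -> I} -> F) :
  \sum_(c : {ffun 'I_(k + l) -> I})
    G [ffun i => c (lshift l i)] [ffun j => c (rshift k j)] =
  \sum_a \sum_b G a b.
Proof.
rewrite pair_big /=.
pose h (z : {ffun 'I_k -> I} * {ffun 'I_l -> I}) : {ffun 'I_(k + l) -> I} :=
  [ffun i => match fintype.split i with inl j => z.1 j | inr j => z.2 j end].
have hl z i : h z (lshift l i) = z.1 i.
  by rewrite ffunE -[lshift l i]/(unsplit (inl i)) unsplitK.
have hr z j : h z (rshift k j) = z.2 j.
  by rewrite ffunE -[rshift k j]/(unsplit (inr j)) unsplitK.
rewrite (reindex h) /=.
  apply: eq_bigr => -[a b] _; congr G; apply/ffunP => i; rewrite ffunE ?hl ?hr //.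
exists (fun c : {ffun 'I_(k + l) -> I} =>
    ([ffun i => c (lshift l i)], [ffun j => c (rshift k j)])) => [[a b] _|c _].
  by congr pair; apply/ffunP => i; rewrite ffunE ?hl ?hr.
by apply/ffunP => i; rewrite ffunE; case: (fintype.splitP i) => j ij /=;
  rewrite ffunE; congr (c _); exact: val_inj.
Qed.

Section ustatistics.
Context d (T : measurableType d) (R : realType) (mu : probability T R).

Notation power n := (prod_prob (fun _ : 'I_n => mu)).
Notation power2 k l := (power k \x power l)%E.

(** Non-injective maps [a] and [b] are included (strictly speaking, a V-statistic): the square of
    such a mean is then again one, for the kernel [tensor h], at the price of a bias of order
    [1 / p]. *)
Definition ustat p k l (H : k.-tuple T * l.-tuple T -> R)
    (z : p.-tuple T * p.-tuple T) : R :=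
  (p%:R ^+ (k + l))^-1 * \sum_(a : {ffun 'I_k -> 'I_p}) \sum_(b : {ffun 'I_l -> 'I_p})
    H (select a z.1, select b z.2).

Lemma measurable_select2 p p' k l (a : 'I_k -> 'I_p) (b : 'I_l -> 'I_p') :
  measurable_fun setT (fun z : p.-tuple T * p'.-tuple T => (select a z.1, select b z.2)).
Proof.
apply: measurable_fun_pair.
  exact: (measurableT_comp (measurable_select a) measurable_fst).
exact: (measurableT_comp (measurable_select b) measurable_snd).
Qed.

Lemma bounded_measurable_ustat p k l (H : k.-tuple T * l.-tuple T -> R) :
  bounded_measurable H -> bounded_measurable (ustat (p := p) H).
Proof.
move=> bH; apply: bounded_measurableM; first exact: bounded_measurable_cst.
apply: bounded_measurable_sum => a; apply: bounded_measurable_sum => b.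
exact: bounded_measurable_comp bH (measurable_select2 a b).
Qed.

Lemma expect_select2 p k l (a : 'I_k -> 'I_p) (b : 'I_l -> 'I_p)
    (H : k.-tuple T * l.-tuple T -> R) :
  injective a -> injective b -> bounded_measurable H ->
  \int[power2 p p]_z H (select a z.1, select b z.2) = \int[power2 k l]_z H z.
Proof.
move=> ainj binj bH.
rewrite (expect_prod12 (power p) (power p) (bounded_measurable_comp bH (measurable_select2 a b))) /=.
rewrite (expect_prod12 (power k) (power l) bH).
rewrite -(expect_select mu ainj (bounded_measurable_expect2 (power k) (power l) bH)).
apply: eq_Rintegral => x _.
exact: (expect_select mu binj (bounded_measurable_section1 bH (select a x))).
Qed.

(** Terms with [a] and [b] injective have exactly the right expectation; any other is off by at most
    [2%:R * M], and these are a proportion of at most [(k ^ 2 + l ^ 2) / p] of all terms. *)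
Lemma expect_ustat p k l (H : k.-tuple T * l.-tuple T -> R) M : (0 < p)%N ->
  bounded_measurable H -> (forall z, `|H z| <= M) ->
  `|\int[power2 p p]_z ustat H z - \int[power2 k l]_z H z| <=
    2%:R * M * (k ^ 2 + l ^ 2)%:R / p%:R.
Proof.
move=> p0 bH HM; have pR : (0 : R) < p%:R by rewrite ltr0n.
have pkl : (0 : R) < p%:R ^+ (k + l) by rewrite exprn_gt0.
(* The bound by [M] says something only if there is a point; on an empty space the constant 1 would
   have integral 0. *)
have M0 : 0 <= M.
  have [|/forallNP noz] := pselect (exists z : k.-tuple T * l.-tuple T, True).
    by move=> [z _]; exact: le_trans (normr_ge0 _) (HM z).
  have : \int[power2 k l]_z 1 = 0 :> R.
    rewrite -[RHS](@expect_cst _ _ _ (power2 k l) 0).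
    by apply: eq_Rintegral => z; case: (noz z Logic.I).
  by rewrite (@expect_cst _ _ _ (power2 k l) 1) => /eqP; rewrite oner_eq0.
have bt a b : bounded_measurable (fun z : p.-tuple T * p.-tuple T => H (select a z.1, select b z.2)).
  exact: bounded_measurable_comp bH (measurable_select2 a b).
rewrite (@expectZ _ _ _ (power2 p p)); last first.
  by do 2 (apply: bounded_measurable_sum => ?); exact: bt.
rewrite (@expect_sum _ _ _ (power2 p p)); last first.
  by move=> a; apply: bounded_measurable_sum => b; exact: bt.
set E := \int[power2 k l]_z H z.
have -> : E = (p%:R ^+ (k + l))^-1 *
    \sum_(a : {ffun 'I_k -> 'I_p}) \sum_(b : {ffun 'I_l -> 'I_p}) E.
  rewrite !sumr_const !card_ffun !card_ord -mulrnA -expnD [(l + k)%N]addnC -(mulr_natl E) natrX.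
  by rewrite mulrA mulVf ?mul1r // gt_eqF.
have pkli : (0 : R) <= (p%:R ^+ (k + l))^-1 by rewrite invr_ge0 ltW.
rewrite -mulrBr normrM (ger0_norm pkli) mulrC ler_pdivrMr // -sumrB.
apply: le_trans (ler_norm_sum _ _ _) _.
apply: (@le_trans _ _ (\sum_(a : {ffun 'I_k -> 'I_p}) \sum_(b : {ffun 'I_l -> 'I_p})
   2%:R * M * ((~~ injectiveb a)%:R + (~~ injectiveb b)%:R))).
  apply: ler_sum => a _; rewrite (@expect_sum _ _ _ (power2 p p)); last by move=> b; exact: bt.
  rewrite -sumrB; apply: le_trans (ler_norm_sum _ _ _) _; apply: ler_sum => b _.
  have bound : `|\int[power2 p p]_z H (select a z.1, select b z.2) - E| <= 2%:R * M.
    apply: le_trans (ler_normB _ _) _.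
    have -> : 2%:R * M = M + M by ring.
    apply: lerD; apply: norm_expect => //; exact: bt.
  have [ainj|ainj] := boolP (injectiveb a); last first.
    apply: le_trans bound _; rewrite -[leLHS]mulr1 ler_wpM2l ?mulr_ge0 //.
    by rewrite lerDl.
  have [binj|binj] := boolP (injectiveb b); last first.
    by apply: le_trans bound _; rewrite add0r mulr1.
  rewrite expect_select2 //; [|exact/injectiveP..].
  by rewrite subrr normr0 addr0 mulr0.
under eq_bigr do rewrite -mulr_sumr big_split /= sumr_const card_ffun !card_ord.
rewrite -mulr_sumr big_split /= sumr_const card_ffun !card_ord sumrMnl.
have := @sum_noninjective R p k p0; have := @sum_noninjective R p l p0.
set x := \sum_(b : {ffun 'I_l -> 'I_p}) _; set y := \sum_(a : {ffun 'I_k -> 'I_p}) _.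
move=> xle yle.
rewrite -[X in _ * (X + _)]mulr_natr -[X in _ * (_ + X)]mulr_natr !natrX natrD -!mulrA.
rewrite !ler_wpM2l // exprD.
have pk : (0 : R) <= p%:R ^+ k by rewrite exprn_ge0.
have pl : (0 : R) <= p%:R ^+ l by rewrite exprn_ge0.
have := ler_wpM2r pl yle; have := ler_wpM2r pk xle.
set u := p%:R ^+ k; set v := p%:R ^+ l.
have -> : ((k ^ 2)%:R + (l ^ 2)%:R) * (p%:R^-1 * (u * v)) =
  (k ^ 2)%:R / p%:R * u * v + (l ^ 2)%:R / p%:R * v * u :> R by ring.
lra.
Qed.

(** Two copies of [h] on disjoint halves of the coordinates, hence independent. *)
Definition tensor k l (h : k.-tuple T * l.-tuple T -> R)
    (z : (k + k).-tuple T * (l + l).-tuple T) : R :=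
  h (select (lshift k) z.1, select (lshift l) z.2) *
  h (select (@rshift k k) z.1, select (@rshift l l) z.2).

Lemma ustat_sqr p k l (h : k.-tuple T * l.-tuple T -> R) (z : p.-tuple T * p.-tuple T) :
  ustat h z ^+ 2 = ustat (tensor h) z.
Proof.
rewrite /ustat exprMn -exprVn -exprM; congr (_ * _).
  by rewrite exprVn; congr (_^-1); congr (_ ^+ _); lia.
have sel n m (c : {ffun 'I_m -> 'I_p}) (g : 'I_n -> 'I_m) (t : p.-tuple T) :
    select g (select c t) = select [ffun i => c (g i)] t.
  by apply: eq_from_tnth => i; rewrite !tnth_mktuple ffunE.
transitivity (\sum_(c : {ffun 'I_(k + k) -> 'I_p}) \sum_(e : {ffun 'I_(l + l) -> 'I_p})
   h (select [ffun i => c (lshift k i)] z.1, select [ffun i => e (lshift l i)] z.2) *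
   h (select [ffun i => c (rshift k i)] z.1, select [ffun i => e (rshift l i)] z.2)); last first.
  by do 2 (apply: eq_bigr => ? _); rewrite /tensor !sel.
rewrite (sum_ffun_split (fun a a' => \sum_(e : {ffun 'I_(l + l) -> 'I_p})
   h (select a z.1, select [ffun i => e (lshift l i)] z.2) *
   h (select a' z.1, select [ffun i => e (rshift l i)] z.2))).
rewrite expr2 mulr_suml; apply: eq_bigr => a _; rewrite mulr_sumr; apply: eq_bigr => a' _.
rewrite (sum_ffun_split (fun b b' => h (select a z.1, select b z.2) * h (select a' z.1, select b' z.2))).
by rewrite mulr_suml; apply: eq_bigr => b _; rewrite mulr_sumr.
Qed.

Lemma expect_split k l (g1 : k.-tuple T -> R) (g2 : l.-tuple T -> R) :
  bounded_measurable g1 -> bounded_measurable g2 ->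
  \int[power (k + l)]_t (g1 (select (lshift l) t) * g2 (select (@rshift k l) t)) =
  (\int[power k]_t g1 t) * \int[power l]_t g2 t.
Proof.
move=> b1 b2; rewrite (@expect_cat _ _ _ mu k l (fun t => g1 (select (lshift l) t) * g2 (select (@rshift k l) t))); last first.
  by apply: bounded_measurableM; apply: bounded_measurable_comp => //; exact: measurable_select.
have sl (z : k.-tuple T * l.-tuple T) : select (lshift l) (cat_pair z) = z.1.
  apply: eq_from_tnth => i; rewrite !tnth_mktuple.
  by rewrite -[lshift l i]/(unsplit (inl i)) unsplitK.
have sr (z : k.-tuple T * l.-tuple T) : select (@rshift k l) (cat_pair z) = z.2.
  apply: eq_from_tnth => i; rewrite !tnth_mktuple.
  by rewrite -[rshift k i]/(unsplit (inr i)) unsplitK.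
under eq_Rintegral do rewrite sl sr.
rewrite (@expect_prod12 _ _ _ _ R (power k) (power l) (fun z => g1 z.1 * g2 z.2)); last first.
  apply: bounded_measurableM.
    exact: bounded_measurable_comp b1 measurable_fst.
  exact: bounded_measurable_comp b2 measurable_snd.
transitivity (\int[power k]_x ((\int[power l]_y g2 y) * g1 x)).
  by apply: eq_Rintegral => x _ /=; rewrite expectZ // mulrC.
by rewrite expectZ // mulrC.
Qed.

Lemma bounded_measurable_tensor k l (h : k.-tuple T * l.-tuple T -> R) :
  bounded_measurable h -> bounded_measurable (tensor h).
Proof.
by move=> bh; apply: bounded_measurableM;
  exact: bounded_measurable_comp bh (measurable_select2 _ _).
Qed.

Lemma expect_tensor k l (h : k.-tuple T * l.-tuple T -> R) : bounded_measurable h ->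
  \int[power2 (k + k) (l + l)]_z tensor h z = (\int[power2 k l]_z h z) ^+ 2.
Proof.
move=> bh.
rewrite (expect_prod12 (power (k + k)) (power (l + l)) (bounded_measurable_tensor bh)).
under eq_Rintegral => x _.
  rewrite /tensor /=.
  rewrite (@expect_split l l (fun y => h (select (lshift k) x, y)) (fun y => h (select (@rshift k k) x, y)));
    [|exact: bounded_measurable_section1..].
  over.
rewrite (@expect_split k k (fun x => \int[power l]_y h (x, y)) (fun x => \int[power l]_y h (x, y)));
  [|exact: (bounded_measurable_expect2 (power k) (power l))..].
by rewrite -expect_prod12 // expr2.
Qed.

(** Write [U] for the sample mean and [x] for [(k ^ 2 + l ^ 2) / p], and expand the square. [E U^2],
    the expectation of the mean for [tensor h], exceeds [t^2] by at most [8x]; [E U] is at least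
    [t - 2x], so [-2 t E U] exceeds [-2 t^2] by at most [4x], as [t <= 1]. Hence [12 = 8 + 4]. *)
Lemma variance_ustat p k l (h : k.-tuple T * l.-tuple T -> R) : (0 < p)%N ->
  bounded_measurable h -> (forall z, 0 <= h z <= 1) ->
  \int[power2 p p]_z ((ustat h z - \int[power2 k l]_w h w) ^+ 2) <=
    12%:R * (k ^ 2 + l ^ 2)%:R / p%:R.
Proof.
move=> p0 bh h01; set t := \int[power2 k l]_w h w.
have pR : (0 : R) < p%:R by rewrite ltr0n.
have h1 z : `|h z| <= 1 by rewrite ger0_norm; have /andP[] := h01 z.
have t01 : 0 <= t <= 1.
  have := norm_expect (power2 k l) bh h1; rewrite -/t => tle.
  have t0 : 0 <= t by apply: Rintegral_ge0 => z _; have /andP[] := h01 z.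
  by rewrite t0 /=; rewrite ger0_norm in tle.
have hh1 z : `|tensor h z| <= 1.
  by rewrite /tensor normrM mulr_ile1.
have bu := @bounded_measurable_ustat p k l h bh.
have bt := bounded_measurable_tensor bh.
have but := @bounded_measurable_ustat p _ _ _ bt.
have -> : \int[power2 p p]_z ((ustat h z - t) ^+ 2) =
    \int[power2 p p]_z ustat (tensor h) z - 2%:R * t * \int[power2 p p]_z ustat h z + t ^+ 2.
  have b2 : bounded_measurable (fun z => 2%:R * t * ustat (p := p) h z).
    by apply: bounded_measurableM => //; exact: bounded_measurable_cst.
  rewrite -(expectZ (power2 p p) (2%:R * t) bu) -(expectB (power2 p p) but b2).
  rewrite -[X in _ + X](expect_cst (power2 p p)) -(expectD (power2 p p)) //; last 2 first.
  - exact: bounded_measurableB.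
  - exact: bounded_measurable_cst.
  by apply: eq_Rintegral => z _; rewrite -ustat_sqr; ring.
have := expect_ustat p0 bt hh1; have := expect_ustat p0 bh h1.
rewrite expect_tensor // -/t !ler_norml => /andP[e1 _] /andP[_ e2].
set U := \int[_]_z ustat h z in e1 *; set V := \int[_]_z _ in e2 *.
have [t0 t1] := andP t01.
pose x : R := (k ^ 2 + l ^ 2)%:R / p%:R.
have x0 : 0 <= x by rewrite divr_ge0.
have e2x : 2%:R * 1 * ((k + k) ^ 2 + (l + l) ^ 2)%:R / p%:R = 8%:R * x :> R.
  rewrite /x mulr1 -!mulrA mulrA [RHS]mulrA -!natrM; congr (_%:R / _); lia.
have e1x : 2%:R * 1 * (k ^ 2 + l ^ 2)%:R / p%:R = 2%:R * x :> R by rewrite /x mulr1 mulrA.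
rewrite e2x in e2; rewrite e1x in e1.
have -> : 12%:R * (k ^ 2 + l ^ 2)%:R / p%:R = 12%:R * x by rewrite /x mulrA.
have := ler_wpM2l t0 e1; have := ler_wpM2r x0 t1; lra.
Qed.

End ustatistics.

(** * The classes of a Latinon *)

Section class_sets.
Variables (R : realType) (q : nat).

(* ](e/q), (e+1)/q], with the first class extended to -oo and the last one to
   +oo: the classes partition the whole line. *)
Definition class_set (e : 'I_q) : set R :=
  [set r | ((0 < e)%N -> e%:R / q%:R < r) /\ ((e.+1 < q)%N -> r <= e.+1%:R / q%:R)].

Lemma measurable_class_set e : measurable (class_set e).
Proof.
have -> : class_set e = (if (0 < e)%N then `](e%:R / q%:R), +oo[%classic else setT) `&`
    (if (e.+1 < q)%N then `]-oo, (e.+1%:R / q%:R)]%classic else setT).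
  apply/seteqP; split=> r [].
    by move=> r1 r2; split; case: ifP => [h|//]; rewrite /= in_itv /= ?andbT; [exact: r1|exact: r2].
  move=> r1 r2; split=> h; [move: r1|move: r2]; by rewrite h /= in_itv /= ?andbT.
by apply: measurableI; case: ifP.
Qed.

Lemma class_set_le e e' r r' : class_set e r -> class_set e' r' -> r <= r' -> (e <= e')%N.
Proof.
move=> [re _] [_ re'] rr'; rewrite leqNgt; apply/negP => lt.
have q0 : (0 < q)%N := leq_ltn_trans (leq0n e) (ltn_ord e).
have qR : (0 : R) < q%:R by rewrite ltr0n.
have := re (leq_ltn_trans (leq0n _) lt); have := re' (leq_ltn_trans lt (ltn_ord e)).
have : e'.+1%:R / q%:R <= e%:R / q%:R :> R by rewrite ler_pM2r ?invr_gt0 // ler_nat.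
lra.
Qed.

Lemma class_set_inj e e' r : class_set e r -> class_set e' r -> e = e'.
Proof.
move=> re re'; apply/val_inj/eqP; rewrite eqn_leq.
by rewrite (class_set_le re re') // (class_set_le re' re).
Qed.

Hypothesis q0 : (0 < q)%N.

Lemma class_set_cover r : exists e, class_set e r.
Proof.
have pq : (q.-1 < q)%N by rewrite prednK.
pose Q (e : 'I_q) := (e.+1 == q) || (r <= e.+1%:R / q%:R).
have Qlast : Q (Ordinal pq) by rewrite /Q /= prednK // eqxx.
case: (arg_minnP (fun e : 'I_q => nat_of_ord e) Qlast) => e Qe emin.
exists e; split=> [e0|eq]; last first.
  by move: Qe; rewrite /Q; case: eqP => [eE|] //=; rewrite eE ltnn in eq.
rewrite ltNge; apply/negP => rle.
have lt : (e.-1 < q)%N by apply: leq_ltn_trans (leq_pred _) (ltn_ord e).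
have := emin (Ordinal lt); rewrite /Q /= prednK // rle orbT => /(_ isT).
by rewrite leqNgt ltn_predL e0.
Qed.

Lemma lambda01_class_set e : lambda01 (class_set e) = (q%:R^-1)%:E.
Proof.
have qR : (0 : R) < q%:R by rewrite ltr0n.
have e1 : e.+1%:R / q%:R <= 1 :> R by rewrite ler_pdivrMr // mul1r ler_nat.
have diff : e.+1%:R / q%:R - e%:R / q%:R = q%:R^-1 :> R.
  by rewrite -mulrBl -natrB // subSnn mul1r.
have qV : 0 < q%:R^-1 :> R by rewrite invr_gt0.
have le_last (r : R) : (e.+1 < q)%N = false -> r <= 1 -> r <= e.+1%:R / q%:R.
  move=> /negbT; rewrite -leqNgt => qe r1; apply: le_trans r1 _.
  by rewrite ler_pdivlMr // mul1r ler_nat.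
rewrite /lambda01; case: (posnP e) => [e0|e0].
  have -> : class_set e `&` `[0, 1] = `[0%R, (e.+1%:R / q%:R)]%classic.
    apply/seteqP; split=> r /=; rewrite !in_itv /=.
      move=> [[_ re] /andP[r0 r1]]; rewrite r0 /=.
      by case: (boolP (e.+1 < q)%N) => [/re//|/negPf h]; exact: le_last.
    move=> /andP[r0 re]; split; last by rewrite r0 (le_trans re).
    by split=> [|_] //; rewrite e0.
  rewrite lebesgue_measure_itv /= lte_fin.
  move: diff; rewrite e0 mul0r subr0 => ->.
  by rewrite qV -EFinB subr0.
have -> : class_set e `&` `[0, 1] = `](e%:R / q%:R), (e.+1%:R / q%:R)]%classic.
  apply/seteqP; split=> r /=; rewrite !in_itv /=.
    move=> [[re re'] /andP[r0 r1]]; rewrite re //=.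
    by case: (boolP (e.+1 < q)%N) => [/re'//|/negPf h]; exact: le_last.
  move=> /andP[re re']; split; first by split.
  rewrite (le_trans re') // andbT; apply: ltW; apply: le_lt_trans re.
  by rewrite divr_ge0.
rewrite lebesgue_measure_itv /= lte_fin -subr_gt0 diff qV -EFinB diff.
by [].
Qed.

Lemma class_set_sum (P : probability R R) : \sum_e fine (P (class_set e)) = 1.
Proof.
apply: EFin_inj; rewrite -sumEFin.
transitivity (\sum_(e < q) P (class_set e))%E.
  by apply: eq_bigr => e _; rewrite fineK // fin_num_measure //; exact: measurable_class_set.
rewrite -measure_bigsetU_ord; first last.
- move=> e e' _ _ [r [re re']]; exact: class_set_inj re re'.
- by move=> e; exact: measurable_class_set.
rewrite (_ : \big[setU/set0]_(e < q) _ = setT); first exact: probability_setT.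
apply/seteqP; split=> // r _; have [e re] := class_set_cover r.
by rewrite -bigcup_seq; exists e => //=; rewrite mem_index_enum.
Qed.

End class_sets.

Section latinon_classes.
Context (R : realType) d (Omega : measurableType d) (mu : probability Omega R).
Variables (W : Omega * Omega -> pprobability R R) (f : Omega -> R).
Hypothesis HWf : latinon mu W f.
Variable q : nat.
Hypothesis q0 : (0 < q)%N.

Definition class_prob (e : 'I_q) (z : Omega * Omega) : R := fine (W z (@class_set R q e)).

Lemma class_prob_fin e z : (W z (@class_set R q e) = (class_prob e z)%:E)%E.
Proof.
by rewrite /class_prob fineK // fin_num_measure //; exact: measurable_class_set.
Qed.

Lemma class_prob01 e z : 0 <= class_prob e z <= 1.
Proof.
rewrite -!lee_fin -class_prob_fin measure_ge0 /=.
by apply: probability_le1; exact: measurable_class_set.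
Qed.

Lemma class_prob_sum z : \sum_e class_prob e z = 1.
Proof. exact: class_set_sum. Qed.

Lemma bounded_measurable_class_prob e : bounded_measurable (class_prob e).
Proof.
split.
  apply/measurable_EFinP; rewrite (_ : _ \o _ = fun z => W z (@class_set R q e)); last first.
    by apply/funext => z; rewrite class_prob_fin.
  exact: (measurable_kernel (kprobability (latinon_measurable HWf)) _ (measurable_class_set _)).
exists 1 => z; have /andP[c0 c1] := class_prob01 e z.
by rewrite ger0_norm.
Qed.

(** Averaging over a whole row evaluates the value marginal of the row permuton on a class, which
    meets the unit interval in length [1 / q]. *)
Lemma class_prob_row e : {ae mu, forall x, \int[mu]_y class_prob e (x, y) = q%:R^-1}.
Proof.
apply: filterS (latinon_row HWf) => x [pi pip piE].
have := piE setT (@class_set R q e) measurableT (measurable_class_set e).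
rewrite (pip (@class_set R q e) (measurable_class_set e)).2 lambda01_class_set // preimage_setT => qE.
rewrite /Rintegral -[RHS]/(fine (q%:R^-1)%:E) qE; congr fine; apply: eq_integral => y _; by rewrite class_prob_fin.
Qed.

Lemma class_prob_col e : {ae mu, forall y, \int[mu]_x class_prob e (x, y) = q%:R^-1}.
Proof.
apply: filterS (latinon_col HWf) => y [pi pip piE].
have := piE setT (@class_set R q e) measurableT (measurable_class_set e).
rewrite (pip (@class_set R q e) (measurable_class_set e)).2 lambda01_class_set // preimage_setT => qE.
rewrite /Rintegral -[RHS]/(fine (q%:R^-1)%:E) qE; congr fine; apply: eq_integral => x _; by rewrite class_prob_fin.
Qed.

Lemma measurable_ordered_tuples k : measurable (@ordered_tuples R d Omega f k).
Proof.
have -> : @ordered_tuples R d Omega f k = \bigcap_(z in [set z : 'I_k * 'I_k | (z.1 < z.2)%N])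
    ((fun t : k.-tuple Omega => f (tnth t z.1) < f (tnth t z.2)) @^-1` [set true]).
  apply/seteqP; split=> [t tA [i j] /= ij|t tA i j ij]; first exact: tA.
  exact: (tA (i, j) ij).
apply: fin_bigcap_measurable => // z _.
rewrite -[X in measurable X]setTI; apply: measurable_fun_ltr => //;
  exact: (measurableT_comp (latinon_fun_measurable HWf) (measurable_tnth _)).
Qed.

Definition class_density k l (c : 'M['I_q]_(k, l)) (z : k.-tuple Omega * l.-tuple Omega) : R :=
  (z.1 \in @ordered_tuples R d Omega f k)%:R * (z.2 \in @ordered_tuples R d Omega f l)%:R *
  \prod_i \prod_j class_prob (c i j) (tnth z.1 i, tnth z.2 j).

Lemma measurable_tnth_pair k l (i : 'I_k) (j : 'I_l) :
  measurable_fun setT (fun z : k.-tuple Omega * l.-tuple Omega => (tnth z.1 i, tnth z.2 j)).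
Proof.
apply: measurable_fun_pair.
  exact: (measurableT_comp (measurable_tnth _) measurable_fst).
exact: (measurableT_comp (measurable_tnth _) measurable_snd).
Qed.

Lemma bounded_measurable_class_density k l (c : 'M['I_q]_(k, l)) :
  bounded_measurable (class_density c).
Proof.
apply: bounded_measurableM.
  apply: bounded_measurableM.
    exact: bounded_measurable_comp (bounded_measurable_indic R (@measurable_ordered_tuples k)) measurable_fst.
  exact: bounded_measurable_comp (bounded_measurable_indic R (@measurable_ordered_tuples l)) measurable_snd.
apply: bounded_measurable_prod => i; apply: bounded_measurable_prod => j.
exact: bounded_measurable_comp (bounded_measurable_class_prob _) (measurable_tnth_pair _ _).
Qed.

Lemma class_density01 k l (c : 'M['I_q]_(k, l)) z : 0 <= class_density c z <= 1.
Proof.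
have p01 : 0 <= \prod_i \prod_j class_prob (c i j) (tnth z.1 i, tnth z.2 j) <= 1.
  have in01 i : 0 <= \prod_j class_prob (c i j) (tnth z.1 i, tnth z.2 j) <= 1.
    apply/andP; split.
      by apply: prodr_ge0 => j _; have /andP[] := class_prob01 (c i j) (tnth z.1 i, tnth z.2 j).
    by apply: Num.Theory.prodr_ile1 => j _; exact: class_prob01.
  apply/andP; split; last by apply: Num.Theory.prodr_ile1 => i _; exact: in01.
  by apply: prodr_ge0 => i _; have /andP[] := in01 i.
rewrite /class_density; case: (_ \in _); case: (_ \in _); rewrite ?mul0r ?mulr0 ?mul0r ?mul1r ?lexx ?ler01 //.
Qed.

Notation power n := (prod_prob (fun _ : 'I_n => mu)).
Notation power2 k l := (power k \x power l)%E.

(** A kernel on one row and two columns whose sample mean is the mean squared deviation from [1 / q]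
    of the row averages of class [e]. A second moment is thus treated as a first moment. *)
Definition row_defect e (z : 1.-tuple Omega * 2.-tuple Omega) : R :=
  (class_prob e (tnth z.1 ord0, tnth z.2 ord0) - q%:R^-1) *
  (class_prob e (tnth z.1 ord0, tnth z.2 ord_max) - q%:R^-1).

Definition col_defect e (z : 2.-tuple Omega * 1.-tuple Omega) : R :=
  (class_prob e (tnth z.1 ord0, tnth z.2 ord0) - q%:R^-1) *
  (class_prob e (tnth z.1 ord_max, tnth z.2 ord0) - q%:R^-1).

Let centered e z := class_prob e z - q%:R^-1.

Let bounded_centered e : bounded_measurable (centered e).
Proof.
by apply: bounded_measurableB; [exact: bounded_measurable_class_prob|exact: bounded_measurable_cst].
Qed.

Lemma centered_le1 e z : `|class_prob e z - q%:R^-1| <= 1.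
Proof.
have /andP[c0 c1] := class_prob01 e z.
have qV : 0 < q%:R^-1 :> R by rewrite invr_gt0 ltr0n.
have q1 : q%:R^-1 <= 1 :> R by rewrite invf_le1 ?ltr0n // ler1n.
by rewrite ler_norml; apply/andP; split; lra.
Qed.

Lemma bounded_measurable_row_defect e : bounded_measurable (row_defect e).
Proof.
apply: bounded_measurableM;
  exact: (bounded_measurable_comp (bounded_centered e) (measurable_tnth_pair _ _)).
Qed.

Lemma bounded_measurable_col_defect e : bounded_measurable (col_defect e).
Proof.
apply: bounded_measurableM;
  exact: (bounded_measurable_comp (bounded_centered e) (measurable_tnth_pair _ _)).
Qed.

Lemma expect_ae0 (F : Omega -> R) : bounded_measurable F ->
  {ae mu, forall x, F x = 0} -> \int[mu]_x F x = 0.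
Proof.
move=> bF F0; rewrite /Rintegral (ae_eq_integral (cst 0%E)) ?integral_cst ?mul0e //.
- by have [mF _] := bF; exact/measurable_EFinP.
- by apply: filterS F0 => x Fx _ /=; rewrite Fx.
Qed.

Lemma expect_tuple1 (F : 1.-tuple Omega -> R) (g : Omega -> R) :
  bounded_measurable g -> (forall t, F t = g (tnth t ord0)) ->
  \int[power 1]_t F t = \int[mu]_x g x.
Proof.
move=> bg Fg; rewrite -(@expect_tnth _ _ _ mu 1 ord0 g bg).
by apply: eq_Rintegral => t _.
Qed.

Lemma expect_tnth_mul (g : Omega -> R) : bounded_measurable g ->
  \int[power 2]_t (g (tnth t ord0) * g (tnth t ord_max)) = (\int[mu]_x g x) ^+ 2.
Proof.
move=> bg.
have bgg : bounded_measurable (fun z : Omega * Omega => g z.1 * g z.2).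
  apply: bounded_measurableM.
    exact: bounded_measurable_comp bg measurable_fst.
  exact: bounded_measurable_comp bg measurable_snd.
rewrite (@expect_tnth2 _ _ _ mu 2 ord0 ord_max (fun z => g z.1 * g z.2)) //.
rewrite (expect_prod12 mu mu bgg) /=.
transitivity (\int[mu]_x ((\int[mu]_y g y) * g x)); last by rewrite expectZ // expr2.
by apply: eq_Rintegral => x _; rewrite expectZ // mulrC.
Qed.

(** For a fixed row the two columns are independent, so the expectation over them is the square of
    the mean deviation of that row, which is zero for almost every row. *)
Lemma expect_row_defect e : \int[power2 1 2]_z row_defect e z = 0.
Proof.
rewrite (expect_prod12 (power 1) (power 2) (bounded_measurable_row_defect e)).
have bE := bounded_measurable_expect2 mu mu (bounded_centered e).
rewrite (@expect_tuple1 _ (fun x => (\int[mu]_y centered e (x, y)) * \int[mu]_y centered e (x, y))).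
- apply: expect_ae0; first exact: bounded_measurableM.
  apply: filterS (class_prob_row e) => x xE.
  rewrite /centered expectB; [|exact: (bounded_measurable_section1 (bounded_measurable_class_prob e))|exact: bounded_measurable_cst].
  by rewrite xE expect_cst subrr mul0r.
- exact: bounded_measurableM.
- move=> t; rewrite -expr2 -(@expect_tnth_mul (fun y => centered e (tnth t ord0, y))) //.
  exact: (bounded_measurable_section1 (bounded_centered e)).
Qed.

Lemma expect_col_defect e : \int[power2 2 1]_z col_defect e z = 0.
Proof.
rewrite (expect_prod21 (power 2) (power 1) (bounded_measurable_col_defect e)).
have bE := bounded_measurable_expect1 mu mu (bounded_centered e).
rewrite (@expect_tuple1 _ (fun y => (\int[mu]_x centered e (x, y)) * \int[mu]_x centered e (x, y))).
- apply: expect_ae0; first exact: bounded_measurableM.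
  apply: filterS (class_prob_col e) => x xE.
  rewrite /centered expectB; [|exact: (bounded_measurable_section2 (bounded_measurable_class_prob e))|exact: bounded_measurable_cst].
  by rewrite xE expect_cst subrr mul0r.
- exact: bounded_measurableM.
- move=> t; rewrite -expr2 -(@expect_tnth_mul (fun x => centered e (x, tnth t ord0))) //.
  exact: (bounded_measurable_section2 (bounded_centered e)).
Qed.

Definition tie (z : Omega * Omega) : R := (f z.1 == f z.2)%:R.

Lemma bounded_measurable_tie : bounded_measurable tie.
Proof.
have mA : measurable ((fun z : Omega * Omega => f z.1 == f z.2) @^-1` [set true]).
  rewrite -[X in measurable X]setTI; apply: measurable_fun_eqr => //.
    exact: (measurableT_comp (latinon_fun_measurable HWf) measurable_fst).
  exact: (measurableT_comp (latinon_fun_measurable HWf) measurable_snd).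
have := bounded_measurable_indic R mA; congr bounded_measurable.
by apply/funext => z; rewrite /tie; congr (nat_of_bool _)%:R; apply/idP/idP => [/set_mem|h]; [|apply/mem_set].
Qed.

(** The law of [f] is Lebesgue measure, so every level set of [f] is null. *)
Lemma expect_tie : \int[(mu \x mu)%E]_z tie z = 0.
Proof.
rewrite (expect_prod12 mu mu bounded_measurable_tie).
rewrite -[RHS](@expect_cst _ _ _ mu 0); apply: eq_Rintegral => x _.
rewrite /Rintegral.
have mA : measurable (f @^-1` [set f x]).
  by rewrite -[X in measurable X]setTI; exact: (latinon_fun_measurable HWf).
transitivity (fine (\int[mu]_y (\1_(f @^-1` [set f x]) y)%:E)%E).
  congr fine; apply: eq_integral => y _; congr EFin; rewrite /tie indicE /=.
  by congr (nat_of_bool _)%:R; apply/eqP/idP => [h|/set_mem]; [apply/mem_set|].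
rewrite integral_indic // setIT; transitivity (fine (lambda01 [set f x])).
  exact: (congr1 fine (latinon_fun_preserving HWf (measurable_set1 (f x)))).
rewrite /lambda01.
rewrite (_ : lebesgue_measure _ = 0%E) //.
apply: (@subset_measure0 _ _ _ lebesgue_measure _ [set f x]) => //.
- by apply: measurableI => //; exact: measurable_set1.
- exact: lebesgue_measure_set1.
Qed.

End latinon_classes.

(** * Choosing a good sample *)

Lemma sum_triple (F : numFieldType) p (g : 'I_p -> 'I_p -> F) : (0 < p)%N ->
  (p%:R ^+ (1 + 2))^-1 * \sum_(a : {ffun 'I_1 -> 'I_p}) \sum_(b : {ffun 'I_2 -> 'I_p})
    g (a ord0) (b ord0) * g (a ord0) (b ord_max) =
  p%:R^-1 * \sum_a ((\sum_b g a b) / p%:R) ^+ 2.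
Proof.
move=> p0; have pn : p%:R != 0 :> F by rewrite pnatr_eq0 -lt0n.
under eq_bigr => a _ do rewrite (sum_coordinate2 (g (a ord0)) (g (a ord0)) p0) //.
rewrite -mulr_sumr.
rewrite (sum_coordinate ord0 (fun a => (\sum_b g a b) / p%:R * ((\sum_b g a b) / p%:R)) p0).
rewrite !mulrA; congr (_ * _).
by rewrite exprD expr1; field.
Qed.

Section sample.
Context (R : realType) d (Omega : measurableType d) (mu : probability Omega R).
Variables (W : Omega * Omega -> pprobability R R) (f : Omega -> R).
Hypothesis HWf : latinon mu W f.
Variable q : nat.
Hypothesis q0 : (0 < q)%N.

Notation power n := (prod_prob (fun _ : 'I_n => mu)).
Notation power2 k l := (power k \x power l)%E.

Lemma ustat_row_defect p (e : 'I_q) (z : p.-tuple Omega * p.-tuple Omega) : (0 < p)%N ->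
  ustat (row_defect W e) z = p%:R^-1 * \sum_a
    ((\sum_b class_prob W e (tnth z.1 a, tnth z.2 b)) / p%:R - q%:R^-1) ^+ 2.
Proof.
move=> p0; have pn : p%:R != 0 :> R by rewrite pnatr_eq0 -lt0n.
pose g a b := class_prob W e (tnth z.1 a, tnth z.2 b) - q%:R^-1.
transitivity (p%:R^-1 * \sum_a ((\sum_b g a b) / p%:R) ^+ 2).
  rewrite -sum_triple //; congr (_ * _); apply: eq_bigr => a _; apply: eq_bigr => b _.
  by rewrite /row_defect !tnth_mktuple.
congr (_ * _); apply: eq_bigr => a _; congr (_ ^+ 2).
by rewrite /g sumrB sumr_const card_ord -(mulr_natr q%:R^-1); field; rewrite pnatr_eq0 -lt0n q0.
Qed.

Lemma ustat_col_defect p (e : 'I_q) (z : p.-tuple Omega * p.-tuple Omega) : (0 < p)%N ->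
  ustat (col_defect W e) z = p%:R^-1 * \sum_b
    ((\sum_a class_prob W e (tnth z.1 a, tnth z.2 b)) / p%:R - q%:R^-1) ^+ 2.
Proof.
move=> p0; have pn : p%:R != 0 :> R by rewrite pnatr_eq0 -lt0n.
pose g b a := class_prob W e (tnth z.1 a, tnth z.2 b) - q%:R^-1.
transitivity (p%:R^-1 * \sum_b ((\sum_a g b a) / p%:R) ^+ 2).
  rewrite -sum_triple // addnC; congr (_ * _).
  rewrite exchange_big; apply: eq_bigr => b _; apply: eq_bigr => a _.
  by rewrite /col_defect !tnth_mktuple.
congr (_ * _); apply: eq_bigr => b _; congr (_ ^+ 2).
by rewrite /g sumrB sumr_const card_ord -(mulr_natr q%:R^-1); field; rewrite pnatr_eq0 -lt0n q0.
Qed.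

(** A single nonnegative quantity for all that can go wrong: pattern densities off, uneven lines,
    ties under [f]. If its expectation is small, some sample is good in every respect at once. The
    bound [K] on the sizes keeps the sum finite. *)
Definition sample_error K p (z : p.-tuple Omega * p.-tuple Omega) : R :=
  \sum_(k < K.+1) \sum_(l < K.+1) \sum_(c : 'M['I_q]_(k, l))
     (ustat (class_density W f c) z - \int[power2 k l]_w class_density W f c w) ^+ 2 +
  (\sum_(e < q) ustat (row_defect W e) z + \sum_(e < q) ustat (col_defect W e) z) +
  (\sum_i \sum_(j | i != j) tie f (tnth z.1 i, tnth z.1 j) +
   \sum_i \sum_(j | i != j) tie f (tnth z.2 i, tnth z.2 j)).

Lemma expect_sample_error K : exists C : R, 0 <= C /\ forall p, (0 < p)%N ->
  bounded_measurable (sample_error K (p := p)) /\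
  \int[power2 p p]_z sample_error K z <= C / p%:R.
Proof.
pose C1 : R := \sum_(k < K.+1) \sum_(l < K.+1) \sum_(c : 'M['I_q]_(k, l))
  12%:R * (k ^ 2 + l ^ 2)%:R.
(* [10 = 2 * (1 ^ 2 + 2 ^ 2)], the bias constant of a kernel bounded by 1 on one row and two
   columns, or the reverse. *)
pose C2 : R := \sum_(e < q) 10%:R.
exists (C1 + (C2 + C2)); split.
  by rewrite !addr_ge0 //; do ?(apply: sumr_ge0 => ? _); rewrite ?mulr_ge0.
move=> p p0; have pR : (0 : R) < p%:R by rewrite ltr0n.
have bD k l (c : 'M['I_q]_(k, l)) := bounded_measurable_class_density HWf c.
have bsq k l (c : 'M['I_q]_(k, l)) : bounded_measurable (fun z : p.-tuple Omega * p.-tuple Omega =>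
   (ustat (class_density W f c) z - \int[power2 k l]_w class_density W f c w) ^+ 2).
  under eq_fun do rewrite expr2.
  by apply: bounded_measurableM; (apply: bounded_measurableB;
    [exact: bounded_measurable_ustat|exact: bounded_measurable_cst]).
have brow e := bounded_measurable_ustat p (bounded_measurable_row_defect HWf e).
have bcol e := bounded_measurable_ustat p (bounded_measurable_col_defect HWf e).
have btie1 i j : bounded_measurable (fun z : p.-tuple Omega * p.-tuple Omega => tie f (tnth z.1 i, tnth z.1 j)).
  apply: (bounded_measurable_comp (bounded_measurable_tie HWf)).
  by apply: measurable_fun_pair; exact: (measurableT_comp (measurable_tnth _) measurable_fst).
have btie2 i j : bounded_measurable (fun z : p.-tuple Omega * p.-tuple Omega => tie f (tnth z.2 i, tnth z.2 j)).
  apply: (bounded_measurable_comp (bounded_measurable_tie HWf)).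
  by apply: measurable_fun_pair; exact: (measurableT_comp (measurable_tnth _) measurable_snd).
have bA : bounded_measurable (fun z : p.-tuple Omega * p.-tuple Omega =>
  \sum_(k < K.+1) \sum_(l < K.+1) \sum_(c : 'M['I_q]_(k, l))
     (ustat (class_density W f c) z - \int[power2 k l]_w class_density W f c w) ^+ 2).
  by do 3 (apply: bounded_measurable_sum => ?); exact: bsq.
have bB1 : bounded_measurable (fun z : p.-tuple Omega * p.-tuple Omega => \sum_(e < q) ustat (row_defect W e) z).
  by apply: bounded_measurable_sum => e; exact: brow.
have bB2 : bounded_measurable (fun z : p.-tuple Omega * p.-tuple Omega => \sum_(e < q) ustat (col_defect W e) z).
  by apply: bounded_measurable_sum => e; exact: bcol.
have bT1 : bounded_measurable (fun z : p.-tuple Omega * p.-tuple Omega => \sum_i \sum_(j | i != j) tie f (tnth z.1 i, tnth z.1 j)).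
  by do 2 (apply: bounded_measurable_sum => ?); exact: btie1.
have bT2 : bounded_measurable (fun z : p.-tuple Omega * p.-tuple Omega => \sum_i \sum_(j | i != j) tie f (tnth z.2 i, tnth z.2 j)).
  by do 2 (apply: bounded_measurable_sum => ?); exact: btie2.
have bB := bounded_measurableD bB1 bB2.
have bT := bounded_measurableD bT1 bT2.
split; first exact: bounded_measurableD (bounded_measurableD bA bB) bT.
rewrite /sample_error (expectD (power2 p p) (bounded_measurableD bA bB) bT).
rewrite (expectD (power2 p p) bA bB) (expectD (power2 p p) bB1 bB2) (expectD (power2 p p) bT1 bT2).
have bty : bounded_measurable (tie f) := bounded_measurable_tie HWf.
have T0 (i j : 'I_p) : i != j -> \int[power p]_t tie f (tnth t i, tnth t j) = 0.
  by move=> ij; rewrite (expect_tnth2 mu ij bty); exact: (expect_tie HWf).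
have btt (i j : 'I_p) : bounded_measurable (fun t : p.-tuple Omega => tie f (tnth t i, tnth t j)).
  by apply: (bounded_measurable_comp bty); apply: measurable_fun_pair; exact: measurable_tnth.
have T1 : \int[power2 p p]_z (\sum_i \sum_(j | i != j) tie f (tnth z.1 i, tnth z.1 j)) = 0.
  rewrite (expect_prod12 (power p) (power p) bT1) /=.
  under eq_Rintegral do rewrite expect_cst.
  rewrite expect_sum => [|i]; last by apply: bounded_measurable_sum => j; exact: btt.
  rewrite big1 // => i _; rewrite expect_sum => [|j]; last exact: btt.
  by rewrite big1 // => j ij; exact: T0.
have T2 : \int[power2 p p]_z (\sum_i \sum_(j | i != j) tie f (tnth z.2 i, tnth z.2 j)) = 0.
  rewrite (expect_prod21 (power p) (power p) bT2) /=.
  under eq_Rintegral do rewrite expect_cst.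
  rewrite expect_sum => [|i]; last by apply: bounded_measurable_sum => j; exact: btt.
  rewrite big1 // => i _; rewrite expect_sum => [|j]; last exact: btt.
  by rewrite big1 // => j ij; exact: T0.
rewrite T1 T2 !addr0 mulrDl; apply: lerD.
  rewrite (@expect_sum _ _ _ (power2 p p)) => [|k]; last by do 2 (apply: bounded_measurable_sum => ?); exact: bsq.
  rewrite mulr_suml; apply: ler_sum => k _.
  rewrite (@expect_sum _ _ _ (power2 p p)) => [|l]; last by (apply: bounded_measurable_sum => ?); exact: bsq.
  rewrite mulr_suml; apply: ler_sum => l _.
  rewrite (@expect_sum _ _ _ (power2 p p)) => [|c]; last exact: bsq.
  rewrite mulr_suml; apply: ler_sum => c _.
  apply: variance_ustat => // z; exact: class_density01.
have le1 (e : 'I_q) z : `|row_defect W e z| <= 1.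
  by rewrite /row_defect normrM; apply: mulr_ile1 => //; exact: centered_le1.
have le1' (e : 'I_q) z : `|col_defect W e z| <= 1.
  by rewrite /col_defect normrM; apply: mulr_ile1 => //; exact: centered_le1.
rewrite mulrDl; apply: lerD.
  rewrite (@expect_sum _ _ _ (power2 p p)) // mulr_suml; apply: ler_sum => e _.
  have := expect_ustat mu p0 (bounded_measurable_row_defect HWf e) (le1 e).
  rewrite (expect_row_defect HWf q0) subr0 => le; apply: le_trans (ler_norm _) _.
  by apply: le_trans le _; rewrite mulr1 -natrM.
rewrite (@expect_sum _ _ _ (power2 p p)) // mulr_suml; apply: ler_sum => e _.
have := expect_ustat mu p0 (bounded_measurable_col_defect HWf e) (le1' e).
rewrite (expect_col_defect HWf q0) subr0 => le; apply: le_trans (ler_norm _) _.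
by apply: le_trans le _; rewrite mulr1 -natrM.
Qed.

Lemma exists_sample (K P0 : nat) (zeta : R) : 0 < zeta ->
  exists p (X Y : p.-tuple Omega), [/\ (P0 <= p)%N /\ (0 < p)%N,
    injective (fun i => f (tnth X i)) /\ injective (fun i => f (tnth Y i)),
    forall k l (c : 'M['I_q]_(k, l)), (k <= K)%N -> (l <= K)%N ->
      (ustat (class_density W f c) (X, Y) - \int[power2 k l]_w class_density W f c w) ^+ 2 <= zeta,
    \sum_a \sum_(e < q) ((\sum_b class_prob W e (tnth X a, tnth Y b)) / p%:R - q%:R^-1) ^+ 2
      <= zeta * p%:R &
    \sum_b \sum_(e < q) ((\sum_a class_prob W e (tnth X a, tnth Y b)) / p%:R - q%:R^-1) ^+ 2
      <= zeta * p%:R].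
Proof.
move=> zeta0; have [C [C0 Cp]] := expect_sample_error K.
(* Capped at 1 because the number of ties is an integer: a total error below 1 excludes them. *)
pose z1 : R := Num.min zeta 1.
have z10 : 0 < z1 by rewrite lt_min zeta0 ltr01.
pose p := maxn P0 (Num.trunc (C / z1)).+1.
have p0 : (0 < p)%N by rewrite leq_max orbT.
have pR : (0 : R) < p%:R by rewrite ltr0n.
have [bE E] := Cp p p0.
have Elt : \int[power2 p p]_z sample_error K z < z1.
  apply: le_lt_trans E _; rewrite ltr_pdivrMr // mulrC -ltr_pdivrMr //.
  by apply: lt_le_trans (truncnS_gt _) _; rewrite ler_nat leq_maxr.
have [[X Y] XY] := expect_exists bE Elt.
have A0 k l (c : 'M['I_q]_(k, l)) : 0 <= (ustat (class_density W f c) (X, Y) -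
    \int[power2 k l]_w class_density W f c w) ^+ 2 by rewrite sqr_ge0.
pose A := \sum_(k < K.+1) \sum_(l < K.+1) \sum_(c : 'M['I_q]_(k, l))
     (ustat (class_density W f c) (X, Y) - \int[power2 k l]_w class_density W f c w) ^+ 2.
pose B1 := \sum_(e < q) ustat (row_defect W e) (X, Y).
pose B2 := \sum_(e < q) ustat (col_defect W e) (X, Y).
pose T1 := \sum_i \sum_(j | i != j) tie f (tnth X i, tnth X j).
pose T2 := \sum_i \sum_(j | i != j) tie f (tnth Y i, tnth Y j).
have A00 : 0 <= A by do 3 (apply: sumr_ge0 => ? _); exact: A0.
have B10 : 0 <= B1.
  apply: sumr_ge0 => e _; rewrite ustat_row_defect // mulr_ge0 ?invr_ge0 //.
  by apply: sumr_ge0 => a _; rewrite sqr_ge0.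
have B20 : 0 <= B2.
  apply: sumr_ge0 => e _; rewrite ustat_col_defect // mulr_ge0 ?invr_ge0 //.
  by apply: sumr_ge0 => a _; rewrite sqr_ge0.
have tie0 z : 0 <= tie f z by rewrite ler0n.
have T10 : 0 <= T1 by do 2 (apply: sumr_ge0 => ? _); exact: tie0.
have T20 : 0 <= T2 by do 2 (apply: sumr_ge0 => ? _); exact: tie0.
have XYE : A + (B1 + B2) + (T1 + T2) < z1 by exact: XY.
have zz : z1 <= zeta by rewrite ge_min lexx.
have z11 : z1 <= 1 by rewrite ge_min lexx orbT.
have noties (X' : p.-tuple Omega) :
    \sum_i \sum_(j | i != j) tie f (tnth X' i, tnth X' j) < 1 ->
    injective (fun i => f (tnth X' i)).
  move=> lt i j fij; apply/eqP; apply: contraT => ij; move: lt; rewrite ltNge => /negP[].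
  rewrite (bigD1 i) //= (bigD1 j) //= {1}/tie /= fij eqxx -addrA lerDl addr_ge0 //.
    by apply: sumr_ge0 => ? _.
  by do 2 (apply: sumr_ge0 => ? _).
exists p, X, Y; split.
- by split=> //; exact: leq_maxl.
- by split; apply: noties; [rewrite -/T1|rewrite -/T2]; lra.
- move=> k l c kK lK; apply: (@le_trans _ _ A); last by lra.
  have kK' : (k < K.+1)%N by []. have lK' : (l < K.+1)%N by [].
  rewrite /A (bigD1 (Ordinal kK')) //= (bigD1 (Ordinal lK')) //= (bigD1 c) //=.
  rewrite -!addrA lerDl !addr_ge0 //; do ?(apply: sumr_ge0 => ? _) => //.
- have -> : \sum_a \sum_(e < q) ((\sum_b class_prob W e (tnth X a, tnth Y b)) / p%:R - q%:R^-1) ^+ 2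
     = B1 * p%:R.
    rewrite exchange_big /B1 mulr_suml; apply: eq_bigr => e _.
    by rewrite ustat_row_defect // mulrAC mulVf ?mul1r // gt_eqF.
  by rewrite ler_wpM2r //; lra.
- have -> : \sum_b \sum_(e < q) ((\sum_a class_prob W e (tnth X a, tnth Y b)) / p%:R - q%:R^-1) ^+ 2
     = B2 * p%:R.
    rewrite exchange_big /B2 mulr_suml; apply: eq_bigr => e _.
    by rewrite ustat_col_defect // mulrAC mulVf ?mul1r // gt_eqF.
  by rewrite ler_wpM2r //; lra.
Qed.

End sample.

(** * Sorting the sample *)

Lemma exists_sorting (R : realDomainType) p (g : 'I_p -> R) : injective g ->
  exists s : 'I_p -> 'I_p, injective s /\
    forall a b, (g (s a) < g (s b)) = (a < b)%N.
Proof.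
move=> ginj.
pose below i := [set j | g j < g i]%SET.
have below_lt i : (#|below i| < p)%N.
  rewrite -[ltnRHS]card_ord; apply: proper_card; apply/properP; split.
    by apply/fintype.subsetP.
  by exists i; rewrite // inE ltxx.
pose rank i : 'I_p := Ordinal (below_lt i).
have rank_lt i j : g i < g j -> (rank i < rank j)%N.
  move=> ij; apply: proper_card; apply/properP; split.
    by apply/fintype.subsetP => h; rewrite !inE => hi; exact: lt_trans ij.
  by exists i; rewrite inE ?ij // ltxx.
have rank_inj : injective rank.
  move=> i j ij; apply: ginj; apply/eqP; rewrite eq_le !leNgt.
  by apply/andP; split; apply/negP => /rank_lt; rewrite ij ltnn.
have [s rankK sK] := injF_bij rank_inj.
exists s; split; first exact: can_inj sK.
move=> a b; apply/idP/idP => [/rank_lt|ab]; first by rewrite !sK.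
rewrite ltNge le_eqVlt; apply/negP => /orP[/eqP/ginj sab|/rank_lt].
  by move: ab; rewrite -[b]sK sab sK ltnn.
by rewrite !sK ltnNge ltnW.
Qed.

Section sorted_sample.
Context (R : realType) d (Omega : measurableType d) (mu : probability Omega R).
Variables (W : Omega * Omega -> pprobability R R) (f : Omega -> R).
Variables (q p : nat) (X Y : p.-tuple Omega) (s t : 'I_p -> 'I_p).
Hypotheses (sinj : injective s) (tinj : injective t).
Hypothesis s_lt : forall a b, (f (tnth X (s a)) < f (tnth X (s b))) = (a < b)%N.
Hypothesis t_lt : forall a b, (f (tnth Y (t a)) < f (tnth Y (t b))) = (a < b)%N.

Definition sample_array a b (e : 'I_q) : R := class_prob W e (tnth X (s a), tnth Y (t b)).

Lemma ordered_select k (Z : p.-tuple Omega) (r : 'I_p -> 'I_p) (a : {ffun 'I_k -> 'I_p}) :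
  (forall b b', (f (tnth Z (r b)) < f (tnth Z (r b'))) = (b < b')%N) ->
  (select [ffun i => r (a i)] Z \in @ordered_tuples R d Omega f k) = incr a.
Proof.
move=> rlt; apply/idP/idP => [/set_mem ord|/forallP ai]; last first.
  apply/mem_set => i j ij; rewrite !tnth_mktuple !ffunE rlt.
  by have /implyP := forallP (ai i) j; apply.
apply/forallP => i; apply/forallP => j; apply/implyP => ij.
by have := ord i j ij; rewrite !tnth_mktuple !ffunE rlt.
Qed.

(** Reindexing by the sorting permutations turns the indicators of ordered tuples in [class_density]
    into monotonicity of the index maps, so the mean over all maps becomes a sum over increasing
    ones. *)
Lemma ustat_pattern_weight k l (c : 'M['I_q]_(k, l)) :
  (k`! * l`!)%:R * ustat (class_density W f c) (X, Y) = pattern_weight sample_array c.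
Proof.
rewrite /ustat /pattern_weight mulrA; congr (_ * _).
have post_inj h (r : 'I_p -> 'I_p) : injective r ->
    injective (fun a : {ffun 'I_h -> 'I_p} => [ffun i => r (a i)]).
  by move=> rinj a a' /ffunP aa'; apply/ffunP => i; have := aa' i; rewrite !ffunE => /rinj.
rewrite (reindex_inj (post_inj k s sinj)) [RHS]big_mkcond; apply: eq_bigr => a _.
rewrite (reindex_inj (post_inj l t tinj)) /=.
case: ifPn => ai; last first.
  rewrite big1 // => b _; rewrite /class_density ordered_select //.
  by rewrite (negPf ai) !mul0r.
rewrite [RHS]big_mkcond; apply: eq_bigr => b _.
rewrite /class_density !ordered_select // ai mul1r.
case: ifPn => _; last by rewrite mul0r.
rewrite mul1r; apply: eq_bigr => i _; apply: eq_bigr => j _.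
by rewrite /= !tnth_mktuple !ffunE.
Qed.

Lemma sample_array_rows :
  \sum_a \sum_(e < q) ((\sum_b sample_array a b e) / p%:R - q%:R^-1) ^+ 2 =
  \sum_a \sum_(e < q) ((\sum_b class_prob W e (tnth X a, tnth Y b)) / p%:R - q%:R^-1) ^+ 2.
Proof.
rewrite [RHS](reindex_inj sinj); apply: eq_bigr => a _; apply: eq_bigr => e _.
by rewrite [X in _ = (X / _ - _) ^+ 2](reindex_inj tinj).
Qed.

Lemma sample_array_cols :
  \sum_b \sum_(e < q) ((\sum_a sample_array a b e) / p%:R - q%:R^-1) ^+ 2 =
  \sum_b \sum_(e < q) ((\sum_a class_prob W e (tnth X a, tnth Y b)) / p%:R - q%:R^-1) ^+ 2.
Proof.
rewrite [RHS](reindex_inj tinj); apply: eq_bigr => b _; apply: eq_bigr => e _.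
by rewrite [X in _ = (X / _ - _) ^+ 2](reindex_inj sinj).
Qed.

End sorted_sample.

(** * Squeezing the density of a Latinon between sums over class patterns *)

Lemma size_undup_map (T : eqType) (U V : eqType) (g : T -> U) (h : T -> V) (r : seq T) :
  (forall x y, (g x == g y) = (h x == h y)) ->
  size (undup (map g r)) = size (undup (map h r)).
Proof.
move=> gh; elim: r => //= x r IHr.
have -> : (g x \in map g r) = (h x \in map h r).
  by apply/mapP/mapP => -[y yr xy]; exists y => //; apply/eqP; move: xy => /eqP; rewrite gh.
by case: (_ \in _) => //=; rewrite IHr.
Qed.

(** Repeated entries are allowed here, in contrast with [struct_equiv_coarsen]: a rank counts the
    distinct values up to an entry, and comparisons determine equalities too. *)
Lemma struct_equiv_comparison d (T : orderType d) d' (T' : orderType d')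
    k l (M N : 'M[T]_(k, l)) (A : 'M[T']_(k, l)) :
  (forall i j i' j', (M i j <= M i' j')%O = (N i j <= N i' j')%O) ->
  struct_equiv M A = struct_equiv N A.
Proof.
move=> MN.
have rk (Q : 'M[T]_(k, l)) i j : entry_rank Q (Q i j) =
    size (undup (map (fun z => Q z.1 z.2)
      (seq.filter (fun z => (Q z.1 z.2 <= Q i j)%O) (enum {: 'I_k * 'I_l})))).
  by rewrite /entry_rank /entries -size_filter filter_undup filter_map.
rewrite /struct_equiv; apply: eq_forallb => i; apply: eq_forallb => j.
rewrite !rk; congr (_ == _).
rewrite (@size_undup_map _ _ _ (fun z => M z.1 z.2) (fun z => N z.1 z.2)).
  by congr (size (undup (map _ _))); apply: eq_filter => z; rewrite MN.
by move=> z z'; rewrite !eq_le !MN.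
Qed.

Section monotone_integral.
Import HBNNSimple.

(* Measurability is not needed, as the integral of a nonnegative function is a
   supremum over the simple functions below it; it spares the measurability of
   [entry_prob] in x and y. *)
Lemma le_integral_ge0 d (T : measurableType d) (R : realType)
    (m : {measure set T -> \bar R}) (D : set T) (F G : T -> \bar R) :
  (forall x, D x -> 0 <= F x)%E -> (forall x, D x -> F x <= G x)%E ->
  (\int[m]_(x in D) F x <= \int[m]_(x in D) G x)%E.
Proof.
move=> F0 FG; have G0 x : D x -> (0 <= G x)%E by move=> Dx; apply: le_trans (FG x Dx); exact: F0.
rewrite !ge0_integralE //; apply: ereal_sup_le => _ [h hF <-].
exists h => // x; apply: le_trans (hF x) _.
exact: lee_restrict.
Qed.

End monotone_integral.

Lemma expect_indic d (T : measurableType d) (R : realType) (P : probability T R) (A : set T) :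
  measurable A -> \int[P]_z (z \in A)%:R = fine (P A).
Proof.
move=> mA; rewrite /Rintegral; congr fine.
by rewrite -[LHS]/(\int[P]_z (\1_A z)%:E)%E integral_indic // setIT.
Qed.

Section density_bounds.
Context (R : realType) d (Omega : measurableType d) (mu : probability Omega R).
Variables (W : Omega * Omega -> pprobability R R) (f : Omega -> R).
Hypothesis HWf : latinon mu W f.
Variable q : nat.
Hypothesis q0 : (0 < q)%N.

Notation power n := (prod_prob (fun _ : 'I_n => mu)).
Notation power2 k l := (power k \x power l)%E.

Lemma integral_rectangle k l (D : set (k.-tuple Omega)) (D' : set (l.-tuple Omega))
    (G : k.-tuple Omega * l.-tuple Omega -> R) :
  measurable D -> measurable D' -> bounded_measurable G ->
  (\int[power k]_(x in D) \int[power l]_(y in D') (G (x, y))%:E =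
   (\int[power2 k l]_z ((z.1 \in D)%:R * (z.2 \in D')%:R * G z))%:E)%E.
Proof.
move=> mD mD' bG.
have bH : bounded_measurable (fun z : k.-tuple Omega * l.-tuple Omega =>
    (z.1 \in D)%:R * (z.2 \in D')%:R * G z).
  apply: bounded_measurableM => //; apply: bounded_measurableM.
    exact: bounded_measurable_comp (bounded_measurable_indic R mD) measurable_fst.
  exact: bounded_measurable_comp (bounded_measurable_indic R mD') measurable_snd.
have restr (T : Type) (E : set T) (F : T -> R) :
    ((fun x => (F x)%:E) \_ E = (fun x => ((x \in E)%:R * F x)%:E))%E.
  by apply/funext => x; rewrite /patch; case: ifP => _; rewrite ?mul1r ?mul0r.
rewrite (expect_prod12 (power k) (power l) bH).
rewrite -(expect_EFin (power k) (bounded_measurable_expect2 (power k) (power l) bH)).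
rewrite integral_mkcond; apply: eq_integral => x _; rewrite /patch; case: ifP => xD /=; last first.
  transitivity (\int[power l]_y (0 : R))%:E; first by rewrite expect_cst.
  by congr EFin; apply: eq_Rintegral => y _; rewrite !mul0r.
rewrite integral_mkcond restr.
transitivity (\int[power l]_y ((y \in D')%:R * G (x, y)))%:E; last first.
  by congr EFin; apply: eq_Rintegral => y _; rewrite mul1r.
apply: expect_EFin; apply: bounded_measurableM; first exact: bounded_measurable_indic.
exact: (bounded_measurable_section1 bG).
Qed.

Section pattern.
Variables (k l : nat) (A : 'M['I_(k * l)]_(k, l)).

(** Since the outer classes are unbounded, the intersection with the unit interval is what places a
    cell inside [realized] when [c] is injective and equivalent to [A]. It costs no mass, [W] being
    carried by the unit interval. *)
Definition cell (c : 'M['I_q]_(k, l)) : set (k.-tuple (l.-tuple R)) :=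
  box (fun i => box (fun j => @class_set R q (c i j) `&` `[0, 1]%classic)).

Lemma measurable_cell c : measurable (cell c).
Proof.
apply: measurable_box => i; apply: measurable_box => j; apply: measurableI => //.
exact: measurable_class_set.
Qed.

Definition realized : set (k.-tuple (l.-tuple R)) :=
  @mx_of_tuples R k l @^-1` realizations A `[0%R, 1%R]%classic.

(* Structural equivalence to A depends only on the comparisons between entries,
   of which there are finitely many patterns. *)
Lemma measurable_realized : measurable realized.
Proof.
have mE i j : measurable_fun setT (fun M : k.-tuple (l.-tuple R) => tnth (tnth M i) j).
  exact: (measurableT_comp (measurable_tnth _) (measurable_tnth _)).
pose entry (M : k.-tuple (l.-tuple R)) (z : 'I_k * 'I_l) := tnth (tnth M z.1) z.2.
pose cmp (M : k.-tuple (l.-tuple R)) : {ffun ('I_k * 'I_l) * ('I_k * 'I_l) -> bool} :=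
  [ffun z => entry M z.1 <= entry M z.2].
pose good := [set g | exists2 M, realized M & cmp M = g].
have -> : realized =
    (\bigcap_(z in [set: 'I_k * 'I_l]) ((fun M => entry M z) @^-1` `[0%R, 1%R]%classic)) `&`
    \bigcup_(g in good) \bigcap_(z in [set: ('I_k * 'I_l) * ('I_k * 'I_l)])
       ((fun M => entry M z.1 <= entry M z.2) @^-1` [set g z]).
  apply/seteqP; split=> M.
    move=> MA; split.
      by move=> z _; have [+ _] := MA => /(_ z.1 z.2); rewrite mxE.
    by exists (cmp M); [exists M|move=> z _; rewrite /= ffunE].
  move=> [M01 [g [N NA Ng] Mg]]; split.
    by move=> i j; rewrite mxE; exact: (M01 (i, j) Logic.I).
  have [_] := NA; rewrite (@struct_equiv_comparison _ _ _ _ _ _ (mx_of_tuples N) (mx_of_tuples M)) //.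
  move=> i j i' j'; rewrite !mxE.
  have := Mg ((i, j), (i', j')) Logic.I; rewrite /= -Ng ffunE /entry /= => ->.
  by [].
apply: measurableI.
  apply: fin_bigcap_measurable => // z _.
  by rewrite -[X in measurable X]setTI; exact: mE.
apply: fin_bigcup_measurable; first exact: finite_finset.
move=> g _; apply: fin_bigcap_measurable => // z _.
by rewrite -[X in measurable X]setTI; apply: measurable_fun_ler => //; exact: mE.
Qed.

Definition cell_prob (c : 'M['I_q]_(k, l)) (z : k.-tuple Omega * l.-tuple Omega) : R :=
  \prod_i \prod_j class_prob W (c i j) (tnth z.1 i, tnth z.2 j).

Lemma entry_prob_cell c x y :
  fine (entry_prob W x y (cell c)) = cell_prob c (x, y).
Proof.
have mI i j : measurable (@class_set R q (c i j) `&` `[0%R, 1%R]%classic).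
  by apply: measurableI => //; exact: measurable_class_set.
rewrite /entry_prob /cell (prod_prob_box _ (fun i => measurable_box (mI i))).
have inner i j : W (tnth x i, tnth y j) (@class_set R q (c i j) `&` `[0, 1]%classic) =
    (class_prob W (c i j) (tnth x i, tnth y j))%:E.
  rewrite -class_prob_fin; apply/eqP; rewrite eq_le; apply/andP; split.
    by apply: le_measure; rewrite ?inE; [exact: mI|exact: measurable_class_set|exact: subIsetl].
  set w := W _; have w0 : w (~` `[0, 1]%classic) = 0%E.
    rewrite probability_setC // [X in (_ - X)%E](latinon_unit HWf) subee //.
  rewrite -[leRHS]adde0 -w0; apply: le_trans (measureU2 _ _ _).
  - apply: le_measure; rewrite ?inE.
    + exact: measurable_class_set.
    + apply: measurableU; last exact: measurableC.
      exact: mI.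
    + by move=> r Ir; case: (pselect (`[0%R, 1%R]%classic r)) => h; [left|right].
  - exact: mI.
  - exact: measurableC.
under eq_bigr => i _.
  rewrite (prod_prob_box _ (mI i)).
  under eq_bigr do rewrite inner.
  rewrite prodEFin; over.
by rewrite prodEFin.
Qed.

Lemma cell_inj c c' t : cell c t -> cell c' t -> c = c'.
Proof.
move=> ct c't; apply/matrixP => i j.
exact: class_set_inj (ct i j).1 (c't i j).1.
Qed.

Lemma cell_cover t : realized t -> exists c, cell c t.
Proof.
move=> [t01 _]; have [e eP] := choice (@class_set_cover R q q0).
exists (\matrix_(i, j) e (tnth (tnth t i) j)) => i j.
by rewrite mxE; split; [exact: eP|have := t01 i j; rewrite mxE].
Qed.

Lemma cell_struct_equiv c t : cell c t -> mx_injb c ->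
  struct_equiv (mx_of_tuples t) A = struct_equiv c A.
Proof.
move=> ct /injectiveP cinj; apply: struct_equiv_coarsen => // i j i' j'.
by rewrite !mxE leEord; exact: class_set_le (ct i j).1 (ct i' j').1.
Qed.

Let goodc (c : 'M['I_q]_(k, l)) := mx_injb c && struct_equiv c A.

(** The cells partition the arrays over the unit interval. In a cell with [c] injective, equivalence
    to [A] is decided by [c]; the other cells are undecided, and the upper bound takes them
    whole. *)
Lemma entry_prob_bounds x y :
  \sum_(c | goodc c) cell_prob c (x, y) <= fine (entry_prob W x y realized) <=
  \sum_(c | goodc c) cell_prob c (x, y) +
  \sum_(c : 'M['I_q]_(k, l) | ~~ mx_injb c) cell_prob c (x, y).
Proof.
have bc c : bounded_measurable (fun t : k.-tuple (l.-tuple R) => (t \in cell c)%:R : R).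
  exact: bounded_measurable_indic (measurable_cell c).
have br := bounded_measurable_indic R measurable_realized.
have sumE (Q : pred 'M['I_q]_(k, l)) : \sum_(c | Q c) cell_prob c (x, y) =
    \int[entry_prob W x y]_t (\sum_(c | Q c) (t \in cell c)%:R).
  rewrite expect_sum //; apply: eq_bigr => c _.
  by rewrite -entry_prob_cell (expect_indic _ (measurable_cell c)).
rewrite !sumE -(expect_indic _ measurable_realized) -expectD; [|exact: bounded_measurable_sum..].
apply/andP; split; apply: le_expect => //.
- exact: bounded_measurable_sum.
- move=> t; have [[c [cg ct]]|none] := pselect (exists c, goodc c /\ cell c t).
    rewrite (bigD1 c) //= big1 ?addr0 => [|c' /andP[_ c'c]].
      rewrite (mem_set ct) mem_set //; have /andP[cinj cA] := cg; split; last first.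
        by rewrite (cell_struct_equiv ct cinj).
      by move=> i j; rewrite mxE; exact: (ct i j).2.
    rewrite memNset // => c't; move/eqP: c'c; apply; exact: cell_inj c't ct.
  rewrite big1 // => c cg; rewrite memNset // => ct; apply: none; by exists c.
- by apply: bounded_measurableD; exact: bounded_measurable_sum.
- have nn t c : 0 <= (t \in cell c)%:R :> R by rewrite ler0n.
  move=> t; have [tr|tr] := pselect (realized t); last first.
    by rewrite memNset // addr_ge0 // sumr_ge0.
  have [c ct] := cell_cover tr; rewrite mem_set //.
  have [cinj|cinj] := boolP (mx_injb c).
    have cg : goodc c by rewrite /goodc cinj -(cell_struct_equiv ct cinj); exact: tr.2.
    by rewrite (bigD1 c) //= (mem_set ct) -addrA lerDl addr_ge0 // sumr_ge0.
  rewrite addrC (bigD1 c) //= (mem_set ct) -addrA lerDl addr_ge0 // sumr_ge0 //.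
Qed.

(** Integrates the pointwise bounds. The density, a priori an extended real, is finite because it
    lies between two finite sums; these are expectations of [class_density], to be compared with
    sample means. *)
Lemma latinon_density_bounds : exists r : R,
  latinon_density mu W f A = r%:E /\
  let S := \sum_(c | goodc c) \int[power2 k l]_w class_density W f c w in
  let N := \sum_(c : 'M['I_q]_(k, l) | ~~ mx_injb c) \int[power2 k l]_w class_density W f c w in
  (k`! * l`!)%:R * S <= r <= (k`! * l`!)%:R * (S + N).
Proof.
pose Ok := @ordered_tuples R d Omega f k; pose Ol := @ordered_tuples R d Omega f l.
have mk : measurable Ok := measurable_ordered_tuples HWf (k := k).
have ml : measurable Ol := measurable_ordered_tuples HWf (k := l).
have bcell c : bounded_measurable (cell_prob c).
  apply: bounded_measurable_prod => i; apply: bounded_measurable_prod => j.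
  exact: bounded_measurable_comp (bounded_measurable_class_prob HWf _) (measurable_tnth_pair _ _).
have rect (Q : pred 'M['I_q]_(k, l)) :
    (\int[power k]_(x in Ok) \int[power l]_(y in Ol) (\sum_(c | Q c) cell_prob c (x, y))%:E =
     (\sum_(c | Q c) \int[power2 k l]_w class_density W f c w)%:E)%E.
  rewrite (integral_rectangle mk ml (G := fun z => \sum_(c | Q c) cell_prob c z)); last first.
    exact: bounded_measurable_sum.
  congr EFin; rewrite -(@expect_sum _ _ _ (power2 k l)); last first.
    by move=> c; exact: (bounded_measurable_class_density HWf).
  by apply: eq_Rintegral => z _; rewrite mulr_sumr.
set J := (\int[power k]_(x in Ok) \int[power l]_(y in Ol) entry_prob W x y realized)%E.
have fin x y : (entry_prob W x y realized = (fine (entry_prob W x y realized))%:E)%E.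
  by rewrite fineK // fin_num_measure //; exact: measurable_realized.
set S := \sum_(c | goodc c) \int[power2 k l]_w class_density W f c w.
set N := \sum_(c : 'M['I_q]_(k, l) | ~~ mx_injb c) \int[power2 k l]_w class_density W f c w.
have cell0 c z : 0 <= cell_prob c z.
  apply: prodr_ge0 => i _; apply: prodr_ge0 => j _.
  by have /andP[] := class_prob01 W (c i j) (tnth z.1 i, tnth z.2 j).
have low : (S%:E <= J)%E.
  rewrite /S -rect; apply: le_integral_ge0 => x _.
    by apply: integral_ge0 => y _; rewrite lee_fin sumr_ge0.
  apply: le_integral_ge0 => y _; first by rewrite lee_fin sumr_ge0.
  by rewrite fin lee_fin; have /andP[] := entry_prob_bounds x y.
have high : (J <= (S + N)%:E)%E.
  have -> : S + N = \sum_(c | goodc c || ~~ mx_injb c) \int[power2 k l]_w class_density W f c w.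
    rewrite /S /N [RHS](bigID (@mx_injb q k l)) /=; congr (_ + _); apply: eq_bigl => c.
      by rewrite /goodc; case: (mx_injb c); rewrite ?andbF ?orbF ?andbT.
    by rewrite /goodc; case: (mx_injb c); rewrite ?andbF ?orbF ?andbT.
  rewrite -rect; apply: le_integral_ge0 => x _.
    by apply: integral_ge0 => y _; exact: measure_ge0.
  apply: le_integral_ge0 => y _; first exact: measure_ge0.
  rewrite fin lee_fin; have /andP[_ /le_trans] := entry_prob_bounds x y; apply.
  rewrite [leRHS](bigID (@mx_injb q k l)) /=; rewrite le_eqVlt; apply/orP; left; apply/eqP.
  by congr (_ + _); apply: eq_bigl => c; rewrite /goodc; case: (mx_injb c); rewrite ?andbF ?orbF ?andbT.
have Jfin : J \is a fin_num.
  by rewrite fin_numE; apply/andP; split; apply/eqP => JE; move: low high; rewrite JE ?leeNy_eq ?leye_eq.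
exists ((k`! * l`!)%:R * fine J); split; first by rewrite EFinM fineK.
by rewrite /= !ler_wpM2l // -lee_fin fineK.
Qed.

End pattern.
End density_bounds.

(** * The approximation theorem *)

Lemma ffact_ratio_prod (R : realFieldType) p k l : (0 < p)%N ->
  `|1 - (k`! * 'C(p, k))%:R / p%:R ^+ k * ((l`! * 'C(p, l))%:R / p%:R ^+ l)| <=
  (k ^ 2 + l ^ 2)%:R / p%:R :> R.
Proof.
move=> p0; have pR : (0 : R) < p%:R by rewrite ltr0n.
have xk h : 1 - (h ^ 2)%:R / p%:R <= ((h`! * 'C(p, h))%:R / p%:R ^+ h : R) <= 1.
  rewrite mulnC bin_ffact; apply/andP; split; first exact: ffact_ratio_ge.
  rewrite ler_pdivrMr ?exprn_gt0 // mul1r.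
  by rewrite -natrX ler_nat ffact_le_exp.
have x0 h : 0 <= (h`! * 'C(p, h))%:R / p%:R ^+ h :> R by rewrite divr_ge0 ?exprn_ge0.
have /andP[a1 a2] := xk k; have /andP[b1 b2] := xk l.
have := x0 k; have := x0 l; move: a1 a2 b1 b2.
set x := _%:R / p%:R ^+ k; set y := _%:R / p%:R ^+ l.
rewrite natrD mulrDl; set u := _ / p%:R; set v := _ / p%:R.
move=> a1 a2 b1 b2 y0 x0'.
have xy1 : x * y <= 1 by rewrite mulr_ile1.
rewrite ger0_norm ?subr_ge0 //.
have : x - x * y <= 1 - y.
  have -> : x - x * y = x * (1 - y) by ring.
  by rewrite ler_piMl // subr_ge0.
lra.
Qed.

Section approximation.
Context (R : realType) d (Omega : measurableType d) (mu : probability Omega R).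
Variables (W : Omega * Omega -> pprobability R R) (f : Omega -> R).
Hypothesis HWf : latinon mu W f.

(** The term in [1 / q], due to patterns with two entries in one class, occurs twice: once for the
    Latin square and once for the Latinon, to which the bound is transferred from the weights of the
    sample. *)
Lemma latin_square_approximation (K q : nat) (eps : R) : (0 < q)%N -> 0 < eps ->
  exists n (L : 'M['I_n]_n), [/\ (K <= n)%N, latin_square L &
    forall k l (A : 'M['I_(k * l)]_(k, l)), (k <= K)%N -> (l <= K)%N ->
    exists r, latinon_density mu W f A = r%:E /\
      `|density R A L - r| <= 2%:R * ((k`! * l`!)%:R * ((k * l) ^ 2)%:R / q%:R) + eps].
Proof.
move=> q0 eps0; have qR : (0 : R) < q%:R by rewrite ltr0n.
pose Q k l := #|{: 'M['I_q]_(k, l)}|.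
pose Err k l : R := (Q k l)%:R * ((k`! * l`!)%:R * (k * l)%:R * (18%:R * q%:R)).
pose Wt k l : R := (Q k l)%:R * (k`! * l`!)%:R.
have Err0 k l : 0 <= Err k l by rewrite !mulr_ge0.
have Wt0 k l : 0 <= Wt k l by rewrite !mulr_ge0.
(* Dominates the error constants of all sizes up to [K]; [eta] is scaled so that each error is at
   most [eps / 8]. *)
pose S := \sum_(k < K.+1) \sum_(l < K.+1) (Err k l + Wt k l).
have S_ge k l : (k <= K)%N -> (l <= K)%N -> Err k l + Wt k l <= S.
  move=> kK lK; have kK' : (k < K.+1)%N by []. have lK' : (l < K.+1)%N by [].
  rewrite /S (bigD1 (Ordinal kK')) //= (bigD1 (Ordinal lK')) //= -addrA lerDl.
  by rewrite addr_ge0 // ?sumr_ge0 // => *; rewrite ?sumr_ge0 // => *; rewrite addr_ge0.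
have S0 : 0 <= S.
  by apply: le_trans (S_ge 0%N 0%N _ _) => //; rewrite addr_ge0.
pose eta := eps / (8%:R * (S + 1)).
have eta0 : 0 < eta by rewrite divr_gt0 // mulr_gt0 // ltr_wpDl.
have Seta : S * eta <= eps / 8%:R.
  have -> : eps / 8%:R = (S + 1) * eta by rewrite /eta; field; lra.
  by apply: ler_wpM2r; [exact: ltW|rewrite lerDl].
pose delta := Num.min eta (8%:R * q%:R)^-1.
have delta0 : 0 < delta by rewrite lt_min eta0 invr_gt0 mulr_gt0.
have delta_eta : delta <= eta by rewrite ge_min lexx.
have delta1 : 8%:R * q%:R * delta <= 1.
  rewrite -ler_pdivlMl ?mulr_gt0 // mulr1 ge_min lexx orbT //.
(* [delta ^+ 3] is what trimming asks of the row and column defects; [eta ^+ 2] makes pattern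
   densities, controlled through squares, correct up to [eta]. *)
pose zeta := Num.min (delta ^+ 3) (eta ^+ 2).
have zeta0 : 0 < zeta by rewrite lt_min !exprn_gt0.
(* Large enough that [tot] is within [eps / 4] of 1. *)
pose P0 := maxn K (Num.trunc (8%:R * (K ^ 2)%:R / eps)).+1.
have [p [X [Y [[P0p p0] [Xinj Yinj] near rows cols]]]] :=
  exists_sample HWf q0 K P0 zeta0.
have pR : (0 : R) < p%:R by rewrite ltr0n.
have Kp : (K <= p)%N := leq_trans (leq_maxl _ _) P0p.
have p_large : 2%:R * (K ^ 2)%:R / p%:R <= eps / 4%:R.
  rewrite ler_pdivrMr //.
  have : 8%:R * (K ^ 2)%:R / eps <= p%:R.
    apply: le_trans (ltW (truncnS_gt _)) _; rewrite ler_nat.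
    exact: leq_trans (leq_maxr _ _) P0p.
  rewrite ler_pdivrMr //; lra.
have [s [sinj s_lt]] := exists_sorting Xinj.
have [t [tinj t_lt]] := exists_sorting Yinj.
pose w := @sample_array R d Omega W q p X Y s t.
have wE k l (c : 'M['I_q]_(k, l)) := ustat_pattern_weight W sinj tinj s_lt t_lt c.
have w0 a b c : 0 <= w a b c by have /andP[] := class_prob01 W c (tnth X (s a), tnth Y (t b)).
have w1 a b : \sum_c w a b c = 1 by exact: class_prob_sum.
have zd : zeta * p%:R <= delta ^+ 3 * p%:R by rewrite ler_wpM2r // ge_min lexx.
have w_row : \sum_a \sum_c ((\sum_b w a b c) / p%:R - q%:R^-1) ^+ 2 <= delta ^+ 3 * p%:R.
  by rewrite (sample_array_rows W q X Y sinj tinj); exact: le_trans rows zd.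
have w_col : \sum_b \sum_c ((\sum_a w a b c) / p%:R - q%:R^-1) ^+ 2 <= delta ^+ 3 * p%:R.
  by rewrite (sample_array_cols W q X Y sinj tinj); exact: le_trans cols zd.
have [n [L [pn Llat LA]]] := latin_of_weights p0 q0 delta0 delta1 w0 w1 w_row w_col.
exists n, L; split=> //; first exact: leq_trans pn.
move=> k l A kK lK.
have [r [rE rb]] := latinon_density_bounds HWf q0 A.
exists r; split=> //.
have [] := LA k l A (leq_trans kK Kp) (leq_trans lK Kp).
set N := (k`! * l`!)%:R; set col := N * _ / _; set tot := (_ / _ * (_ / _)).
set err := _%:R * (N * _ * _); rewrite -/w.
move=> dA dN.
pose T (c : 'M['I_q]_(k, l)) := \int[(prod_prob (fun _ : 'I_k => mu) \x prod_prob (fun _ : 'I_l => mu))%E]_z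
  class_density W f c z.
have weight_near (P : pred 'M['I_q]_(k, l)) :
    `|\sum_(c | P c) pattern_weight w c - N * \sum_(c | P c) T c| <= Wt k l * eta.
  rewrite mulr_sumr -sumrB; apply: le_trans (ler_norm_sum _ _ _) _.
  apply: (@le_trans _ _ (\sum_(c : 'M['I_q]_(k, l)) N * eta)).
    rewrite big_mkcond; apply: ler_sum => c _; case: ifP => _; last by rewrite mulr_ge0 //; exact: ltW.
    rewrite -wE -mulrBr normrM ger0_norm // ler_wpM2l //.
    rewrite -ler_sqr ?nnegrE ?normr_ge0 //; last exact: ltW.
    rewrite real_normK ?num_real //; apply: le_trans (near k l c kK lK) _.
    by rewrite ge_min lexx orbT.
  by rewrite sumr_const -[leLHS]mulr_natl mulrA.
have SK := S_ge k l kK lK.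
have err_le : err <= eps / 8%:R.
  have -> : err = Err k l * delta by rewrite /err /Err; ring.
  apply: le_trans Seta; apply: ler_pM => //; first exact: ltW.
  by apply: le_trans SK; rewrite lerDl.
have Wt_le : Wt k l * eta <= eps / 8%:R.
  apply: le_trans Seta; rewrite ler_wpM2r //; first exact: ltW.
  by apply: le_trans SK; rewrite lerDr.
have tot_le : `|1 - tot| <= eps / 4%:R.
  apply: le_trans (ffact_ratio_prod R k l p0) _; apply: le_trans p_large.
  rewrite ler_wpM2r ?invr_ge0 // -natrM ler_nat mul2n -addnn.
  by rewrite leq_add // leq_sqr.
have := weight_near (fun c => mx_injb c && struct_equiv c A).
have := weight_near (fun c => ~~ mx_injb c).
move: rb dA dN; rewrite -/N /=.
set SA := \sum_(c | _ && _) pattern_weight w c; set SN := \sum_(c | ~~ _) pattern_weight w c.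
set TA := \sum_(c | _ && _) T c; set TN := \sum_(c | ~~ _) T c.
rewrite mulrDr => /andP[r1 r2]; rewrite !ler_norml => /andP[a1 a2] b /andP[c1 c2] /andP[e1 e2].
move: r1 r2; rewrite -/TA -/TN => r1 r2.
(* The budget: [err] and [Wt k l * eta] at most twice each, at [eps / 8], and [eps / 4] for [tot],
   which stays below [eps]. *)
by apply/andP; split; lra.
Qed.

End approximation.

Theorem theorem3p13 (R : realType) (d : measure_display)
    (Omega : measurableType d) (mu : probability Omega R)
    (Hsep : separable mu) (Hatomless : atomless mu)
    (W : Omega * Omega -> pprobability R R) (f : Omega -> R)
    (HWf : latinon mu W f) :
  exists (n : nat -> nat) (L : forall m, 'M['I_(n m)]_(n m)),
    (forall m, latin_square (L m)) /\ left_converges mu L W f.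
Proof.
(* With [m.+1] classes, accuracy [1 / m.+1] and sizes up to [m], every size is eventually covered
   and both errors vanish. *)
have H m : exists z : {n : nat & 'M['I_n]_n},
    [/\ (m <= projT1 z)%N, latin_square (projT2 z) &
    forall k l (A : 'M['I_(k * l)]_(k, l)), (k <= m)%N -> (l <= m)%N ->
    exists r, latinon_density mu W f A = r%:E /\
      `|density R A (projT2 z) - r| <=
        2%:R * ((k`! * l`!)%:R * ((k * l) ^ 2)%:R / m.+1%:R) + m.+1%:R^-1].
  have m0 : (0 : R) < m.+1%:R^-1 by rewrite invr_gt0.
  have [n [L [mn Llat LA]]] := latin_square_approximation HWf m (ltn0Sn m) m0.
  by exists (existT (fun n => 'M['I_n]_n) n L).
have [g gP] := choice H.
exists (fun m => projT1 (g m)), (fun m => projT2 (g m)); split.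
  by move=> m; have [] := gP m.
split.
  apply/cvgnyPge => B; near=> m.
  have [mn _ _] := gP m; apply: leq_trans mn.
  by near: m; exact: nbhs_infty_ge.
move=> k l A _ _ _.
(* The index [maxn k l] is large enough to see that the limit is a finite real [r]. *)
have [_ _ /(_ k l A (leq_maxl _ _) (leq_maxr _ _))[r [rE _]]] := gP (maxn k l).
rewrite rE; apply: cvg_EFin; first by near=> m.
pose C : R := 2%:R * ((k`! * l`!)%:R * ((k * l) ^ 2)%:R) + 1.
apply/cvgrPdist_le => eps eps0; near=> m.
have kl_m : (maxn k l <= m)%N by near: m; exact: nbhs_infty_ge.
move: kl_m; rewrite geq_max => /andP[km lm].
have [_ _ /(_ k l A km lm)[r' [rE']]] := gP m.
have -> : r' = r by apply: EFin_inj; rewrite -rE -rE'.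
rewrite distrC => le; apply: le_trans le _.
have -> : 2%:R * ((k`! * l`!)%:R * ((k * l) ^ 2)%:R / m.+1%:R) + m.+1%:R^-1 = C / m.+1%:R.
  by rewrite /C; ring.
rewrite ler_pdivrMr ?ltr0n // mulrC -ler_pdivrMr //.
have : ((Num.trunc (C / eps)).+1 <= m)%N by near: m; exact: nbhs_infty_ge.
move=> Cm; apply: le_trans (ltW (truncnS_gt _)) _; rewrite ler_nat.
exact: leqW.
Unshelve. all: by end_near.
Qed.
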